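(* Let $n\geq 1$ and let $Y=OG(n,2n+1)$ be the odd orthogonal Grassmannian parametrizing $n$-dimensional isotropic linear subspaces of $\mathbb{C}^{2n+1}$ with respect to a nondegenerate orthogonal form, with Schubert classes $\tau_\lambda\in H^*(Y,\mathbb{Z})$ indexed by strict partitions $\lambda\subset\rho_n=(n,n-1,\ldots,1)$. For all strict partitions $\lambda,\mu,\nu\subset\rho_n$, the constant $f(\lambda,\mu;\nu)$, i.e. the number of LRS tableaux of shape $\mathcal{S}(\lambda^\vee/\mu)$ with content $\nu^\vee$ (taken to be $0$ if $\mu\not\subset\lambda^\vee$), is the coefficient of $\tau_\nu$ in the expansion of the cup product $\tau_\lambda\cdot\tau_\mu$ in the basis of Schubert classes.
   Context: A strict partition is a partition with distinct (positive) parts. $\rho_n=(n,n-1,\ldots,1)$. For a strict $\lambda\subset\rho_n$, $\lambda^\vee\subset\rho_n$ is the strict partition whose parts complement the parts of $\lambda$ in $\{1,\ldots,n\}$. The shifted diagram $\mathcal{S}(\lambda)$ is obtained from the Young diagram of $\lambda$ by indenting the $i$th row by $i-1$ columns, for each $i\geq1$; $\mathcal{S}(\lambda/\mu)=\mathcal{S}(\lambda)\smallsetminus\mathcal{S}(\mu)$. Schubert classes: for a fixed complete isotropic flag $F_\bullet$ of $\mathbb{C}^{2n+1}$, $\tau_\lambda\in H^{2|\lambda|}(Y,\mathbb{Z})$ is the class dual to the Schubert variety $\{\Sigma\in Y:\dim(\Sigma\cap F_{n+1-\lambda_i})\geq i\text{ for }1\leq i\leq\ell(\lambda)\}$, where $\ell(\lambda)$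 is the number of parts. The $\tau_\lambda$ for strict $\lambda\subset\rho_n$ form a $\mathbb{Z}$-basis of $H^*(Y,\mathbb{Z})$. They satisfy the (known) Pieri rule: for $1\leq p\leq n$, $\tau_p\cdot\tau_\lambda=\sum 2^{N(\widetilde\lambda/\lambda)}\tau_{\widetilde\lambda}$, where $\tau_p=\tau_{(p)}$, the sum is over strict $\widetilde\lambda\subset\rho_n$ obtained from $\lambda$ by adding a horizontal strip of length $p$ (i.e. $p$ boxes, no two in the same column of the unshifted Young diagram), and $N(\widetilde\lambda/\lambda)$ is one less than the number of border strip components (edge-connected components) of $\mathcal{S}(\widetilde\lambda/\lambda)$. Here a border strip is an edge-connected skew diagram containing no $2\times2$ block of squares; in this situation $\mathcal{S}(\widetilde\lambda/\lambda)$ is a union of border strips. The paper's treatment takes as granted only that the $\tau_\lambda$ form a basis and that the Pieri rule holds. Let $A$ be the ordered alphabet $1'<1<2'<2<\cdots$; the symbols $1',2',\ldots$ are marked, the symbols $1,2,\ldots$ unmarked. A shifted tableau $T$ on $\mathcal{S}(\lambda/\mu)$ is a filling of the boxes with symbols from $A$ such that (i) the entries are weakly increasing along each row and down each column, and (ii) each row contains at most one $i'$ and each column contains at most one $i$, for every integer $i\geq1$. The content of $T$ is the sequence whose $i$th part is the number of boxes with entry $i$ or $i'$. The word $w(T)$ is obtained by reading the entries of $T$ from right to left in successive rows, starting with the top row. For an integer $i$ set $\widehat{i'}=i$ and $\widehat{i}=(i+1)'$. For a word $w=w_1w_2\cdots w_p$ in $A$ write $\widehat{w}=\widehat{w}_p\cdots\widehat{w}_2\widehat{w}_1$.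 The word $w$ is an LRS word if (i) in the concatenation $w\widehat{w}$, every $i$ or $i'$ is preceded by more occurrences of the (unmarked) symbol $i-1$ than of the (unmarked) symbol $i$, for all $i\geq2$; and (ii) the last occurrence of $i'$ in $w$ (if any) is followed by at least one $i$ in $w$, for all $i\geq1$. $T$ is a Littlewood-Richardson-Stembridge tableau (LRS tableau) if $w(T)$ is an LRS word. *)

(* Defs.v *)
From HB Require Import structures.
From mathcomp Require Import all_boot all_order all_algebra.

Set Implicit Arguments.
Unset Strict Implicit.
Unset Printing Implicit Defensive.

Import GRing.Theory.

Definition strict_partition (s : seq nat) : bool := sorted gtn s && (0 \notin s).

Definition included (s t : seq nat) : bool :=
  all (fun i => nth 0 s i <= nth 0 t i) (iota 0 (size s)).

Definition rho (n : nat) : seq nat := rev (iota 1 n).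

Record spart (n : nat) := SPart {
  parts :> seq nat;
  partsP : strict_partition parts && included parts (rho n)
}.

HB.instance Definition _ n := [isSub for @parts n].
HB.instance Definition _ n := [Countable of spart n by <:].

Lemma rho_sorted n : sorted gtn (rho n).
Proof. by rewrite /rho rev_sorted; exact: iota_ltn_sorted. Qed.

Lemma mem_rho n x : (x \in rho n) = (0 < x <= n).
Proof. by rewrite mem_rev mem_iota add1n ltnS. Qed.

Lemma spart_mem_rho n (s : spart n) : {subset parts s <= rho n}.
Proof.
case: s => [[|a s]] //= /andP[/andP[/= s_dec s_pos] /= /andP[a_le _]] x x_s.
rewrite mem_rho lt0n; apply/andP; split.
  by apply: contraNneq s_pos => <-.
apply: leq_trans (_ : x <= a) _.
  move: x_s; rewrite inE => /predU1P[-> //|x_s].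
  have gtn_tr : transitive gtn by move=> y z t yz /ltn_trans; apply.
  by apply/ltnW/(allP (order_path_min gtn_tr s_dec)).
apply: leq_trans a_le _; case: n => [//|n].
by rewrite /= nth_rev ?size_iota // subn1 /= -/(iota 1 n.+1) nth_iota.
Qed.

Lemma spart_filter n (s : spart n) : parts s = [seq x <- rho n | x \in parts s].
Proof.
have gtn_tr : transitive gtn by move=> y z t yz /ltn_trans; apply.
apply: (irr_sorted_eq gtn_tr) => [x||| x]; first exact: ltnn.
- by have /andP[/andP[]] := partsP s.
- by apply: sorted_filter => //; exact: rho_sorted.
by rewrite mem_filter; apply/idP/andP => [xs|[]//]; split=> //; exact: spart_mem_rho xs.
Qed.

Definition spart_to_set n (s : spart n) : {set 'I_n.+1} :=
  [set i : 'I_n.+1 | val i \in parts s].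

Definition set_to_spart n (A : {set 'I_n.+1}) : option (spart n) :=
  insub [seq x <- rho n | inord x \in A].

Lemma spart_to_setK n : pcancel (@spart_to_set n) (@set_to_spart n).
Proof.
move=> s; rewrite /set_to_spart.
suff -> : [seq x <- rho n | inord x \in spart_to_set s] = val s by rewrite valK.
rewrite /= [RHS]spart_filter; apply: eq_in_filter => x.
by rewrite mem_rho inE => /andP[_ x_n]; rewrite /= inordK.
Qed.

HB.instance Definition _ n : isFinite (spart n) := PCanIsFinite (@spart_to_setK n).

Fact empty_spartP n : strict_partition [::] && included [::] (rho n).
Proof. by []. Qed.

Definition empty_spart n : spart n := SPart (empty_spartP n).

Fact row_spartP n p (p_n : 0 < p <= n) :
  strict_partition [:: p] && included [:: p] (rho n).
Proof.
case/andP: p_n => p_gt0 p_n.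
rewrite /strict_partition /included /= inE eq_sym -lt0n p_gt0 /= andbT.
apply: leq_trans p_n _; case: n => [//|n].
by rewrite nth_rev ?size_iota // subn1 nth_iota.
Qed.

Definition row_spart n p (p_n : 0 < p <= n) : spart n := SPart (row_spartP p_n).

Definition dual_part (n : nat) (s : seq nat) : seq nat :=
  [seq x <- rho n | x \notin s].

(* Boxes are pairs (row, column), both counted from 0.  Diagrams are listed in
   reading order: rows from top to bottom, each row from right to left. *)
Definition young (s : seq nat) : seq (nat * nat) :=
  [seq (i, j) | i <- iota 0 (size s), j <- rev (iota 0 (nth 0 s i))].

Definition shifted (s : seq nat) : seq (nat * nat) :=
  [seq (b.1, b.1 + b.2) | b <- young s].

Definition skew_young (s t : seq nat) : seq (nat * nat) :=
  [seq b <- young s | b \notin young t].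

Definition skew_shifted (s t : seq nat) : seq (nat * nat) :=
  [seq b <- shifted s | b \notin shifted t].

Definition adjacent (b c : nat * nat) : bool :=
  [|| (b.1 == c.1) && ((b.2 == c.2.+1) || (c.2 == b.2.+1))
    | (b.2 == c.2) && ((b.1 == c.1.+1) || (c.1 == b.1.+1))].

Definition num_components (D : seq (nat * nat)) : nat :=
  n_comp (fun b c : seq_sub D => adjacent (val b) (val c)) predT.

Definition horizontal_strip (t s : seq nat) (p : nat) : bool :=
  [&& included s t, sumn t == sumn s + p & uniq [seq b.2 | b <- skew_young t s]].

(* A horizontal strip of positive length has at least one component, so the
   truncated predecessor is harmless for p > 0. *)
Definition pieri_exp (t s : seq nat) : nat := (num_components (skew_shifted t s)).-1.

Definition Zcomb (H : zmodType) (I : finType) (tau : I -> H) (c : {ffun I -> int}) : H :=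
  (\sum_i tau i *~ c i)%R.

Definition Zbasis (H : zmodType) (I : finType) (tau : I -> H) : Prop :=
  (forall x, exists c, x == Zcomb tau c) /\ injective (Zcomb tau).

Definition Zcoef (H : zmodType) (I : finType) (tau : I -> H) (hB : Zbasis tau)
    (x : H) (i : I) : int :=
  xchoose (hB.1 x) i.

Lemma ZcoefK (H : zmodType) (I : finType) (tau : I -> H) (hB : Zbasis tau) (x : H) :
  (x = \sum_i tau i *~ Zcoef hB x i)%R.
Proof. exact/eqP/(xchooseP (hB.1 x)). Qed.

Lemma Zcoef_unique (H : zmodType) (I : finType) (tau : I -> H) (hB : Zbasis tau)
    (c : {ffun I -> int}) (i : I) :
  Zcoef hB (Zcomb tau c) i = c i.
Proof.
rewrite /Zcoef; congr (fun_of_fin _ i).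
by apply: hB.2; apply/esym/eqP/(xchooseP (hB.1 (Zcomb tau c))).
Qed.

(* The ring H^*(OG(n, 2n+1), Z) with its Schubert classes is presented by the
   following properties.  They determine it up to a unique isomorphism matching
   the classes: over Q every tau_lambda is a polynomial in the tau_p applied to
   tau_empty = 1, and H is torsion free.  The class tau_empty is dual to the
   whole variety, hence is the unit; this is not a consequence of the Pieri rule
   for p > 0 (replace tau_empty by tau_empty + tau_rho). *)
Record schubert_classes (n : nat) (H : comNzRingType) (tau : spart n -> H) : Prop := {
  schubert_basis : Zbasis tau;
  schubert_unit : tau (empty_spart n) = 1%R;
  schubert_pieri : forall p (p_n : 0 < p <= n) (lam : spart n),
    (tau (row_spart p_n) * tau lam =
     \sum_(lam' : spart n | horizontal_strip lam' lam p)
        tau lam' *+ 2 ^ pieri_exp lam' lam)%R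
}.

(* The symbol i is (i, true) and i' is (i, false); symbols of the alphabet
   have i >= 1. *)
Definition letter : Type := (nat * bool)%type.
Definition unmarked (i : nat) : letter := (i, true).
Definition marked (i : nat) : letter := (i, false).

(* 1' < 1 < 2' < 2 < ... *)
Definition leq_letter (a b : letter) : bool :=
  (a.1 < b.1) || (a.1 == b.1) && (a.2 ==> b.2).

Definition hat (a : letter) : letter :=
  if a.2 then marked a.1.+1 else unmarked a.1.

Definition hat_word (w : seq letter) : seq letter := rev [seq hat a | a <- w].

Definition lattice_word (v : seq letter) : bool :=
  [forall p : 'I_(size v),
     let i := (nth (unmarked 0) v p).1 in
     (2 <= i) ==>
       (count_mem (unmarked i) (take p v) < count_mem (unmarked i.-1) (take p v))].

(* Position p carries the last occurrence of i' in w. *)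
Definition last_marked (w : seq letter) (p i : nat) : bool :=
  (nth (unmarked 0) w p == marked i) && (marked i \notin drop p.+1 w).

Definition LRS_word (w : seq letter) : bool :=
  lattice_word (w ++ hat_word w) &&
  [forall p : 'I_(size w),
     let i := (nth (unmarked 0) w p).1 in
     last_marked w p i ==> (unmarked i \in drop p.+1 w)].

Section Tableaux.
Variable D : seq (nat * nat).
Implicit Type T : seq_sub D -> letter.

Definition shifted_tableau T : bool :=
  [&& [forall b, 0 < (T b).1],
      [forall b, forall c, ((val b).1 == (val c).1) && ((val b).2 <= (val c).2) ==>
        leq_letter (T b) (T c)],
      [forall b, forall c, ((val b).2 == (val c).2) && ((val b).1 <= (val c).1) ==>
        leq_letter (T b) (T c)],
      [forall b, forall c,
        [&& (val b).1 == (val c).1, T b == T c & ~~ (T b).2] ==> (b == c)]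
    & [forall b, forall c,
        [&& (val b).2 == (val c).2, T b == T c & (T b).2] ==> (b == c)]].

(* The sequence stops at the largest integer occurring in T; later terms are 0. *)
Definition content T : seq nat :=
  mkseq (fun i => #|[set b | (T b).1 == i.+1]|) (\max_b (T b).1).

Definition word T : seq letter := [seq T b | b <- pmap insub D].

Definition LRS_tableau (kappa : seq nat) T : bool :=
  [&& shifted_tableau T, content T == kappa & LRS_word (word T)].

Lemma eq_LRS_tableau kappa T T' : T =1 T' -> LRS_tableau kappa T = LRS_tableau kappa T'.
Proof.
move=> eqT; rewrite /LRS_tableau /word (eq_map eqT) /content (eq_bigr _ (fun b _ => congr1 fst (eqT b))).
congr [&& _, _ & _].
  rewrite /shifted_tableau; congr [&& _, _, _, _ & _];
  by do ?[apply: eq_forallb => ?]; rewrite ?eqT.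
congr (_ == _); apply: eq_map => i.
by apply: eq_card => b; rewrite !inE eqT.
Qed.

(* Entries of a tableau of content kappa are bounded by size kappa, so that it
   suffices to count fillings with letters in a finite alphabet. *)
Definition bounded_filling (m : nat) : finType := {ffun seq_sub D -> 'I_m.+1 * bool}.

Definition unbound m (T : bounded_filling m) : {ffun seq_sub D -> letter} :=
  [ffun b => (val (T b).1, (T b).2)].

Definition num_LRS (kappa : seq nat) : nat :=
  #|[set T : bounded_filling (size kappa) | LRS_tableau kappa (unbound T)]|.

Lemma unbound_inj m : injective (@unbound m).
Proof.
move=> T T' /ffunP eqT; apply/ffunP=> b; have := eqT b; rewrite !ffunE.
by case: (T b) (T' b) => [i u] [j v] /= [/val_inj-> ->].
Qed.

Lemma num_LRSP (kappa : seq nat) : exists s : seq {ffun seq_sub D -> letter},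
  [/\ uniq s, forall T : {ffun seq_sub D -> letter}, (T \in s) = LRS_tableau kappa T & size s = num_LRS kappa].
Proof.
pose A := [set U : bounded_filling (size kappa) | LRS_tableau kappa (unbound U)].
exists [seq unbound U | U <- enum A].
split; last by rewrite size_map -cardE.
  by rewrite map_inj_uniq ?enum_uniq //; exact: unbound_inj.
move=> T; apply/mapP/idP => [[U]|LT]; first by rewrite mem_enum inE => ? ->.
have bnd b : (T b).1 < (size kappa).+1.
  rewrite ltnS; have /and3P[_ /eqP<- _] := LT; rewrite size_mkseq.
  exact: (leq_bigmax_cond (F := fun b => (T b).1)).
have eT : unbound (m := size kappa) [ffun b => (Ordinal (bnd b), (T b).2)] = T.
  by apply/ffunP=> b; rewrite !ffunE /=; case: (T b).
by exists [ffun b => (Ordinal (bnd b), (T b).2)]; rewrite ?mem_enum ?inE eT.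
Qed.

End Tableaux.

Definition f_LRS (n : nat) (lam mu nu : seq nat) : nat :=
  if included mu (dual_part n lam)
  then num_LRS (skew_shifted (dual_part n lam) mu) (dual_part n nu)
  else 0.

(* Main.v *)
Require Import Defs.
From mathcomp Require Import all_boot all_order all_algebra.
From mathcomp Require Import zify.

Set Implicit Arguments.
Unset Strict Implicit.
Unset Printing Implicit Defensive.

(** The proof turns tableaux into words and multiplies words by jeu de taquin.

   A strict partition grows by one box at a time, and the box is determined by its
   content, that is, column minus row in the shifted diagram.  So a list of contents
   is a path of strict partitions ([legal], [run]).  A filling of a skew diagram is
   recorded by the contents of its boxes, letter by letter, for each letter [i] first
   the boxes [i'] downwards, then the boxes [i] upwards.  A Littlewood-Richardson-
   Stembridge tableau becomes a word whose blocks are hook words, and the lattice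
   condition becomes inequalities between counts in consecutive blocks
   ([ballot_pair]).  No tableau is lost in this way: the boxes of a word are recovered
   by [linear_extension], the entries by [filling_word] and [blocks_fill], and the
   order in which boxes are read may be replaced by the order of their contents
   ([LRS_reading]).  Hence f(lam, mu; nu) is the number [lr lam mu nu] of such words
   from mu to the complement of lam ([num_LRS_words]).

   The Pieri coefficients also count words: a horizontal strip of length p with k
   components underlies 2 ^ (k - 1) hook words of length p, because the mark of a box
   is forced except at the lowest box of each component, and the lowest box of all is
   unmarked ([pieri_hook_words]).

   A slide [pass] moves a box through a word.  Iterated slides [infuse] turn a hook
   word followed by a word of LRS type into a word of LRS type followed by a hook word,
   bijectively, with the same start and end.  Reversal and complements turn the removal
   of a strip from the complement of lam into the addition of a strip to lam.  Together
   this says that multiplying lam or mu by tau_p has the same effect on [lr]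
   ([lr_comm]).  Since tau of the empty partition is the unit, and [lr] has the matching
   value there ([lr_empty]), induction on mu gives the theorem: if p is the smallest
   part of mu, then tau_p times the class of the remaining parts is the class of mu plus
   classes of smaller weight ([new_part_heaviest], [schubert_product]).

   The main difficulty is that slides preserve the ballot inequalities in both
   directions.  A slide through a hook word exchanges one content in its decreasing and
   one in its increasing run; the inequalities survive because the path of the hole
   forces some room in them ([pass_ballot]).  The converse
   ([pass_ballot_conv]) uses no such analysis.  The slide is embedded into a staircase,
   where [infuse] is an injection between two finite sets of words whose sizes agree by
   duality, so that it is onto ([infuse_onto]). *)

(** * Paths of strict partitions *)

(** The number of boxes of the shifted diagram on the [z]-th diagonal. *)
Definition cnt (s : seq nat) (z : nat) : nat := count (ltn z) s.

(* Abstracts counts before calling [lia], which may otherwise fail to identify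
   convertible instances of a count. *)
Ltac clia := repeat match goal with
  | |- context [count ?p ?w] => move: (count p w) => ?
  | |- context [cnt ?s ?z] => move: (cnt s z) => ?
  end; lia.

Lemma gtn_trans : transitive gtn.
Proof. by move=> y x z /= yx zy; apply: ltn_trans zy yx. Qed.

Lemma strict_eq s t : strict_partition s -> strict_partition t -> s =i t -> s = t.
Proof.
move=> /andP[ss _] /andP[st _]; apply: (irr_sorted_eq gtn_trans) => // x.
exact: ltnn.
Qed.

Lemma strict_uniq s : strict_partition s -> uniq s.
Proof. by case/andP=> ss _; apply: (sorted_uniq gtn_trans) ss => x; exact: ltnn. Qed.

Lemma strict_cons a s : strict_partition (a :: s) -> strict_partition s.
Proof.
rewrite /strict_partition inE negb_or /= => /andP[/path_sorted-> /andP[_ ->]] //.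
Qed.

Lemma strict_lt a s : strict_partition (a :: s) -> forall x, x \in s -> x < a.
Proof. by case/andP=> /(order_path_min gtn_trans)/allP h _ x /h. Qed.

Lemma cntS s z : strict_partition s -> cnt s z = cnt s z.+1 + (z.+1 \in s).
Proof.
move=> /strict_uniq us; rewrite -(count_uniq_mem _ us) /cnt -count_predUI addnC.
rewrite [X in X + _](_ : _ = 0) ?add0n.
  by apply: eq_count => x /=; rewrite [z < x]leq_eqVlt orbC eq_sym.
by apply/eqP; rewrite -leqn0 leqNgt -has_count; apply/hasP => -[x _ /= /andP[h /eqP]]; lia.
Qed.

Lemma cnt_eventually s : exists n, forall z, n <= z -> cnt s z = 0.
Proof.
exists (\max_(x <- s) x) => z hz; apply/eqP; rewrite -leqn0 leqNgt -has_count.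
apply/hasP=> -[x xs /=].
by have := @leq_bigmax_seq _ s predT id x xs isT; move=> /=; lia.
Qed.

Lemma cnt_mono s y z : y <= z -> cnt s z <= cnt s y.
Proof. by move=> yz; apply: sub_count => x /=; lia. Qed.

Lemma cnt_drop s y z : strict_partition s -> y <= z -> cnt s y <= cnt s z + (z - y).
Proof.
move=> hs /subnK <-; elim: (z - y) => [|k IH]; first by rewrite add0n subnn addn0.
have := cntS (k + y) hs; rewrite addSn; move: IH; lia.
Qed.

Lemma strict_mem s z : strict_partition s -> z > 0 -> (z \in s) = (cnt s z < cnt s z.-1).
Proof. by move=> hs; case: z => // z _; rewrite /= (cntS z hs); case: (_ \in _); lia. Qed.

Lemma strict_cnt_eq s t : strict_partition s -> strict_partition t ->
  cnt s =1 cnt t -> s = t.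
Proof.
move=> hs ht e; apply: strict_eq => // -[|z].
  by case/andP: hs => _ /negbTE->; case/andP: ht => _ /negbTE->.
by rewrite !strict_mem //= !e.
Qed.

(** Both sides say that row [r] of the shifted diagram has a box on the diagonal [z]. *)
Lemma cnt_nth s r z : strict_partition s -> (r < cnt s z) = (z < nth 0 s r).
Proof.
elim: s r => [|a s IH] r hs; first by rewrite nth_nil.
have {}IH := IH _ (strict_cons hs); rewrite /cnt /= -/(cnt s z).
have hl : z < a \/ cnt s z = 0.
  case: (ltnP z a) => za; [by left | right].
  apply/eqP; rewrite -leqn0 leqNgt -has_count; apply/hasP=> -[x xs /=].
  by have := strict_lt hs xs; lia.
case: r => [|r] /=; first by case: hl => h; lia.
rewrite -IH; case: (ltnP z a) hl => za [] h //; lia.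
Qed.

(** A new box on the diagonal [x] lengthens a part [x]; on the main diagonal it
   starts a new row. *)
Definition addable (s : seq nat) (x : nat) : bool :=
  ((x == 0) || (x \in s)) && (x.+1 \notin s).

(** Turns the part [x] into [x.+1]; for [x = 0] the index is out of range and a
   new part [1] is appended. *)
Definition add_box (s : seq nat) (x : nat) : seq nat := set_nth 0 s (index x s) x.+1.

Lemma path_add_box b s x : path gtn b s -> 0 \notin s -> x.+1 < b -> addable s x ->
  path gtn b (add_box s x).
Proof.
elim: s b => [|a s IH] b /=; first by rewrite /add_box /= => _ _ -> .
move=> /andP[ab ps]; rewrite inE negb_or => /andP[a0 s0] xb.
rewrite /addable !inE negb_or => /andP[h /andP[xa xs]].
rewrite /add_box /=; case: eqP => [e|/eqP ne].
  by rewrite /= xb /=; case: s ps {IH xs s0 h} => //= c s /andP[]; lia.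
rewrite [set_nth _ _ _ _]/= /= ab /=; apply: IH => //.
  case/or3P: h => [|/eqP|xs']; [lia|by move=> e; rewrite e eqxx in ne|].
  by have := allP (order_path_min gtn_trans ps) _ xs'; move=> /=; lia.
rewrite /addable xs andbT; case/or3P: h => [->//|/eqP|->]; last by rewrite orbT.
by move=> e; rewrite e eqxx in ne.
Qed.

Lemma strict_add_box s x : strict_partition s -> addable s x ->
  strict_partition (add_box s x).
Proof.
move=> /andP[ss s0] ad; apply/andP; split.
  have hp : path gtn (maxn (head 0 s) x.+1).+1 s.
    by case: s ss {s0 ad} => //= a s ->; rewrite andbT; lia.
  by apply: path_sorted (path_add_box hp s0 _ ad); lia.
apply/negP=> h0; have := mem_nth 0.
case/(nthP 0): h0 => i; rewrite size_set_nth => hi; rewrite nth_set_nth /=.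
case: eqP => // ne e _; case/negP: s0; rewrite -e; apply: mem_nth.
have := index_size x s; rewrite leq_max in hi.
by case/orP: hi => // hi; have := ltnW hi; lia.
Qed.

Lemma cnt_add_box s x z : strict_partition s -> addable s x ->
  cnt (add_box s x) z = cnt s z + (z == x).
Proof.
elim: s => [|a s IH] hs.
  by rewrite /addable in_nil orbF andbT => /eqP->; rewrite /cnt /=; lia.
rewrite /addable !inE negb_or => /andP[h /andP[xa xs]].
rewrite /add_box /=; case: eqP => [<-|/eqP ne]; first by rewrite /cnt /=; lia.
rewrite [set_nth _ _ _ _]/= /cnt /= -/(cnt _ _) IH ?addnA //; first exact: strict_cons hs.
rewrite /addable xs andbT; case/or3P: h => [->//|/eqP|->]; last by rewrite orbT.
by move=> e; rewrite e eqxx in ne.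
Qed.

Lemma mem_add_box s x m : strict_partition s -> addable s x ->
  (m \in add_box s x) = (m == x.+1) || (m \in s) && (m != x).
Proof.
move=> hs ad; have hs' := strict_add_box hs ad; case: m => [|m].
  by case/andP: hs' => _ /negbTE->; case/andP: hs => _ /negbTE->.
rewrite !strict_mem //= !cnt_add_box //.
have := cntS m hs; have := ad; rewrite /addable => /andP[h /negbTE xs].
case: (eqVneq m x) => [->|nx].
  by rewrite xs; move=> ->; lia.
case: (eqVneq m.+1 x) => [e|nx'] ->; last by rewrite !addn0; case: (_ \in _); lia.
by move: h; rewrite -e /= => ->; lia.
Qed.

(** A word lists the contents of boxes that are added one after another. *)
Fixpoint legal (s w : seq nat) : bool :=
  if w is x :: w' then addable s x && legal (add_box s x) w' else true.

Definition run (s w : seq nat) : seq nat := foldl add_box s w.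

Lemma legal_cat s u v : legal s (u ++ v) = legal s u && legal (run s u) v.
Proof. by elim: u s => //= x u IH s; rewrite IH andbA. Qed.

Lemma run_cat s u v : run s (u ++ v) = run (run s u) v.
Proof. exact: foldl_cat. Qed.

Lemma strict_run s w : strict_partition s -> legal s w -> strict_partition (run s w).
Proof. by elim: w s => //= x w IH s hs /andP[a]; apply: IH; apply: strict_add_box. Qed.

Lemma cnt_run s w z : strict_partition s -> legal s w ->
  cnt (run s w) z = cnt s z + count_mem z w.
Proof.
elim: w s => [|x w IH] s hs /=; first by rewrite addn0.
by case/andP=> a l; rewrite IH ?strict_add_box // cnt_add_box // addnA [z == x]eq_sym.
Qed.

(** Two boxes on a diagonal of a skew diagram are separated by the boxes of the
   rectangle that they span. *)
Lemma legal_between s x w1 w2 : strict_partition s -> legal s (x :: w1 ++ x :: w2) ->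
  (x.+1 \in w1) && ((x == 0) || (x.-1 \in w1)).
Proof.
move=> hs /= /andP[a]; rewrite legal_cat => /andP[l1 /= /andP[a' _]].
have hs1 := strict_add_box hs a.
have e z := cnt_run z hs1 l1; have hs2 := strict_run hs1 l1.
have e0 := cnt_add_box _ hs a.
have p y : 0 < count_mem y w1 -> y \in w1 by rewrite -has_count has_pred1.
case/andP: a => hx hx1; case/andP: a' => hx' hx1'.
apply/andP; split.
  by apply: p; have := cnt_mono s (leqnSn x); move: hx1 hx1'; rewrite !strict_mem //= !e !e0 eqxx gtn_eqF //; clear; clia.
case: x => [//|x] /= in hx hx' e0 hx1 hx1' hs1 hs2 l1 e *.
by apply: p; have := cnt_drop hs (leqnSn x); rewrite subSnn; move: hx hx'; rewrite !strict_mem //= !e !e0 eqxx ltn_eqF //; clear; clia.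
Qed.

Lemma legal_neq s x w : strict_partition s -> legal s (x :: x :: w) = false.
Proof. by move=> hs; apply/negP => /(@legal_between s x [::] w hs). Qed.

(** Boxes on diagonals that are neither equal nor neighbours do not interact. *)
Lemma add_box_comm s x y : strict_partition s -> x.+1 < y \/ y.+1 < x ->
  legal s [:: x; y] -> legal s [:: y; x] /\ run s [:: y; x] = run s [:: x; y].
Proof.
move=> hs xy /= /and3P[ax ay _].
have hsx := strict_add_box hs ax.
have ay' : addable s y.
  by move: ay; rewrite /addable !mem_add_box //; case: (y \in s); case: (y.+1 \in s);
    rewrite ?andbT ?andbF ?orbF ?orbT //=; lia.
have hsy := strict_add_box hs ay'.
have ax' : addable (add_box s y) x.
  by move: ax; rewrite /addable !mem_add_box //; case: (x \in s); case: (x.+1 \in s);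
    rewrite ?andbT ?andbF ?orbF ?orbT //=; lia.
split; first by rewrite ay' ax'.
apply: strict_cnt_eq; rewrite ?strict_add_box // => z.
by rewrite !cnt_add_box // -!addnA [(z == x) + _]addnC.
Qed.

(** * Slides *)

Definition adj (h x : nat) : bool := (x == h.+1) || (h == x.+1).

(** The jeu de taquin slide of the word [w] into a hole of content [h], and the
   content of the hole afterwards.  An entry of content [x] moves into the hole
   exactly when the hole is adjacent to its box, which for the next entry to be
   added means that the contents differ by one. *)
Fixpoint pass (h : nat) (w : seq nat) : seq nat * nat :=
  if w is x :: w' then
    if adj h x then let p := pass x w' in (h :: p.1, p.2)
    else let p := pass h w' in (x :: p.1, p.2)
  else ([::], h).

Lemma adj_sym h x : adj h x = adj x h.
Proof. by rewrite /adj orbC. Qed.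

Lemma pass_cat h u v : pass h (u ++ v) =
  let p := pass h u in let q := pass p.2 v in (p.1 ++ q.1, q.2).
Proof.
by elim: u h => [|x u IH] h /=; [case: (pass h v) | case: ifP => _; rewrite IH].
Qed.

Lemma size_pass h w : size (pass h w).1 = size w.
Proof. by elim: w h => //= x w IH h; case: ifP => _ /=; rewrite IH. Qed.

Lemma count_pass h w P :
  count P (pass h w).1 + P (pass h w).2 = count P w + P h.
Proof. by elim: w h => //= x w IH h; case: ifP => _ /=; have := IH x; have := IH h; lia. Qed.

Lemma perm_pass h w : perm_eq ((pass h w).2 :: (pass h w).1) (h :: w).
Proof. by apply/permP => P /=; rewrite addnC count_pass addnC. Qed.

Lemma mem_pass h w y : y \in (pass h w).1 -> y = h \/ y \in w.
Proof.
move=> hy; have : y \in h :: w by rewrite -(perm_mem (perm_pass h w)) inE hy orbT.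
by rewrite inE => /predU1P.
Qed.

Lemma legal_swap s h x w : strict_partition s -> legal s (h :: x :: w) -> ~~ adj h x ->
  legal s (x :: h :: w) /\ run s (x :: h :: w) = run s (h :: x :: w).
Proof.
move=> hs hl hx; have hxn : h <> x by move=> e; move: hl; rewrite e legal_neq.
case/and3P: hl => ah ax lw; have [||] := @add_box_comm s h x hs.
- by move: hx hxn; rewrite /adj; lia.
- by rewrite /= ah ax.
by move=> /= /and3P[-> -> _] e; rewrite /= e.
Qed.

(** An entry that is not adjacent to the hole commutes with it; an entry that moves
   into the hole leaves its own box as the new hole. *)
Lemma pass_legal s h w : strict_partition s -> legal s (h :: w) ->
  legal s (rcons (pass h w).1 (pass h w).2) /\
  run s (rcons (pass h w).1 (pass h w).2) = run s (h :: w).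
Proof.
elim: w s h => [|x w IH] s h hs // hl /=; case: ifP => [_|/negbT hx].
  case/and3P: hl => ah ax lw.
  have [l r] := IH _ x (strict_add_box hs ah) (introT andP (conj ax lw)).
  by split; [rewrite /= ah | exact: r].
have [/andP[ax l] r] := legal_swap hs hl hx.
have [l' r'] := IH _ h (strict_add_box hs ax) l.
by split; [rewrite /= ax | exact: etrans r' r].
Qed.

(** Adjacency is symmetric, so the hole retraces its path. *)
Lemma pass_rev h w : pass (pass h w).2 (rev (pass h w).1) = (rev w, h).
Proof.
elim: w h => //= x w IH h; case: ifP => hx /=.
  by rewrite rev_cons -cats1 pass_cat IH /= adj_sym hx /= cats1 rev_cons.
by rewrite rev_cons -cats1 pass_cat IH /= hx /= cats1 rev_cons.
Qed.

Lemma pass_id h w : {in w, forall x, ~~ adj h x} -> pass h w = (w, h).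
Proof.
elim: w => //= x w IH hw; rewrite (negbTE (hw x _)) ?mem_head // IH // => y yw.
by apply: hw; rewrite inE yw orbT.
Qed.

Lemma ltn_path_lt x w : path ltn x w -> {in w, forall y, x < y}.
Proof. by move/(order_path_min ltn_trans)/allP. Qed.

Lemma gtn_path_gt x w : path gtn x w -> {in w, forall y, y < x}.
Proof. by move/(order_path_min gtn_trans)/allP. Qed.

(** In a horizontal strip the hole either jumps one step back or runs along the
   row to its right. *)
Lemma pass_inc s g w : strict_partition s -> sorted ltn w -> legal s (g :: w) ->
  let p := pass g w in
  sorted ltn p.1 /\
  (p.2.+1 = g /\ p.2 \in w \/
   [/\ g <= p.2, forall y, g < y <= p.2 -> y \in w & forall y, y.+1 = g -> y \notin w]).
Proof.
elim: w s g => [|x w IH] s g hs hw hl /=.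
  by split => //; right; split => // y; lia.
have hwx := ltn_path_lt hw; have hgx : g <> x.
  by move=> e; move: hl; rewrite e legal_neq.
case: ifP; rewrite /adj => hx /=; last first.
  have [/andP[ax hl'] _] := legal_swap hs hl (negbT hx).
  have [so sh] := IH _ g (strict_add_box hs ax) (path_sorted hw) hl'.
  split.
    rewrite /= path_min_sorted //; apply/allP => y /=.
    case: (ltnP x g) => xg.
      by case/mem_pass => [->|/hwx].
    rewrite pass_id /=; first exact: hwx.
    by move=> z /hwx; rewrite /adj; lia.
  case: sh => [[e hin]|[h1 h2 h3]]; first by left; rewrite inE hin orbT.
  right; split => // y hy; first by rewrite inE h2 ?orbT.
  by rewrite inE negb_or h3 // andbT; lia.
case/orP: hx => /eqP hx.
  have [|||so sh] := IH (add_box s g) x.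
  - by apply: strict_add_box => //; case/andP: hl.
  - exact: path_sorted hw.
  - by case/andP: hl.
  have hp : x <= (pass x w).2 /\ (forall y, x < y <= (pass x w).2 -> y \in w).
    by case: sh => [[e /hwx]|[]//]; lia.
  split.
    rewrite path_min_sorted //; apply/allP => y /mem_pass[->|/hwx] /=; lia.
  right; split; first by lia.
    move=> y hy; rewrite inE; case: (eqVneq y x) => // ne; apply: hp.2; lia.
  move=> y hy; rewrite inE negb_or; apply/andP; split; first by lia.
  by apply/negP => /hwx; lia.
have gw : g \notin w.
  apply/negP => /splitPr e; case: e hl {IH} hw hwx => w1 w2 hl hw hwx.
  have := @legal_between s g (x :: w1) w2 hs hl; rewrite inE hx => /andP[/orP[/eqP|]]; first lia.
  move=> h1 _; have := ltn_path_lt hw; move/path_sorted: hw.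
  rewrite -hx sorted_pairwise; last exact: ltn_trans.
  rewrite pairwise_cat => /and3P[/allrelP h _ _] _.
  by have := h _ g h1 (mem_head _ _); rewrite /=; lia.
rewrite pass_id => [|y yw]; last first.
  by have := hwx _ yw; have : y != g by [apply: contraNneq gw => <-]; rewrite /adj; lia.
split => /=; last by left; rewrite hx mem_head.
rewrite path_min_sorted; first exact: path_sorted hw.
apply/allP => y yw /=; have := hwx _ yw.
by have : y != g by [apply: contraNneq gw => <-]; lia.
Qed.

(** The mirror image for a vertical strip off the main diagonal. *)
Lemma pass_dec s h w : strict_partition s -> sorted gtn w -> 0 \notin w ->
  legal s (h :: w) ->
  let p := pass h w in
  sorted gtn p.1 /\
  (p.2 = h.+1 /\ p.2 \in w \/
   [/\ p.2 <= h, forall y, p.2 <= y < h -> y \in w & h.+1 \notin w]).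
Proof.
elim: w s h => [|x w IH] s h hs hw h0 hl /=.
  by split => //; right; split => // y; lia.
have hwx := gtn_path_gt hw; have hgx : h <> x.
  by move=> e; move: hl; rewrite e legal_neq.
have [x0 w0] : x != 0 /\ 0 \notin w by move: h0; rewrite inE negb_or eq_sym => /andP.
case: ifP; rewrite /adj => hx /=; last first.
  have [/andP[ax hl'] _] := legal_swap hs hl (negbT hx).
  have [so sh] := IH _ h (strict_add_box hs ax) (path_sorted hw) w0 hl'.
  split.
    rewrite /= path_min_sorted //; apply/allP => y /=.
    case: (ltnP h x) => xg.
      by case/mem_pass => [->|/hwx].
    rewrite pass_id /=; first exact: hwx.
    by move=> z /hwx; rewrite /adj; lia.
  case: sh => [[e' hin]|[h1 h2 h3]]; first by left; rewrite inE hin orbT.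
  right; split => // [y hy|]; first by rewrite inE h2 ?orbT.
  by rewrite inE negb_or h3 // andbT; lia.
case/orP: hx => /eqP hx.
  have gw : h \notin w.
    apply/negP => /splitPr e; case: e hl {IH} hw hwx h0 w0 => w1 w2 hl hw hwx h0 w0.
    have := @legal_between s h (x :: w1) w2 hs hl; rewrite inE => /andP[_].
    case/or3P => [/eqP hh|/eqP|h1]; [|lia|].
      by move: w0; rewrite mem_cat hh mem_head orbT.
    have := hw => /path_sorted; rewrite sorted_pairwise; last exact: gtn_trans.
    rewrite pairwise_cat => /and3P[/allrelP h' _ _].
    by have := h' _ h h1 (mem_head _ _); rewrite /=; lia.
  rewrite pass_id => [|y yw]; last first.
    by have := hwx _ yw; have : y != h by [apply: contraNneq gw => <-]; rewrite /adj; lia.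
  split => /=; last by left; rewrite hx mem_head.
  rewrite path_min_sorted; first exact: path_sorted hw.
  apply/allP => y yw /=; have := hwx _ yw.
  by have : y != h by [apply: contraNneq gw => <-]; lia.
have [||||so sh] := IH (add_box s h) x.
- by apply: strict_add_box => //; case/andP: hl.
- exact: path_sorted hw.
- by [].
- by case/andP: hl.
have hp : (pass x w).2 <= x /\ (forall y, (pass x w).2 <= y < x -> y \in w).
  by case: sh => [[e h1]|[]//]; have := hwx _ h1; lia.
split.
  rewrite path_min_sorted //; apply/allP => y /mem_pass[->|/hwx] /=; lia.
right; split; first by lia.
  move=> y hy; rewrite inE; case: (eqVneq y x) => // ne; apply: hp.2; lia.
rewrite inE negb_or; apply/andP; split; first by lia.
by apply/negP => /hwx; lia.
Qed.

(** * Slides and the ballot inequalities *)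

(** What a slide from [h] to [g] does to the contents [A] of a horizontal strip,
   respectively to the contents [D] of a vertical strip off the main diagonal. *)
Definition inc_slide (A : pred nat) (g h : nat) : Prop :=
  h.+1 = g /\ A h \/
  [/\ g <= h, forall y, g < y <= h -> A y & forall y, y.+1 = g -> ~~ A y].

Definition dec_slide (D : pred nat) (h g : nat) : Prop :=
  g = h.+1 /\ D g \/
  [/\ g <= h, forall y, g <= y < h -> D y & ~~ D h.+1].

(* Only the linear facts are left for [lia], which would otherwise split cases on
   the boolean atoms. *)
Ltac slia := repeat match goal with
  | H : _ -> _ |- _ => clear H
  | H : is_true (?P _) |- _ => is_var P; clear H
  | H : is_true (~~ ?P _) |- _ => is_var P; clear H
  | H : is_true (_ || _) |- _ => clear H
  | H : inc_slide _ _ _ |- _ => clear H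
  | H : dec_slide _ _ _ |- _ => clear H
  end; lia.

Section BallotSlide.

(* [Ai] and [Di] stand for the contents of the unmarked and of the marked boxes of two
   consecutive letters; [ai y] counts the contents of [Ai] that are at least [y], and
   [di y] the contents of [Di] that are at most [y]. *)
Variables (D1 A1 D2 A2 : pred nat) (d1 a1 d2 a2 : nat -> nat) (N : nat).

Hypotheses (a1T : forall y, A1 y -> a1 y = (a1 y.+1).+1)
  (a1F : forall y, ~~ A1 y -> a1 y = a1 y.+1)
  (a2T : forall y, A2 y -> a2 y = (a2 y.+1).+1)
  (a2F : forall y, ~~ A2 y -> a2 y = a2 y.+1)
  (d1T : forall y, D1 y.+1 -> d1 y.+1 = (d1 y).+1)
  (d1F : forall y, ~~ D1 y.+1 -> d1 y.+1 = d1 y)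
  (d2T : forall y, D2 y.+1 -> d2 y.+1 = (d2 y).+1)
  (d2F : forall y, ~~ D2 y.+1 -> d2 y.+1 = d2 y)
  (d10 : d1 0 = 0) (d20 : d2 0 = 0) (D10 : ~~ D1 0) (D20 : ~~ D2 0)
  (N_D2 : forall y, N <= y -> ~~ D2 y).

Hypotheses (disj1 : forall y, A1 y -> ~~ D1 y) (disj2 : forall y, A2 y -> ~~ D2 y)
  (A1D2 : forall y, A1 y -> ~~ D2 y)
  (A1A2 : forall y, A1 y.+1 -> A2 y.+1 -> D2 y || A2 y)
  (D1D2 : forall y, D1 y -> D2 y -> A1 y.+1 || D2 y.+1).

Hypotheses (F1 : forall y, a2 y <= a1 y) (F2 : forall y, D2 y -> a2 y < a1 y)
  (B1 : forall y, a2 0 + d2 y <= a1 0 + d1 y)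
  (B2 : forall y, A1 y -> a2 0 + d2 y < a1 0 + d1 y).

(** Where both letters have an unmarked box on a diagonal, the second letter also has
   a box on the next lower diagonal; the descent ends at [F1] or [F2], or at [B2]
   on the main diagonal. *)
Lemma ballot_A1A2 y : A1 y -> A2 y -> a2 y.+1 < a1 y.+1.
Proof.
elim: y => [|y IH] hA1 hA2.
  by have := B2 hA1; have := a1T hA1; have := a2T hA2; rewrite d10 d20; slia.
have e1 := a1T hA1; have e2 := a2T hA2.
case/orP: (A1A2 hA1 hA2) => h.
  have n1 : ~~ A1 y by apply/negP => /A1D2; rewrite h.
  have n2 : ~~ A2 y by apply/negP => /disj2; rewrite h.
  by have := F2 h; have := a1F n1; have := a2F n2; slia.
have e3 := a2T h; have := F1 y; case: (boolP (A1 y)) => h1; last by have := a1F h1; slia.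
by have := IH h1 h; slia.
Qed.

(** The mirror image: the ascent ends at [B1] or [B2]. *)
Lemma ballot_D1D2 y : D1 y -> D2 y -> a2 0 + d2 y < a1 0 + d1 y.
Proof.
elim: {y}(N - y) {-2}y (erefl (N - y)) => [|k IH] y e h1 h2.
  by have := N_D2 (y := y); rewrite h2; slia.
case/orP: (D1D2 h1 h2) => h.
  by have := B2 h; have := d1F (disj1 h); have := d2F (A1D2 h); slia.
have e2 := d2T h; have b := B1 y.+1; case: (boolP (D1 y.+1)) => h3.
  by have := IH y.+1 _ h3 h; have := d1T h3; slia.
by have := d1F h3; slia.
Qed.

(* The hole starts at [h0] and passes [D1], [A1], [D2], [A2] in turn, which brings it
   to [g1], [h1], [g2], [h2].  The exceptional slides [sp1], [sp2] take a box [0] from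
   the marked to the unmarked boxes. *)
Variables (h0 g1 h1 g2 h2 : nat) (sp1 sp2 : bool).

Hypotheses (slD1 : dec_slide D1 h0 g1) (slA1 : inc_slide A1 g1 h1)
  (slD2 : dec_slide D2 h1 g2) (slA2 : inc_slide A2 g2 h2).

Hypotheses (D1h0 : ~~ D1 h0) (A1h0 : A1 h0 -> D1 h0.+1)
  (D2h0 : D2 h0 -> [|| D1 h0.+1, A1 h0.+1 | D2 h0.+1])
  (A1g1 : ~~ A1 g1) (D2g1 : forall y, D2 y.+1 -> y.+1 = g1 -> A1 y)
  (A2g1 : forall y, A2 y.+1 -> y.+1 = g1 -> [|| A1 y, D2 y | A2 y])
  (D2h1 : ~~ D2 h1) (A2h1 : A2 h1 -> D2 h1.+1).

Hypotheses (sp1P : sp1 -> [/\ h0 = 0, g1 = 1, h1 = 0 & A1 0])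
  (sp2P : sp2 -> [/\ h1 = 0, g2 = 1, h2 = 0, D2 1 & A2 0])
  (sp2N : ~~ sp2 -> ~ [/\ h1 = 0, D2 1 & A2 0]).

(** If the hole runs along a row, then the entries of [A2] below the run extend to
   its left end, and there the ballot condition leaves a surplus of two. *)
Lemma inc_run x : (forall y, g1 < y <= h1 -> A1 y) -> (forall y, y.+1 = g1 -> ~~ A1 y) ->
  g1 <= x <= h1 -> A2 x -> (x = 0 -> A1 1) -> (a2 x.+1).+1 < a1 x.+1.
Proof.
move=> up dn; elim: x => [|x IH] hx hA2 h01.
  have g10 : g1 = 0 by slia.
  have A11 := h01 erefl; have := B2 A11; rewrite (d1F (disj1 A11)) (d2F (A1D2 A11)) d10 d20.
  by have := a2T hA2; have := A1g1; rewrite g10 => /a1F; slia.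
case: (eqVneq g1 x.+1) => [e|ne].
  have nA1 := dn _ (esym e); have := A2g1 hA2 (esym e); rewrite (negbTE nA1) /=.
  have := a2T hA2; have := A1g1; rewrite e => /a1F; have := a1F nA1.
  move=> q1 q2 q3 /orP[h|h].
    by have n2 : ~~ A2 x by [apply/negP => /disj2; rewrite h]; have := F2 h; have := a2F n2; slia.
  by have := F1 x; have := a2T h; slia.
have hA1 : A1 x.+1 by apply: up; slia.
have hA2x : A2 x.
  case/orP: (A1A2 hA1 hA2) => // h; case: (ltnP g1 x) => gx.
    by have : A1 x by [apply: up; slia]; move/A1D2; rewrite h.
  have gx' : x = g1 by slia.
  case: x h gx' {IH hx hA2 h01 ne hA1 gx} => [|x] h gx'; first by move: D20; rewrite h.
  by have := D2g1 h gx'; have := dn _ gx' => /negbTE->.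
have hx' : g1 <= x <= h1 by slia.
have h01' : x = 0 -> A1 1 by move=> x0; apply: up; slia.
by have := IH hx' hA2x h01'; have := a1T hA1; have := a2T hA2; slia.
Qed.

(** Along the run every diagonal carries a box of [A1], so the surplus at its right
   end spreads over all of it. *)
Lemma inc_gain y : (forall y, g1 < y <= h1 -> A1 y) -> g1 < y <= h1 -> a2 y < a1 y.
Proof.
move=> up; elim: {y}(h1 - y) {-2}y (erefl (h1 - y)) => [|k IH] y e hy.
  have hA : A1 y by apply: up; slia.
  have ey : y = h1 by slia.
  rewrite ey in hA *; have := a1T hA; case: (boolP (A2 h1)) => h.
    by have := F2 (A2h1 h); have := a2T h; slia.
  by have := a2F h; have := F1 h1.+1; slia.
have hA : A1 y by apply: up; slia.
have := IH y.+1 _ _; have := a1T hA; case: (boolP (A2 y)) => h; last by have := a2F h; slia.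
by have := a2T h; slia.
Qed.

Lemma A2_down : h2.+1 = g2 -> A2 h2 -> a2 g2 < a1 g2.
Proof.
move=> <- h; case: (boolP (A1 h2)) => h'; first exact: ballot_A1A2.
by have := F1 h2; have := a1F h'; have := a2T h; slia.
Qed.

Lemma A2_down_run : (forall y, g1 < y <= h1 -> A1 y) -> (forall y, y.+1 = g1 -> ~~ A1 y) ->
  h2.+1 = g2 -> A2 h2 -> g1 < g2 <= h1 -> (a2 g2).+1 < a1 g2.
Proof.
move=> up dn e h hg; have q2 : g2 = h1.
  case: slD2 => [[]|[_ run _]]; first slia.
  apply/eqP; rewrite eqn_leq (proj2 (andP hg)) /= leqNgt; apply/negP => lt.
  by have /A1D2 := up _ hg; rewrite run //; slia.
rewrite -e; apply: inc_run => //; first by slia.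
by move=> h20; rewrite -h20 e; apply: up.
Qed.

(** This and [slide_F2], [slide_B1], [slide_B2] are the four ballot inequalities after
   the slide: each strip has gained the content at which the hole enters it and lost
   the content at which the hole leaves it, up to the exceptional box. *)
Lemma slide_F1 y :
  a2 y + (y <= g2) + (sp2 && (y == 0)) + (y <= h1) <=
  a1 y + (y <= g1) + (sp1 && (y == 0)) + (y <= h2).
Proof.
have f := F1 y; case sp2E: sp2.
  have [h10 g21 h20 D21 A20] := sp2P sp2E.
  have hD := disj2 A20; have eA2 := a2T A20.
  case: y f => [|y] f; last first.
    case: slA1 => [[gh _]|[gh up dn]]; first by slia.
    case: (posnP y) => [->|y0]; last by slia.
    by have := F2 D21; slia.
  case sp1E: sp1; first by slia.
  suff : a2 0 < a1 0 by slia.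
  have := F2 D21; case: (boolP (A1 0)) => [/a1T|nA]; first by slia.
  move=> _; case: slA1 => [[_]|[gh _ _]]; first by rewrite h10 (negbTE nA).
  case: slD1 => [[]|[gh' run nD]]; first by slia.
  have h00 : h0 = 0.
    by case: (posnP h0) => // p; have := run 0; rewrite (negbTE D10); slia.
  have := B1 1; rewrite h00 in nD; have := d1F nD; have := d2T D21; slia.
rewrite /= addn0.
have hA2 : (h2.+1 = g2 /\ a2 g2 < a1 g2) \/ g2 <= h2.
  by case: slA2 => [[e h]|[h _ _]]; [left; split => //; apply: A2_down | right].
case: slA1 => [[gh hA]|[gh up dn]].
  case: hA2 => [[e h]|h]; last by slia.
  by case: (eqVneq y g2) => [->|ne]; slia.
have k := @inc_gain y up.
case: slA2 => [[e h]|[h _ _]]; last by move: k; slia.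
have k' := A2_down e h; have k'' := A2_down_run up dn e h.
by case: (eqVneq y g2) => [ey|ne]; [rewrite ey in k *; move: k k''; slia | move: k; slia].
Qed.

Lemma slide_F2 y : D2 y && (y != g2) || (y == h1) && (h1 != g2) && ~~ (sp2 && (y == 0)) ->
  a2 y + (y <= g2) + (sp2 && (y == 0)) + (y <= h1) <
  a1 y + (y <= g1) + (sp1 && (y == 0)) + (y <= h2).
Proof.
case/orP => [/andP[hD yg]|/andP[/andP[/eqP-> hg] ne2]].
  have f := F2 hD; have -> : (y == 0) = false.
    by apply/eqP => y0; move: D20; rewrite -y0 hD.
  rewrite !andbF !addn0.
  have hn : ~ (g1 < y <= h1 /\ A1 y) by case=> _ /A1D2; rewrite hD.
  have hA2 : (h2.+1 = g2) \/ g2 <= h2 by case: slA2 => [[e h]|[h _ _]]; [left | right].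
  case: slA1 => [[gh hA]|[gh up dn]]; first by slia.
  have : ~~ (g1 < y <= h1) by apply/negP => h; apply: hn; split => //; apply: up.
  by slia.
rewrite (negbTE ne2).
have no : ~ [/\ h1 = 0, D2 1 & A2 0].
  case sp2E: sp2; last by apply: sp2N; rewrite sp2E.
  by have [h10 _ _ _ _] := sp2P sp2E; move: ne2; rewrite sp2E h10.
case: slD2 => [[eg hD]|[le run nD]].
  have f := F2 hD; rewrite eg in f; case: (boolP (A2 h1)) => hA.
    have eh : h2 = h1.
      case: slA2 => [[e _]|[_ _ dn]]; first by slia.
      by have := dn _ (esym eg); rewrite hA.
    have e := a2T hA; case: slA1 => [[gh hA1]|[gh up dn]].
      by have := a1T hA1; slia.
    case: (eqVneq g1 h1) => [egh|ngh].
      have : (a2 h1.+1).+1 < a1 h1.+1.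
        apply: inc_run => //; first by slia.
        by move=> h10; case: no; split => //; rewrite -?h10 // -eg.
      by have := A1g1; rewrite egh => /a1F; slia.
    have hA1 : A1 h1 by apply: up; slia.
    have : (a2 h1.+1).+1 < a1 h1.+1 by apply: inc_run => //; slia.
    by have := a1T hA1; slia.
  have le2 : g2 <= h2.
    case: slA2 => [[e h]|[]//]; move: hA; have <- : h2 = h1 by slia.
    by rewrite h.
  have := a2F hA; case: (boolP (A1 h1)) => [/a1T|hA1]; first by slia.
  have := a1F hA1; case: slA1 => [[gh]|[gh up dn]]; first by rewrite (negbTE hA1).
  case: (ltnP g1 h1) => lt; last by slia.
  by have : A1 h1 by [apply: up; slia]; rewrite (negbTE hA1).
have {}le : g2 < h1 by slia.
case: h1 le run nD hg ne2 no slA1 => // h le run nD hg ne2 no slA1'.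
have hD : D2 h by apply: run; slia.
have nA : ~~ A1 h by apply/negP => /A1D2; rewrite hD.
have nA2 : ~~ A2 h by apply/negP => /disj2; rewrite hD.
have := F2 hD; rewrite (a1F nA) (a2F nA2) => f.
case: slA1' => [[gh _]|[gh up dn]]; first by slia.
case: (ltnP g1 h.+1) => lt; last by slia.
case: (ltnP g1 h) => lt'; first by have := up h; rewrite (negbTE nA); slia.
have eg : g1 = h by slia.
case: h hD eg {run no ne2 hg nD le lt lt' nA nA2 f gh up} => [|h] hD eg.
  by move: D20; rewrite hD.
by have := D2g1 hD (esym eg); have := dn _ (esym eg) => /negbTE->.
Qed.

(** The counterparts of [inc_run] and [inc_gain] for a hole that runs down a column
   to the left of entries of [D2]. *)
Lemma dec_hole : D2 h0 -> ~~ D1 h0.+1 -> a2 0 + d2 h0 < a1 0 + d1 h0.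
Proof.
move=> h n; have := D2h0 h; rewrite (negbTE n) /= => /orP[h'|h'].
  by have := B2 h'; have := d1F n; have := d2F (A1D2 h'); slia.
by have := B1 h0.+1; have := d1F n; have := d2T h'; slia.
Qed.

Lemma dec_run x : (forall y, g1 <= y < h0 -> D1 y) -> ~~ D1 h0.+1 ->
  g1 <= x < h0 -> D2 x.+1 -> (a2 0 + d2 x).+1 < a1 0 + d1 x.
Proof.
move=> run n; elim: {x}(h0 - x) {-2}x (erefl (h0 - x)) => [|k IH] x e hx hD; first by slia.
have q2 := d2T hD; case: (ltnP x.+1 h0) => lt.
  have hD1 : D1 x.+1 by apply: run; slia.
  have hD2 : D2 x.+2.
    case/orP: (D1D2 hD1 hD) => // hA; case: (ltnP x.+2 h0) => lt'.
      by have /disj1 := hA; rewrite run //; slia.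
    have ex : x.+2 = h0 by slia.
    by rewrite ex in hA; have := A1h0 hA; rewrite (negbTE n).
  by have := IH x.+1 _ _ hD2; have := d1T hD1; slia.
have ex : x.+1 = h0 by slia.
have := D1h0; rewrite -ex in n * => /d1F.
by have := dec_hole; rewrite -ex => /(_ hD n); slia.
Qed.

Lemma dec_gain y : (forall y, g1 <= y < h0 -> D1 y) -> g1 <= y < h0 ->
  a2 0 + d2 y < a1 0 + d1 y.
Proof.
move=> run; elim: y => [|y IH] hy.
  by have : D1 0 by [apply: run]; rewrite (negbTE D10).
have := d1T (run _ hy); case: (boolP (D2 y.+1)) => h; last first.
  by have := d2F h; have := B1 y; slia.
have := d2T h; case: (eqVneq g1 y.+1) => [e|ne]; last by have := IH; slia.
by have := B2 (D2g1 h (esym e)); slia.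
Qed.

Lemma slide_B1 y : a2 0 + d2 y + (h1 <= y) + (g1 <= y) <= a1 0 + d1 y + (h0 <= y) + (g2 <= y).
Proof.
have b := B1 y.
have up2 : D2 h1.+1 -> a2 0 + d2 h1 < a1 0 + d1 h1.
  move=> h; have e := d2T h; case: (boolP (D1 h1.+1)) => h'.
    by have := ballot_D1D2 h' h; have := d1T h'; slia.
  by have := d1F h'; have := B1 h1.+1; slia.
case: slD1 => [[eg hD1]|[le run n]].
  case: slD2 => [[eg2 hD2]|[le2 _ _]]; last by slia.
  by case: (eqVneq y h1) => [->|ne]; [rewrite eg2 in hD2; have := up2 hD2; slia | slia].
have k := dec_gain run (y := y).
case: slD2 => [[eg2 hD2]|[le2 _ _]]; last by move: k; slia.
rewrite eg2 in hD2; have k' := up2 hD2.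
case: (eqVneq y h1) => [ey|ne]; last by move: k; slia.
rewrite {}ey in b k *; case: (boolP (g1 <= h1 < h0)) => hh; last by move: k; slia.
have eh : h1 = g1.
  case: slA1 => [[gh _]|[gh up _]]; first by slia.
  apply/eqP; rewrite eqn_leq (proj1 (andP hh)) andbT leqNgt; apply/negP => lt.
  by have /disj1 : A1 h1 by [apply: up; slia]; rewrite run.
have := dec_run run n hh hD2; slia.
Qed.

Lemma slide_B2 y : A1 y && (y != h1) || (y == g1) && (g1 != h1) || sp1 && (y == 0) ->
  a2 0 + d2 y + (h1 <= y) + (g1 <= y) < a1 0 + d1 y + (h0 <= y) + (g2 <= y).
Proof.
have D2dn : g2 = h1.+1 \/ g2 <= h1 by case: slD2 => [[-> _]|[h _ _]]; [left | right].
case/orP => [/orP[/andP[hA ne]|/andP[/eqP-> ne]]|/andP[he /eqP->]]; last first.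
- by have [-> -> -> h] := sp1P he; have := B2 h; slia.
- have no_up (up : A1 g1.+1) : g1 < h0 -> (forall y, g1 <= y < h0 -> D1 y) -> ~~ D1 h0.+1 -> False.
    move=> lt run n; case: (ltnP g1.+1 h0) => lt'.
      by have /disj1 := up; rewrite run //; slia.
    have ex : g1.+1 = h0 by slia.
    by rewrite ex in up; have := A1h0 up; rewrite (negbTE n).
  case: slA1 => [[gh hA]|[gh up _]]; last first.
    have hA : A1 g1.+1 by apply: up; slia.
    have := B2 hA; have := d1F (disj1 hA); have := d2F (A1D2 hA).
    case: slD1 => [[eg _]|[le run n]]; first by slia.
    case: (ltnP g1 h0) => lt; last by slia.
    by case: (no_up hA lt run n).
  have b := B2 hA; case: slD1 => [[eg hD1]|[le run n]].
    rewrite -gh in hD1 *; have := d1T hD1; case: (boolP (D2 h1.+1)) => h; [have := d2T h|have := d2F h]; slia.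
  case: (ltnP g1 h0) => lt; last first.
    have eg : g1 = h0 by slia.
    case: (boolP (D2 g1)) => h.
      by have := dec_hole; rewrite -eg => /(_ h); rewrite {1}eg => /(_ n); slia.
    move: D1h0 h b; rewrite -eg -gh => /d1F -> /d2F -> b; slia.
  have hD1 : D1 g1 by apply: run; slia.
  case: (boolP (D2 g1)) => h; last first.
    by move: hD1 h; rewrite -gh => /d1T -> /d2F ->; slia.
  case/orP: (D1D2 hD1 h) => h'; first by case: (no_up h' lt run n).
  by have := @dec_run g1 run n _ h'; slia.
have b := B2 hA; case: slD1 => [[eg _]|[le run n]]; first by slia.
have : ~~ (g1 <= y < h0) by apply/negP => /run hD; have := disj1 hA; rewrite hD.
by slia.
Qed.

End BallotSlide.

(** * Hook words *)

(** The boxes with entries [i] or [i'] of a tableau are listed by the contents of the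
   boxes [i'], which decrease, and those of the boxes [i] from below, which increase.
   The lowest box of a letter is unmarked, so the end of the decreasing run belongs to
   [apart] and the marks can be recovered from the contents. *)
Fixpoint dpart (w : seq nat) : seq nat :=
  if w is x :: w' then
    if w' is y :: _ then if y < x then x :: dpart w' else [::] else [::]
  else [::].

Definition apart (w : seq nat) : seq nat := drop (size (dpart w)) w.

Definition hook (w : seq nat) : bool := sorted ltn (apart w).

Lemma cat_dpart w : dpart w ++ apart w = w.
Proof.
rewrite /apart; elim: w => //= x [|y w] //=; case: ifP => //= _ IH.
by rewrite IH.
Qed.

Lemma dpart_nil w : apart w = [::] -> w = [::].
Proof.
move=> e; have := cat_dpart w; rewrite e cats0; case: w {e} => // x w e.
suff : size (dpart (x :: w)) < size (x :: w) by rewrite e ltnn.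
elim: w x {e} => //= y w IH x; case: ifP => //= _; exact: IH.
Qed.

Lemma dpart_cons2 x y w : dpart (x :: y :: w) = if y < x then x :: dpart (y :: w) else [::].
Proof. by []. Qed.

(** The last letter of the decreasing run belongs to [apart]. *)
Lemma dpart_sorted x w : sorted gtn (rcons (dpart (x :: w)) (head 0 (apart (x :: w)))).
Proof.
elim: w x => // y w IH x; rewrite /apart dpart_cons2; case: ifP => // yx.
move: (IH y); rewrite /apart; case e: (dpart (y :: w)) => [|z d] /=; first by rewrite yx.
move=> ->; rewrite andbT; move: e; case: w {IH} => // z' w.
by rewrite dpart_cons2; case: ifP => // _ [<- _].
Qed.

Lemma dpart_cat d j a : sorted gtn (rcons d j) -> sorted ltn (j :: a) ->
  dpart (d ++ j :: a) = d.
Proof.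
elim: d => [|x d IH].
  by move=> _; case: a => //= y a /andP[]; case: ltngtP.
rewrite cat_cons rcons_cons; case: d IH => [|y d] IH.
  by rewrite /= => /andP[jx _] h; rewrite -/(dpart (j :: a)) jx -[RHS]/(x :: [::]) -IH.
move=> h h'; rewrite cat_cons dpart_cons2 -cat_cons IH //; last by case/andP: h.
by move: h => /= /andP[->].
Qed.

Lemma hook_cat d j a : sorted gtn (rcons d j) -> sorted ltn (j :: a) ->
  [/\ hook (d ++ j :: a), dpart (d ++ j :: a) = d & apart (d ++ j :: a) = j :: a].
Proof. by move=> h1 h2; rewrite /hook /apart dpart_cat // drop_size_cat. Qed.

Lemma hookP w : hook w -> w <> [::] -> exists d j a,
  [/\ w = d ++ j :: a, dpart w = d, apart w = j :: a, sorted gtn (rcons d j)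
    & sorted ltn (j :: a)].
Proof.
case: w => // x w hw _; have := dpart_sorted x w; have := cat_dpart (x :: w).
move: hw; rewrite /hook; case e: (apart (x :: w)) => [|j a] hw; first by move: (dpart_nil e).
by exists (dpart (x :: w)), j, a; split.
Qed.

Lemma sorted_rcons_gtn d j : sorted gtn (rcons d j) -> sorted gtn d /\ {in d, forall x, j < x}.
Proof.
rewrite !(sorted_pairwise gtn_trans) pairwise_rcons => /andP[/allP h ->].
by split => // x /h.
Qed.

Lemma rcons_sorted_gtn d j : sorted gtn d -> {in d, forall x, j < x} -> sorted gtn (rcons d j).
Proof.
by rewrite !(sorted_pairwise gtn_trans) pairwise_rcons => -> h; rewrite andbT; apply/allP.
Qed.

Lemma sorted_dpart w : sorted gtn (dpart w).
Proof. by case: w => // x w; have /sorted_rcons_gtn[] := dpart_sorted x w. Qed.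

Lemma dpart0 w : 0 \notin dpart w.
Proof.
case: w => // x w; have /sorted_rcons_gtn[_ h] := dpart_sorted x w.
by apply/negP => /h.
Qed.

Lemma split_inc a x : sorted ltn a -> x \in a -> exists u v,
  [/\ a = u ++ x :: v, {in u, forall y, y < x} & {in v, forall y, x < y}].
Proof.
move=> sa xa; case/splitPr: xa sa => u v; rewrite (sorted_pairwise ltn_trans).
rewrite pairwise_cat /= => /and3P[/allrelP h _ /andP[/allP h' _]].
by exists u, v; split => // y yu; apply: h => //; rewrite mem_head.
Qed.

Lemma split_dec a x : sorted gtn a -> x \in a -> exists u v,
  [/\ a = u ++ x :: v, {in u, forall y, x < y} & {in v, forall y, y < x}].
Proof.
move=> sa xa; case/splitPr: xa sa => u v; rewrite (sorted_pairwise gtn_trans).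
rewrite pairwise_cat /= => /and3P[/allrelP h _ /andP[/allP h' _]].
by exists u, v; split => // y yu; apply: h => //; rewrite mem_head.
Qed.

Lemma legal_suffix s u v : strict_partition s -> legal s (u ++ v) ->
  exists2 s', strict_partition s' & legal s' v.
Proof.
move=> hs; rewrite legal_cat => /andP[lu lv].
by exists (run s u) => //; apply: strict_run.
Qed.

Lemma legal_between_cat s u x m v : strict_partition s -> legal s (u ++ x :: m ++ x :: v) ->
  (x.+1 \in m) /\ (x = 0 \/ x.-1 \in m).
Proof.
move=> hs /(legal_suffix hs)[s' hs' /(legal_between hs')/andP[h1 h2]].
by split => //; case/orP: h2 => [/eqP|]; [left | right].
Qed.

(** Between two boxes on a diagonal there is one on the next higher diagonal, which
   would have to be listed between them. *)
Lemma hook_disjoint s w : strict_partition s -> legal s w -> hook w ->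
  {in apart w, forall y, y \notin dpart w}.
Proof.
move=> hs lw hw y ya; apply/negP => yd.
have [u [v [ed _ hu]]] := split_dec (sorted_dpart w) yd.
have [u' [v' [ea hu' _]]] := split_inc hw ya.
move: lw; rewrite -(cat_dpart w) ed ea -catA /= catA => /(legal_between_cat hs)[].
by rewrite mem_cat => /orP[/hu|/hu']; lia.
Qed.

Lemma pass_legal_cat s h u v : strict_partition s -> legal s (h :: u ++ v) ->
  exists2 s', strict_partition s' & legal s' ((pass h u).2 :: v).
Proof.
move=> hs hl; have := hl; rewrite -cat_cons legal_cat => /andP[lu lv].
have [lu' ru] := pass_legal hs lu.
have := legal_cat s (rcons (pass h u).1 (pass h u).2) v.
rewrite lu' ru lv cat_rcons => l; exact: legal_suffix hs l.
Qed.

Lemma dec_notin s h d v : strict_partition s -> legal s (h :: d ++ v) -> sorted gtn d ->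
  0 \notin d -> h \notin d.
Proof.
move=> hs hl sd d0; apply/negP => hd; have [u [v' [ed hu _]]] := split_dec sd hd.
move: hl d0; rewrite ed -catA => /(@legal_between_cat s [::])[] // _ [->|/hu]; last by lia.
by rewrite mem_cat mem_head orbT.
Qed.

Definition slide_data w h g k w' (e : bool) : Prop :=
  [/\ dec_slide (mem (dpart w)) h g, inc_slide (mem (apart w)) g k,
      (forall P : pred nat, count P (dpart w') + e * P 0 + P g = count P (dpart w) + P h),
      (forall P : pred nat, count P (apart w') + P k = count P (apart w) + P g + e * P 0)
    & e = [&& h == 0, 1 \in dpart w & 0 \in apart w]] /\
  (e -> g = 1 /\ k = 0).

(** A slide through a hook word slides through its two runs in turn.  The new
   word is again a hook word with the new runs, except when the hole leaves the
   diagonal through [1] and comes back through [0]: then a [0] ends the new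
   decreasing run and has to be moved to the other one. *)
Lemma pass_hook s h w : strict_partition s -> legal s (h :: w) -> hook w ->
  hook (pass h w).1 /\
  exists e, slide_data w h (pass h (dpart w)).2 (pass h w).2 (pass h w).1 e.
Proof.
move=> hs hl hw; case: (eqVneq w [::]) => [->|/eqP w0].
  rewrite /=; split => //; exists false; split => //; split => //=.
  - by right; split => // y; lia.
  - by right; split => // y; lia.
  - by move=> P; lia.
  - by rewrite andbF.
have [d [j [a [ew ed ea sd sa]]]] := hookP hw w0.
have [sd' jd] := sorted_rcons_gtn sd.
have d0 : 0 \notin d by rewrite -ed dpart0.
have hl2 : legal s (h :: d ++ j :: a) by rewrite -ew.
have hl' : legal s (h :: d) by move: hl2; rewrite -cat_cons legal_cat => /andP[].
have /= [so_d sl_d] := pass_dec hs sd' d0 hl'.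
have [s' hs' lg] := pass_legal_cat hs hl2.
have [so_a sl_a] := pass_inc hs' sa lg.
have hd := dec_notin hs hl2 sd' d0.
have ja := ltn_path_lt sa.
have ce P := count_pass h d P.
have ca P := count_pass (pass h d).2 (j :: a) P.
have [ep1 ep2] : (pass h w).1 = (pass h d).1 ++ (pass (pass h d).2 (j :: a)).1 /\
    (pass h w).2 = (pass (pass h d).2 (j :: a)).2 by rewrite ew pass_cat.
rewrite ed ep1 ep2.
case e: ([&& h == 0, 1 \in dpart w & 0 \in apart w]); last first.
  (* Outside the exceptional case the new decreasing run stays above the start of
     the new increasing run. *)
  suff hj : {in (pass h d).1, forall x, head 0 (pass (pass h d).2 (j :: a)).1 < x}.
    move: so_a sl_a ca hj; set q := pass _ (j :: a) => so_a sl_a ca hj.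
    have [j' [a' eq]] : exists j' a', q.1 = j' :: a'.
      case eq: q.1 => [|j' a']; last by exists j', a'.
      by have := size_pass (pass h d).2 (j :: a); rewrite -/q eq.
    rewrite eq in so_a hj ca *.
    have [h1 h2 h3] := hook_cat (@rcons_sorted_gtn _ j' so_d hj) so_a.
    split => //; exists false; rewrite /slide_data h2 h3 e ed ea.
    by split => //; split => // P; rewrite mul0n addn0.
  move=> x xp; have mh := mem_pass xp.
  have xg : x = (pass h d).2 -> h = (pass h d).2 /\ False.
    move=> xg; have := ce (pred1 x); rewrite /= -xg eqxx.
    have : 0 < count_mem x (pass h d).1 by rewrite -has_count has_pred1.
    have : count_mem x d <= 1.
      by rewrite count_uniq_mem ?leq_b1 // (sorted_uniq gtn_trans) // => z; apply: ltnn.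
    case: (eqVneq h x) => [ehx|_]; last by clear; clia.
    by move: hd; rewrite ehx => /count_memPn->; clear; clia.
  have hneq : h = (pass h d).2 -> x <> h by move=> e1 e2; case: (xg (etrans e2 e1)).
  rewrite /=; move: sl_d xg hneq; set g := (pass h d).2 => sl_d xg hneq.
  case: ifP => hadj /=.
    case: sl_d => [[eg gd]|[le run nd]].
      have gj := jd _ gd; have ej : h = j by move: hadj gj eg; rewrite /adj; clear; clia.
      have hl3 : legal s ([::] ++ j :: d ++ j :: a) by move: hl2; rewrite ej.
      have [_ [j0|]] := legal_between_cat hs hl3; last by move/jd; clear; clia.
      move: e gd; rewrite ed ea eg ej j0 eqxx mem_head andbT /= => -> //.
    have [lt|ge] := ltnP g h.
      have gj : j < g by apply/jd/run; rewrite leqnn.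
      case: mh => [->//|/jd]; have : x <> g by move/xg => [].
      by move: hadj gj; rewrite /adj; clear; clia.
    have eh : h = g by move: ge le; clear; clia.
    case: mh => [/(hneq eh)//|/jd xj].
    have : x <> g by move/xg => [].
    by move: hadj xj; rewrite /adj; clear; clia.
  case: mh => [exh|/jd//]; rewrite exh.
  case: sl_d => [[eg /jd gj]|[le run nd]].
    by move: hadj eg gj; rewrite /adj; clear; clia.
  have [lt|ge] := ltnP g h.
    by have /jd : g \in d by [apply: run; rewrite leqnn]; move: lt; clear; clia.
  by case: hneq => //; move: le ge; clear; clia.
have [/eqP h00 d1 a0] := and3P e; rewrite ed in d1; rewrite ea in a0.
have j0 : j = 0 by move: (jd _ d1); clear; clia.
have [u [v [eu hu hv]]] := split_dec sd' d1.
(* In the exceptional case [d] ends in [1] and the increasing run starts with [0]. *)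
have v0 : v = [::].
  case: v eu hv => // y v eu hv; have := hv _ (mem_head _ _).
  by have := jd y; rewrite eu mem_cat !inE eqxx !orbT => /(_ isT); clear; clia.
have pu : pass 0 d = (u ++ [:: 0], 1).
  rewrite eu v0 pass_cat pass_id; first by [].
  by move=> y /hu; rewrite /adj; clear; lia.
have [s2 hs2 l2] := @legal_suffix s [:: h] w hs hl.
have a1 : 1 \notin a.
  apply/negP => a1; have := @hook_disjoint s2 w hs2 l2 hw 1.
  by rewrite ed d1 ea inE a1 orbT => /(_ isT).
have pa : pass 1 (j :: a) = (1 :: a, 0).
  rewrite j0 /= pass_id // => y ya; have := ja _ ya; rewrite j0.
  by have : y != 1 by [apply: contraNneq a1 => <-]; rewrite /adj; clear; clia.
rewrite h00 pu [fst (_, _)]/= [snd (_, _)]/= pa [fst (_, _)]/= [snd (_, _)]/= -catA /=.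
have [] := @hook_cat u 0 (1 :: a).
- by apply: rcons_sorted_gtn => [|y /hu]; [move: sd'; rewrite eu v0 cats1 => /sorted_rcons_gtn[] | clear; lia].
- rewrite /= path_min_sorted ?(path_sorted sa) //; apply/allP => y ya.
  by have := ja _ ya; have : y != 1 by [apply: contraNneq a1 => <-]; rewrite j0 /=; clear; clia.
move=> h1 h2 h3; split => //; exists true; rewrite /slide_data h2 h3 ed ea.
move: sl_d sl_a; rewrite h00 pu [snd (u ++ _, _)]/= pa /= => sl_d sl_a.
split=> //; split => //; last by rewrite d1 a0.
- by move=> P; rewrite eu v0 count_cat /=; clear; clia.
- by move=> P; rewrite j0 /=; clear; clia.
Qed.

(** * Ballot pairs *)

Definition nge (a : seq nat) (y : nat) : nat := count (leq y) a.
Definition nle (d : seq nat) (y : nat) : nat := count (fun x => x <= y) d.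

Lemma ngeS a y : uniq a -> nge a y = nge a y.+1 + (y \in a).
Proof.
move=> ua; rewrite -(count_uniq_mem _ ua) /nge; elim: a {ua} => //= x a ->; clear; lia.
Qed.

Lemma nleS d y : uniq d -> nle d y.+1 = nle d y + (y.+1 \in d).
Proof.
move=> ud; rewrite -(count_uniq_mem _ ud) /nle; elim: d {ud} => //= x d ->; clear; lia.
Qed.

Lemma nge_mem a y : uniq a -> y \in a -> nge a y = (nge a y.+1).+1.
Proof. by move=> ua h; rewrite ngeS // h addn1. Qed.

Lemma nge_notin a y : uniq a -> y \notin a -> nge a y = nge a y.+1.
Proof. by move=> ua h; rewrite ngeS // (negbTE h) addn0. Qed.

Lemma nle_mem d y : uniq d -> y.+1 \in d -> nle d y.+1 = (nle d y).+1.
Proof. by move=> ud h; rewrite nleS // h addn1. Qed.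

Lemma nle_notin d y : uniq d -> y.+1 \notin d -> nle d y.+1 = nle d y.
Proof. by move=> ud h; rewrite nleS // (negbTE h) addn0. Qed.

Lemma nle0 d : 0 \notin d -> nle d 0 = 0.
Proof.
by move=> h; apply/eqP; rewrite -leqn0 leqNgt -has_count; apply/hasP => -[[|x] xd] //; rewrite xd in h.
Qed.

Lemma uniq_dpart w : uniq (dpart w).
Proof. by apply: (sorted_uniq gtn_trans) (sorted_dpart w) => x; apply: ltnn. Qed.

Lemma uniq_apart w : hook w -> uniq (apart w).
Proof. by apply: (sorted_uniq ltn_trans) => x; apply: ltnn. Qed.

(** The condition for two consecutive letters of a Littlewood-Richardson-Stembridge
   tableau, in terms of the contents [apart c1], [apart c2] of their unmarked and
   [dpart c1], [dpart c2] of their marked boxes. *)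
Definition ballot_pair (c1 c2 : seq nat) : bool :=
  let A1 := apart c1 in let D1 := dpart c1 in
  let A2 := apart c2 in let D2 := dpart c2 in
  [&& all (fun y => nge A2 y.+1 < nge A1 y) (D2 ++ A2),
      all (fun y => nge A2 0 + nle D2 y <= nge A1 0 + nle D1 y) D2
    & all (fun y => nge A2 0 + nle D2 y < nge A1 0 + nle D1 y) A1].

(** The inequalities of [ballot_pair] at all contents; between the contents tested
   there, the left-hand sides stand still. *)
Definition ballot_paths (D1 A1 D2 A2 : seq nat) : Prop :=
  [/\ forall y, nge A2 y <= nge A1 y, forall y, y \in D2 -> nge A2 y < nge A1 y,
      forall y, nge A2 0 + nle D2 y <= nge A1 0 + nle D1 y
    & forall y, y \in A1 -> nge A2 0 + nle D2 y < nge A1 0 + nle D1 y].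

Lemma nge_eventually a : exists n, forall y, n <= y -> nge a y = 0.
Proof.
have [n h] := cnt_eventually a; exists n.+1 => -[|y] // hy.
by rewrite -(h y) // /nge /cnt.
Qed.

Lemma ballot_pairP c1 c2 : hook c2 -> {in apart c2, forall y, y \notin dpart c2} ->
  reflect (ballot_paths (dpart c1) (apart c1) (dpart c2) (apart c2)) (ballot_pair c1 c2).
Proof.
move=> h2 disj; have uA := uniq_apart h2; have uD := uniq_dpart c2.
apply: (iffP and3P) => [[/allP hF /allP hB1 /allP hB2]|[hF1 hF2 hB1 hB2]].
  have F1 y : nge (apart c2) y <= nge (apart c1) y.
    have [n hn] := nge_eventually (apart c2).
    elim: {y}(n - y) {-2}y (erefl (n - y)) => [|k IH] y e; first by rewrite hn; lia.
    case: (boolP (y \in apart c2)) => hy.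
      by rewrite nge_mem //; apply: hF; rewrite mem_cat hy orbT.
    rewrite nge_notin //; apply: leq_trans (IH y.+1 _) _; first by lia.
    by apply: sub_count => x /=; lia.
  split => //.
  - move=> y hy; rewrite nge_notin; [|exact: uA|by apply/negP => /disj; rewrite hy].
    by apply: hF; rewrite mem_cat hy.
  - elim=> [|y IH]; first by rewrite (nle0 (dpart0 c2)); have := F1 0; lia.
    case: (boolP (y.+1 \in dpart c2)) => hy; first exact: hB1.
    rewrite nle_notin //; apply: leq_trans IH _; rewrite leq_add2l.
    by apply: sub_count => x /=; lia.
split; apply/allP => y hy //; last exact: hB2.
case: (boolP (y \in apart c2)) => hy'; first by rewrite -nge_mem.
rewrite -nge_notin //; apply: hF2; move: hy; by rewrite mem_cat (negbTE hy') orbF.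
Qed.

Lemma unmarked_marked_disjoint s c1 c2 : strict_partition s -> legal s (c1 ++ c2) ->
  hook c1 -> {in apart c1, forall y, y \notin dpart c2}.
Proof.
move=> hs l hk1 y hA; apply/negP => hD.
have [u [v [ea _ hv]]] := split_inc hk1 hA.
have [u' [v' [ed hu' _]]] := split_dec (sorted_dpart c2) hD.
move: l; rewrite -(cat_dpart c1) -(cat_dpart c2) ea ed.
have -> : (dpart c1 ++ u ++ y :: v) ++ (u' ++ y :: v') ++ apart c2 =
  (dpart c1 ++ u) ++ y :: (v ++ u') ++ y :: (v' ++ apart c2) by rewrite /= -!catA.
case/(legal_between_cat hs) => _ [y0|]; first by have := dpart0 c2; rewrite -y0 hD.
by rewrite mem_cat => /orP[/hv|/hu']; clear; lia.
Qed.

Lemma marked_marked_next s c1 c2 y : strict_partition s -> legal s (c1 ++ c2) ->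
  y \in dpart c1 -> y \in dpart c2 -> (y.+1 \in apart c1) || (y.+1 \in dpart c2).
Proof.
move=> hs l hD hD'; have [u [v [ed _ hv]]] := split_dec (sorted_dpart c1) hD.
have [u' [v' [ed' _ _]]] := split_dec (sorted_dpart c2) hD'.
rewrite -(cat_dpart c1) -(cat_dpart c2) ed {1}ed' in l; move: l.
have -> : ((u ++ y :: v) ++ apart c1) ++ (u' ++ y :: v') ++ apart c2 =
  u ++ y :: (v ++ apart c1 ++ u') ++ y :: (v' ++ apart c2) by rewrite /= -!catA.
case/(legal_between_cat hs); rewrite !mem_cat => /or3P[/hv h'|ha|hu] _.
- by move: h'; rewrite ltnNge leqnSn.
- by apply/orP; left.
- by apply/orP; right; rewrite ed' mem_cat hu.
Qed.

(** [ballot_D1D2] for two consecutive blocks; its hypotheses hold because two boxes on one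
   diagonal are separated by boxes on both neighbouring diagonals. *)
Lemma ballot_marked_strict s c1 c2 y : strict_partition s -> legal s (c1 ++ c2) ->
  hook c1 -> hook c2 -> ballot_pair c1 c2 -> y \in dpart c1 -> y \in dpart c2 ->
  nge (apart c2) 0 + nle (dpart c2) y < nge (apart c1) 0 + nle (dpart c1) y.
Proof.
move=> hs l hk1 hk2 hb.
have l1 : legal s c1 by move: l; rewrite legal_cat => /andP[].
have [s' hs' l2] := legal_suffix hs l.
have [_ _ hB1 hB2] := ballot_pairP _ hk2 (hook_disjoint hs' l2 hk2) hb.
have N_D2 z : (\max_(x <- dpart c2) x).+1 <= z -> z \notin dpart c2.
  move=> hz; apply/negP => zD.
  by have := @leq_bigmax_seq _ (dpart c2) predT id z zD isT; move=> /=; move: hz; clear; lia.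
have d1T z : z.+1 \in dpart c1 -> nle (dpart c1) z.+1 = (nle (dpart c1) z).+1.
  exact/nle_mem/uniq_dpart.
have d1F z : z.+1 \notin dpart c1 -> nle (dpart c1) z.+1 = nle (dpart c1) z.
  exact/nle_notin/uniq_dpart.
have d2T z : z.+1 \in dpart c2 -> nle (dpart c2) z.+1 = (nle (dpart c2) z).+1.
  exact/nle_mem/uniq_dpart.
have d2F z : z.+1 \notin dpart c2 -> nle (dpart c2) z.+1 = nle (dpart c2) z.
  exact/nle_notin/uniq_dpart.
apply: (@ballot_D1D2 (mem (dpart c1)) (mem (apart c1)) (mem (dpart c2)) (nle (dpart c1))
  (nge (apart c1)) (nle (dpart c2)) (nge (apart c2)) _ d1T d1F d2T d2F
  (nle0 (dpart0 c1)) (nle0 (dpart0 c2)) N_D2 _ _ _ hB1 hB2).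
- exact: hook_disjoint hs l1 hk1.
- exact: unmarked_marked_disjoint hs l hk1.
- by move=> z; apply: marked_marked_next hs l.
Qed.

(** The four strips of the two blocks are passed in turn; [slide_F1], [slide_F2],
   [slide_B1] and [slide_B2] apply because two boxes on one diagonal are separated by
   boxes on both neighbouring diagonals. *)
Lemma pass_ballot s h c1 c2 : strict_partition s -> legal s (h :: c1 ++ c2) ->
  hook c1 -> hook c2 -> ballot_pair c1 c2 ->
  ballot_pair (pass h c1).1 (pass (pass h c1).2 c2).1.
Proof.
move=> hs hl hk1 hk2 hb.
have hl1 : legal s (h :: c1) by move: hl; rewrite -cat_cons legal_cat => /andP[].
have [s2 hs2 hl2] := pass_legal_cat hs hl.
have [s0 hs0 l12] := @legal_suffix s [:: h] _ hs hl.
have [hk1' [e1 [[sD1 sA1 cD1 cA1 e1E] e1E']]] := pass_hook hs hl1 hk1.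
have [hk2' [e2 [[sD2 sA2 cD2 cA2 e2E] e2E']]] := pass_hook hs2 hl2 hk2.
have l1 : legal s0 c1 by move: l12; rewrite legal_cat => /andP[].
have [s0' hs0' l2] := legal_suffix hs0 l12.
have disj1 := hook_disjoint hs0 l1 hk1; have disj2 := hook_disjoint hs0' l2 hk2.
have hl' : legal s (h :: dpart c1 ++ apart c1 ++ dpart c2 ++ apart c2).
  by rewrite [dpart c1 ++ _]catA !cat_dpart.
have [s3 hs3 hl3] : exists2 s', strict_partition s' &
    legal s' ((pass h (dpart c1)).2 :: apart c1 ++ dpart c2 ++ apart c2).
  exact: pass_legal_cat hs hl'.
have [s4 hs4 hl4] : exists2 s', strict_partition s' &
    legal s' ((pass (pass h c1).2 (dpart c2)).2 :: apart c2).
  by apply: pass_legal_cat hs2 _; rewrite cat_dpart.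
set h1 := (pass h c1).2 in hl2 sA1 cA1 e1E' sD2 sA2 cD2 cA2 e2E e2E' hl4 *.
set g1 := (pass h (dpart c1)).2 in sD1 sA1 cD1 cA1 e1E' hl3.
set g2 := (pass h1 (dpart c2)).2 in sD2 sA2 cD2 cA2 e2E' hl4.
set h2 := (pass h1 c2).2 in sA2 cA2 e2E'.
have [hF1 hF2 hB1 hB2] := ballot_pairP _ hk2 disj2 hb.
pose D1 : pred nat := mem (dpart c1); pose A1 : pred nat := mem (apart c1).
pose D2 : pred nat := mem (dpart c2); pose A2 : pred nat := mem (apart c2).
pose d1 := nle (dpart c1); pose a1 := nge (apart c1).
pose d2 := nle (dpart c2); pose a2 := nge (apart c2).
have uA1 := uniq_apart hk1; have uA2 := uniq_apart hk2.
have uD1 := uniq_dpart c1; have uD2 := uniq_dpart c2.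
have a1T y : A1 y -> a1 y = (a1 y.+1).+1 by exact: nge_mem.
have a1F y : ~~ A1 y -> a1 y = a1 y.+1 by exact: nge_notin.
have a2T y : A2 y -> a2 y = (a2 y.+1).+1 by exact: nge_mem.
have a2F y : ~~ A2 y -> a2 y = a2 y.+1 by exact: nge_notin.
have d1T y : D1 y.+1 -> d1 y.+1 = (d1 y).+1 by exact: nle_mem.
have d1F y : ~~ D1 y.+1 -> d1 y.+1 = d1 y by exact: nle_notin.
have d2T y : D2 y.+1 -> d2 y.+1 = (d2 y).+1 by exact: nle_mem.
have d2F y : ~~ D2 y.+1 -> d2 y.+1 = d2 y by exact: nle_notin.
have D10 : ~~ D1 0 by exact: dpart0. have D20 : ~~ D2 0 by exact: dpart0.
have d10 : d1 0 = 0 by exact: nle0. have d20 : d2 0 = 0 by exact: nle0.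
have N_D2 y : (\max_(x <- dpart c2) x).+1 <= y -> ~~ D2 y.
  move=> hy; apply/negP => yD.
  by have := @leq_bigmax_seq _ (dpart c2) predT id y yD isT; move=> /=; move: hy; clear; lia.
have dj1 y : A1 y -> ~~ D1 y by exact: disj1.
have dj2 y : A2 y -> ~~ D2 y by exact: disj2.
have sd1 := sorted_dpart c1; have sd2 := sorted_dpart c2.
have A1D2 y : A1 y -> ~~ D2 y by exact: (unmarked_marked_disjoint hs0 l12 hk1).
have A1A2 y : A1 y.+1 -> A2 y.+1 -> D2 y || A2 y.
  move=> hA hA'; have [u [v [ea _ hv]]] := split_inc hk1 hA.
  have [u' [v' [ea' _ _]]] := split_inc hk2 hA'.
  have := hl'; rewrite ea {1}ea'.
  have -> : h :: dpart c1 ++ (u ++ y.+1 :: v) ++ dpart c2 ++ (u' ++ y.+1 :: v') =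
    (h :: dpart c1 ++ u) ++ y.+1 :: (v ++ dpart c2 ++ u') ++ y.+1 :: v' by rewrite /= -!catA.
  case/(legal_between_cat hs) => _ [//|]; rewrite !mem_cat /= => /or3P[/hv|hD|hu].
  - by rewrite ltnNge leqnSn.
  - by apply/orP; left.
  - by apply/orP; right; rewrite /A2 /= ea' mem_cat hu.
have D1D2 y : D1 y -> D2 y -> A1 y.+1 || D2 y.+1 by exact: (marked_marked_next hs0 l12).
have D1h0 : ~~ D1 h by apply: dec_notin hs hl' sd1 D10.
have A1h0 : A1 h -> D1 h.+1.
  move=> hA; have [u [v [ea hu _]]] := split_inc hk1 hA; have := hl'; rewrite ea.
  have -> : h :: dpart c1 ++ (u ++ h :: v) ++ dpart c2 ++ apart c2 =
    [::] ++ h :: (dpart c1 ++ u) ++ h :: (v ++ dpart c2 ++ apart c2) by rewrite /= -!catA.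
  case/(legal_between_cat hs); rewrite mem_cat => /orP[//|/hu]; clear; lia.
have D2h0 : D2 h -> [|| D1 h.+1, A1 h.+1 | D2 h.+1].
  move=> hD; have [u [v [ed _ _]]] := split_dec sd2 hD; have := hl'; rewrite {1}ed.
  have -> : h :: dpart c1 ++ apart c1 ++ (u ++ h :: v) ++ apart c2 =
    [::] ++ h :: (dpart c1 ++ apart c1 ++ u) ++ h :: (v ++ apart c2) by rewrite /= -!catA.
  case/(legal_between_cat hs); rewrite !mem_cat => /or3P[hd|ha|hu] _; apply/or3P.
  - exact: Or31.
  - exact: Or32.
  - by apply: Or33; rewrite /D2 /= ed mem_cat hu.
have A1g1 : ~~ A1 g1.
  apply/negP => hA; have [u [v [ea hu _]]] := split_inc hk1 hA; have := hl3; rewrite ea -catA.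
  by case/(@legal_between_cat s3 [::] g1 _ _ hs3) => /hu; clear; lia.
have D2g1 y : D2 y.+1 -> y.+1 = g1 -> A1 y.
  move=> hD eg; have [u [v [ed hu _]]] := split_dec sd2 hD; have := hl3; rewrite -eg {1}ed.
  rewrite -catA catA => /(@legal_between_cat s3 [::] _ _ _ hs3)[_ [//|]].
  by rewrite mem_cat => /orP[//|/hu]; clear; lia.
have A2g1 y : A2 y.+1 -> y.+1 = g1 -> [|| A1 y, D2 y | A2 y].
  move=> hA eg; have [u [v [ea hu _]]] := split_inc hk2 hA; have := hl3; rewrite -eg {1}ea.
  rewrite 2!catA => /(@legal_between_cat s3 [::] _ _ _ hs3)[_ [//|]].
  rewrite !mem_cat -orbA => /or3P[ha|hd|hy]; apply/or3P.
  - exact: Or31.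
  - exact: Or32.
  - by apply: Or33; rewrite /A2 /= ea mem_cat hy.
have hl2' : legal s2 (h1 :: dpart c2 ++ apart c2) by rewrite cat_dpart.
have D2h1 : ~~ D2 h1 by apply: dec_notin hs2 hl2' sd2 D20.
have A2h1 : A2 h1 -> D2 h1.+1.
  move=> hA; have [u [v [ea hu _]]] := split_inc hk2 hA; have := hl2'; rewrite ea catA.
  case/(@legal_between_cat s2 [::] _ _ _ hs2); rewrite mem_cat => /orP[//|/hu]; clear; lia.
have sp1P : e1 -> [/\ h = 0, g1 = 1, h1 = 0 & A1 0].
  by move=> he; have [-> ->] := e1E' he; move: he; rewrite e1E => /and3P[/eqP-> _ a0].
have sp2P : e2 -> [/\ h1 = 0, g2 = 1, h2 = 0, D2 1 & A2 0].
  by move=> he; have [-> ->] := e2E' he; move: he; rewrite e2E => /and3P[/eqP-> d10' a0'].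
have sp2N : ~~ e2 -> ~ [/\ h1 = 0, D2 1 & A2 0].
  by move=> he [h10 hD hA]; move: he; rewrite e2E h10 eqxx; move: hD hA; rewrite /D2 /A2 /= => -> ->.
have F1' := slide_F1 a1T a1F a2T a2F d1F d2T d2F d10 d20 D10 D20 dj1 dj2 A1D2 A1A2
  hF1 hF2 hB1 hB2 e1 sD1 sA1 sD2 sA2 A1g1 D2g1 A2g1 A2h1 sp2P.
have F2' := slide_F2 a1T a1F a2T a2F d1F d2F d10 d20 D20 dj1 dj2 A1D2 A1A2
  hF1 hF2 hB2 e1 sA1 sD2 sA2 A1g1 D2g1 A2g1 sp2P sp2N.
have B1' := slide_B1 d1T d1F d2T d2F d10 d20 D10 N_D2 dj1 A1D2 D1D2
  hB1 hB2 sD1 sA1 sD2 D1h0 A1h0 D2h0 D2g1.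
have B2' := slide_B2 d1T d1F d2T d2F d10 d20 dj1 A1D2 D1D2
  hB1 hB2 sD1 sA1 sD2 D1h0 A1h0 D2h0 sp1P.
have l2' : legal s2 (pass h1 c2).1.
  by have [] := pass_legal hs2 hl2; rewrite -cats1 legal_cat => /andP[].
have cF1 y := cA1 (leq y); have cF2 y := cA2 (leq y).
have cB1 y := cD1 (fun x => x <= y); have cB2 y := cD2 (fun x => x <= y).
apply/(ballot_pairP _ hk2' (hook_disjoint hs2 l2' hk2')); split.
- move=> y; have := F1' y; have := cF1 y; have := cF2 y.
  by rewrite /nge /a1 /a2 /nge !leqn0; clear; clia.
- move=> y yD; have hy : D2 y && (y != g2) || (y == h1) && (h1 != g2) && ~~ (e2 && (y == 0)).
    have := cD2 (pred1 y); rewrite !count_uniq_mem ?uniq_dpart // yD /=.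
    rewrite -[y \in dpart c2]/(D2 y); move: D2h1 D20; rewrite -/D2.
    rewrite ![y == _]eq_sym; case: (eqVneq h1 y) => [<-|_]; case: (D2 _) => //;
      by clear; case: (0 == _); case: e2; lia.
  have := F2' y hy; have := cF1 y; have := cF2 y.
  by rewrite /nge /a1 /a2 /nge !leqn0; clear; clia.
- move=> y; have := B1' y; have := cB1 y; have := cB2 y; have := cF1 0; have := cF2 0.
  by rewrite /nge /nle /a1 /a2 /d1 /d2 /nge /nle /=; clear; clia.
- move=> y yA.
  have hy : A1 y && (y != h1) || (y == g1) && (g1 != h1) || e1 && (y == 0).
    have := cA1 (pred1 y); rewrite !count_uniq_mem ?uniq_apart // yA /=.
    rewrite -[y \in apart c1]/(A1 y); move: A1g1; rewrite -/A1.
    by rewrite ![y == _]eq_sym; case: (eqVneq g1 y) => [<-|_]; case: (A1 _) => //;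
      clear; case: (0 == _); case: e1; lia.
  have := B2' y hy; have := cB1 y; have := cB2 y; have := cF1 0; have := cF2 0.
  by rewrite /nge /nle /a1 /a2 /d1 /d2 /nge /nle /=; clear; clia.
Qed.

(** * Exchanging two words *)

(** Moves the word [c] past the holes [u], from the last one to the first; a
   pair of words becomes the pair of words that they turn each other into. *)
Fixpoint infuse (u c : seq nat) : seq nat * seq nat :=
  if u is h :: u' then
    let p := infuse u' c in let q := pass h p.1 in (q.1, q.2 :: p.2)
  else (c, [::]).

Lemma infuse_cat u1 u2 c : infuse (u1 ++ u2) c =
  ((infuse u1 (infuse u2 c).1).1, (infuse u1 (infuse u2 c).1).2 ++ (infuse u2 c).2).
Proof. by elim: u1 => [|h u1 IH] /=; [case: (infuse u2 c) | rewrite IH]. Qed.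

(** The slides are undone one by one by [pass_rev]. *)
Lemma infuse_rev u c :
  infuse (rev (infuse u c).2) (rev (infuse u c).1) = (rev c, rev u).
Proof.
elim: u => //= h u IH; rewrite rev_cons -cats1 infuse_cat /= pass_rev /= IH /=.
by rewrite cats1 rev_cons.
Qed.

Definition uninfuse (c v : seq nat) : seq nat * seq nat :=
  let q := infuse (rev v) (rev c) in (rev q.2, rev q.1).

Lemma infuseK u c : uninfuse (infuse u c).1 (infuse u c).2 = (u, c).
Proof. by rewrite /uninfuse infuse_rev /= !revK. Qed.

Lemma uninfuseK c v : infuse (uninfuse c v).1 (uninfuse c v).2 = (c, v).
Proof. by rewrite /= infuse_rev !revK. Qed.

Lemma size_infuse u c : size (infuse u c).1 = size c /\ size (infuse u c).2 = size u.
Proof. by elim: u => //= h u [e1 e2]; rewrite size_pass e1 e2. Qed.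

Lemma size_uninfuse c v : size (uninfuse c v).1 = size v /\ size (uninfuse c v).2 = size c.
Proof.
by have := size_infuse (uninfuse c v).1 (uninfuse c v).2; rewrite uninfuseK /= => -[-> ->].
Qed.

Lemma infuse_legal s u c : strict_partition s -> legal s (u ++ c) ->
  legal s ((infuse u c).1 ++ (infuse u c).2) /\
  run s ((infuse u c).1 ++ (infuse u c).2) = run s (u ++ c).
Proof.
elim: u s => [|h u IH] s hs; first by rewrite /= cats0.
rewrite cat_cons => /andP[ah lu]; have [l r] := IH _ (strict_add_box hs ah) lu.
have lc : legal s (h :: (infuse u c).1) by move: l; rewrite /= ah legal_cat => /andP[].
have [l' r'] := pass_legal hs lc.
rewrite [infuse _ _]/= -cat_rcons legal_cat l' run_cat r' /=; split.
  by move: l; rewrite legal_cat => /andP[].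
by rewrite -r run_cat.
Qed.

(** The roles of the two words can be exchanged: letters of [c] slide backwards
   through [u]. *)
Lemma infuse_cons u x c : infuse u (x :: c) =
  let p := pass x (rev u) in let q := infuse (rev p.1) c in (p.2 :: q.1, q.2).
Proof.
elim: u => [|h u IH] /=; first by [].
rewrite IH rev_cons -cats1 pass_cat /= adj_sym; case: ifP => hx /=; by rewrite rev_cat /=.
Qed.

Lemma hook_rev w : hook w -> hook (rev w).
Proof.
move=> hw; case: (eqVneq w [::]) => [->//|/eqP w0].
have [d [j [a [-> _ _ sd sa]]]] := hookP hw w0.
rewrite rev_cat rev_cons cat_rcons; have [] // := @hook_cat (rev a) j (rev d).
  by rewrite -rev_cons rev_sorted.
by rewrite -rev_rcons rev_sorted.
Qed.

(** * Complements and reversal *)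

Definition bounded (n : nat) (s : seq nat) : bool := all (fun m => m <= n) s.

Lemma bounded_cnt n s : bounded n s = (cnt s n == 0).
Proof.
rewrite /cnt -leqn0 leqNgt -has_count -all_predC; apply: eq_all => x /=.
by rewrite -leqNgt.
Qed.

Lemma mem_dual n s m : (m \in dual_part n s) = (0 < m <= n) && (m \notin s).
Proof. by rewrite mem_filter mem_rho andbC. Qed.

Lemma strict_dual n s : strict_partition (dual_part n s).
Proof.
apply/andP; split; first by apply: (sorted_filter gtn_trans); exact: rho_sorted.
by rewrite mem_dual.
Qed.

Lemma bounded_dual n s : bounded n (dual_part n s).
Proof. by apply/allP => x; rewrite mem_dual => /andP[/andP[]]. Qed.

Lemma strict_pos s m : strict_partition s -> m \in s -> 0 < m.
Proof. by case/andP=> _ h ms; rewrite lt0n; apply: contraNneq h => <-. Qed.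

Lemma dualK n s : strict_partition s -> bounded n s -> dual_part n (dual_part n s) = s.
Proof.
move=> hs /allP hb; apply: strict_eq => //; first exact: strict_dual.
move=> m; rewrite !mem_dual; case: (boolP (m \in s)) => ms; last by case: (0 < m <= n).
by rewrite andbF andbT hb // (strict_pos hs ms).
Qed.

Lemma dual_nil n : dual_part n [::] = rho n.
Proof. by apply/all_filterP/allP. Qed.

Lemma dual_rho n : dual_part n (rho n) = [::].
Proof. by apply/eqP; rewrite -size_eq0 size_filter -leqn0 leqNgt -has_count; apply/hasP => -[x ->]. Qed.

Lemma add_box_dual n s x : strict_partition s -> addable s x -> bounded n (add_box s x) ->
  addable (dual_part n (add_box s x)) x /\
  add_box (dual_part n (add_box s x)) x = dual_part n s.
Proof.
move=> hs ax /allP hb; have hx : x < n.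
  by apply: hb; rewrite mem_add_box // eqxx.
have ad : addable (dual_part n (add_box s x)) x.
  rewrite /addable !mem_dual !mem_add_box // !eqxx /= !andbF /=.
  by case: x {ax hb} hx => //= x hx; rewrite ?andbT; lia.
split=> //; apply: strict_eq; first by apply: strict_add_box => //; exact: strict_dual.
  exact: strict_dual.
move=> m; rewrite mem_add_box ?strict_dual // !mem_dual mem_add_box //.
case/andP: ax => hx0 /negbTE hx1.
case: (eqVneq m x.+1) => [->|_] /=; first by rewrite hx1 hx.
case: (eqVneq m x) => [->|_]; last by rewrite !andbT.
by case/orP: hx0 => [/eqP->|->]; rewrite !andbF.
Qed.

Lemma bounded_run n s w : strict_partition s -> legal s w -> bounded n (run s w) ->
  bounded n s /\ all (fun x => x < n) w.
Proof.
elim: w s => //= x w IH s hs /andP[ax lw] hb.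
have [h1 ->] := IH _ (strict_add_box hs ax) lw hb; rewrite andbT.
move: h1; rewrite !bounded_cnt cnt_add_box // => h.
have hx : x < n.
  rewrite ltnNge; apply/negP => nx; move: h; rewrite addn_eq0; case: (ltngtP n x) nx => // [lt|->]; last by rewrite andbF.
  move=> _ /andP[/eqP h _]; case/andP: ax => /orP[/eqP x0|xs] _; first by rewrite x0 in lt.
  have : 0 < cnt s n by rewrite -has_count; apply/hasP; exists x.
  by rewrite h.
by split=> //; move: h; rewrite addn_eq0 => /andP[].
Qed.

(** A box turns a part [x] into [x.+1], and in the complement [x.+1] into [x]. *)
Lemma legal_dual n s w : strict_partition s -> legal s w -> bounded n (run s w) ->
  legal (dual_part n (run s w)) (rev w) /\
  run (dual_part n (run s w)) (rev w) = dual_part n s.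
Proof.
elim: w s => // x w IH s hs /andP[ax lw] hb.
have [h1 h2] := IH _ (strict_add_box hs ax) lw hb.
have [hb1 _] := bounded_run (strict_add_box hs ax) lw hb.
have [h3 h4] := add_box_dual hs ax hb1.
by rewrite rev_cons -cats1 legal_cat run_cat h1 h2 /= h3 h4.
Qed.

Lemma legal_rev s w : strict_partition s -> legal s w ->
  exists2 s', strict_partition s' & legal s' (rev w).
Proof.
move=> hs lw; have [n hn] := cnt_eventually (run s w).
have hb : bounded n (run s w) by rewrite bounded_cnt hn.
by exists (dual_part n (run s w)); [exact: strict_dual | have [] := legal_dual hs lw hb].
Qed.

Lemma infuse_nil u : infuse u [::] = ([::], u).
Proof. by elim: u => //= h u ->. Qed.

(** A letter of [c] sliding backwards through [u] leaves a hook word by [pass_hook]. *)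
Lemma infuse_hook s u c : strict_partition s -> legal s (u ++ c) -> hook u ->
  hook (infuse u c).2.
Proof.
elim: c s u => [|x c IH] s u hs; first by rewrite infuse_nil.
rewrite -cat_rcons => l hu; have lx := l; rewrite legal_cat in lx; case/andP: lx => lx lc.
have [s' hs' l'] := legal_rev hs lx; rewrite rev_rcons in l'.
have [hk _] := pass_hook hs' l' (hook_rev hu).
have := infuse_legal hs (u := u) (c := [:: x]); rewrite cats1 => /(_ lx).
rewrite infuse_cons /= infuse_nil /= => -[/andP[ap l2] r2].
rewrite infuse_cons /=; apply: (IH _ _ (strict_add_box hs ap)); last exact: hook_rev.
by rewrite legal_cat l2 -/(run _ _) r2 lc.
Qed.

Lemma uninfuse_hook s c v : strict_partition s -> legal s (c ++ v) -> hook v ->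
  hook (uninfuse c v).1.
Proof.
move=> hs /(legal_rev hs)[s' hs']; rewrite rev_cat => l hv.
exact: hook_rev (infuse_hook hs' l (hook_rev hv)).
Qed.

Lemma uninfuse_legal s c v : strict_partition s -> legal s (c ++ v) ->
  legal s ((uninfuse c v).1 ++ (uninfuse c v).2) /\
  run s ((uninfuse c v).1 ++ (uninfuse c v).2) = run s (c ++ v).
Proof.
move=> hs l; have [n hn] := cnt_eventually (run s (c ++ v)).
have hb : bounded n (run s (c ++ v)) by rewrite bounded_cnt hn.
have [l1 r1] := legal_dual hs l hb.
have hd := strict_dual n (run s (c ++ v)); rewrite rev_cat in l1 r1.
have [l2 r2] := infuse_legal hd l1.
have hs1 : bounded n s by have [] := bounded_run hs l hb.
have hb2 : bounded n (run (dual_part n (run s (c ++ v)))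
    ((infuse (rev v) (rev c)).1 ++ (infuse (rev v) (rev c)).2)).
  by rewrite r2 r1 bounded_dual.
have := legal_dual hd l2 hb2; rewrite r2 r1 !dualK // ?rev_cat //.
by apply: strict_run.
Qed.

Lemma add_box_rcons s k : 0 < k -> k \notin s -> add_box (rcons s k) k = rcons s k.+1.
Proof.
by move=> k0 ks; rewrite /add_box; elim: s ks => [|a s IH] /=;
  [rewrite eqxx | rewrite inE negb_or eq_sym => /andP[/negbTE-> /IH] /= ->].
Qed.

Lemma iota_row s m : strict_partition s -> {in s, forall x, m < x} ->
  legal s (iota 0 m) /\ run s (iota 0 m) = if m is 0 then s else rcons s m.
Proof.
move=> hs; elim: m => [//|m IH] hm.
have [|l r] := IH; first by move=> x xs; have := hm _ xs; lia.
rewrite -addn1 iotaD legal_cat run_cat l r /= andbT add0n addn1.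
case: m hm {IH l r} => [|m] hm.
  rewrite /addable eqxx /=; split; first by apply/negP => /hm.
  rewrite /add_box memNindex; last by case/andP: hs.
  by elim: s {hs hm} => //= a s ->.
have ms : m.+1 \notin s by apply/negP => /hm; lia.
rewrite add_box_rcons // /addable mem_rcons mem_head orbT /=; split => //.
by rewrite mem_rcons inE negb_or; apply/andP; split; [lia | apply/negP => /hm; lia].
Qed.

Lemma strict_rcons_inv s m : strict_partition (rcons s m) ->
  [/\ strict_partition s, 0 < m & {in s, forall x, m < x}].
Proof.
case/andP; rewrite mem_rcons inE negb_or (sorted_pairwise gtn_trans) pairwise_rcons.
move=> /andP[/allP h ss] /andP[m0 s0]; split=> //; last by rewrite lt0n eq_sym.
by rewrite /strict_partition (sorted_pairwise gtn_trans) ss.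
Qed.

Lemma path_to s : strict_partition s -> exists2 w, legal [::] w & run [::] w = s.
Proof.
elim/last_ind: s => [|s m IH] hs; first by exists [::].
have [hs' m0 hm] := strict_rcons_inv hs; have [w lw rw] := IH hs'.
have [l r] := iota_row hs' hm; exists (w ++ iota 0 m).
  by rewrite legal_cat lw rw l.
by rewrite run_cat rw r; case: m m0 {hs hm l r}.
Qed.

Lemma path_from n s : strict_partition s -> bounded n s ->
  exists2 w, legal s w & run s w = rho n.
Proof.
move=> hs hb; have [w lw rw] := path_to (strict_dual n s).
have hb' : bounded n (run [::] w) by rewrite rw bounded_dual.
have [] := @legal_dual n [::] w isT lw hb'; rewrite rw dualK // dual_nil.
by exists (rev w).
Qed.

(** * Straight shapes *)

Lemma dpart_iota k m : dpart (iota k m) = [::].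
Proof. by case: m => [|[|m]] //=; rewrite ltnNge leqnSn. Qed.

Lemma apart_iota k m : apart (iota k m) = iota k m.
Proof. by rewrite /apart dpart_iota drop0. Qed.

Lemma hook_iota k m : hook (iota k m).
Proof. by rewrite /hook apart_iota iota_ltn_sorted. Qed.

Lemma nge_iota m y : nge (iota 0 m) y = m - y.
Proof.
rewrite /nge; elim: m => [|m IH]; first by rewrite sub0n.
rewrite -addn1 iotaD count_cat IH /= add0n; lia.
Qed.

Lemma ballot_iota a b : b < a -> ballot_pair (iota 0 a) (iota 0 b).
Proof.
move=> ab; rewrite /ballot_pair !apart_iota !dpart_iota /=.
by apply/andP; split; apply/allP => y; rewrite mem_iota !nge_iota; lia.
Qed.

(** Contents below all parts leave only a new row to be lengthened. *)
Lemma new_row s c : strict_partition s -> legal s c -> hook c ->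
  {in c & s, forall x y, x < y} -> c = iota 0 (size c) /\ {in s, forall y, size c < y}.
Proof.
move=> hs lc hc lt; have sc : sorted ltn c.
  case: c lc hc lt => // x c /andP[/andP[hx _] _].
  case/orP: hx => [/eqP->|xs] hc lt; last by have := lt x x (mem_head _ _) xs; rewrite ltnn.
  by move: hc; rewrite /hook /apart; case: c {lt} => [|y c] //=.
elim/last_ind: c lc {hc} lt sc => [|c x IH].
  by move=> _ _ _; split => // y ys; apply: strict_pos ys.
rewrite -cats1 legal_cat => /andP[lc lx] lt; rewrite (sorted_pairwise ltn_trans) cats1.
rewrite pairwise_rcons -(sorted_pairwise ltn_trans) => /andP[/allP cx sc].
have [|ec hm] := IH lc _ sc.
  by move=> u v uc vs; apply: lt vs; rewrite mem_cat uc.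
have [_ r] := iota_row hs hm; rewrite ec r /= andbT in lx; case/andP: lx => h1 h2.
have ltx v : v \in s -> x < v by apply: lt; rewrite mem_cat mem_head orbT.
have ex : x = size c.
  case: (size c) ec h1 {r h2 hm} => [|k] ec h1.
    by case/orP: h1 => [/eqP//|/ltx]; rewrite ltnn.
  have kc : k \in c by rewrite ec mem_iota; lia.
  case/orP: h1 => [/eqP x0|]; first by have := cx _ kc; rewrite x0.
  by rewrite mem_rcons inE => /predU1P[//|/ltx]; rewrite ltnn.
split; first by rewrite size_rcons -cats1 {1}ec ex -[(size c).+1]addn1 iotaD.
move=> y ys; rewrite size_rcons ltn_neqAle -{2}ex ltx // andbT; apply: contraNneq h2 => ey.
by rewrite ex ey; case: (size c) => [|k]; rewrite ?mem_rcons ?inE ys ?orbT.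
Qed.

Definition lrs (bs : seq (seq nat)) : bool := all hook bs && sorted ballot_pair bs.

Lemma ballot_letters c1 c2 y : ballot_pair c1 c2 -> y \in c2 -> 0 < nge (apart c1) y.
Proof.
by case/and3P => /allP h _ _; rewrite -{1}(cat_dpart c2) => /h; apply: leq_ltn_trans.
Qed.

Lemma strict_rcons s m : strict_partition s -> 0 < m -> {in s, forall x, m < x} ->
  strict_partition (rcons s m).
Proof.
case/andP=> ss s0 m0 h; rewrite /strict_partition mem_rcons inE negb_or s0 andbT.
by rewrite (rcons_sorted_gtn ss h) /=; lia.
Qed.

(** By the ballot condition the contents of a block are smaller than the last part, so
   [new_row] applies to one block after the other. *)
Lemma straight_blocks_from s m bs : strict_partition (rcons s m) ->
  legal (rcons s m) (flatten bs) -> all hook bs -> [::] \notin bs ->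
  path ballot_pair (iota 0 m) bs ->
  bs = map (iota 0) (map size bs) /\ run (rcons s m) (flatten bs) = rcons s m ++ map size bs.
Proof.
elim: bs s m => [|c bs IH] s m hs /=; first by rewrite cats0.
rewrite legal_cat inE negb_or eq_sym => /andP[lc lbs] /andP[hc hbs] /andP[c0 nbs] /andP[bc pbs].
have [|ec hm] := new_row hs lc hc.
  move=> x y xc; have := ballot_letters bc xc; rewrite apart_iota nge_iota => xm ys.
  have : m <= y.
    move: ys; rewrite mem_rcons inE => /predU1P[->//|ys].
    by have [_ _ h] := strict_rcons_inv hs; apply: ltnW (h _ ys).
  lia.
have c1 : 0 < size c by rewrite lt0n size_eq0.
have hs' := strict_rcons hs c1 hm; have [_ r] := iota_row hs hm; rewrite -ec in r.
have {}r : run (rcons s m) c = rcons (rcons s m) (size c) by rewrite r; case: (size c) c1.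
rewrite r in lbs; rewrite ec in pbs; have [e1 e2] := IH _ _ hs' lbs hbs nbs pbs.
by rewrite -ec -e1 run_cat r e2 cat_rcons.
Qed.

Lemma straight_blocks bs : legal [::] (flatten bs) -> lrs bs -> [::] \notin bs ->
  bs = map (iota 0) (map size bs) /\ run [::] (flatten bs) = map size bs.
Proof.
case: bs => // c bs; rewrite /= legal_cat /lrs inE negb_or eq_sym /=.
move=> /andP[lc lbs] /andP[/andP[hc hbs] pbs] /andP[c0 nbs].
have [|ec _] := @new_row [::] c isT lc hc; first by [].
have c1 : 0 < size c by rewrite lt0n size_eq0.
have [_ r] := @iota_row [::] (size c) isT (fun _ => ltac:(by [])); rewrite -ec in r.
have {}r : run [::] c = rcons [::] (size c) by rewrite r; case: (size c) c1.
rewrite r in lbs; rewrite ec in pbs.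
have hs : strict_partition (rcons [::] (size c)) by exact: (@strict_rcons [::]).
have [e1 e2] := straight_blocks_from hs lbs hbs nbs pbs.
by rewrite -ec -e1 run_cat r e2.
Qed.

Lemma straight_word kap : strict_partition kap ->
  let bs := map (iota 0) kap in
  [/\ legal [::] (flatten bs), run [::] (flatten bs) = kap & lrs bs].
Proof.
move=> hk /=; have [sk k0] := andP hk.
have hl : lrs (map (iota 0) kap).
  apply/andP; split; first by apply/allP => b /mapP[m _ ->]; apply: hook_iota.
  by rewrite sorted_map; apply: sub_sorted sk => x y; apply: ballot_iota.
suff [] : legal [::] (flatten (map (iota 0) kap)) /\
  run [::] (flatten (map (iota 0) kap)) = kap by split.
elim/last_ind: kap hk {sk k0 hl} => // s m IH hs.
have [hs' m0 hm] := strict_rcons_inv hs.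
have [l1 r1] := IH hs'; have [l r] := iota_row hs' hm.
rewrite map_rcons -cats1 flatten_cat /= cats0 legal_cat run_cat l1 r1 l r; split => //.
by case: m m0 {hs hm l r}.
Qed.

(** * Two-row shapes in a staircase *)

Lemma extend_row b k j : 0 < b < k ->
  legal [:: k; b] (iota k j) /\ run [:: k; b] (iota k j) = [:: k + j; b].
Proof.
elim: j k => [|j IH] k hb /=; first by rewrite addn0.
have [|l r] := IH k.+1; first by lia.
rewrite /addable !inE eqxx orbT /= /add_box /= eqxx /= l r addSnnS; split => //.
by apply/andP; split => //; lia.
Qed.

(** The word [c1 ++ c2] is the reverse of a word that builds the shape (a, b) from the
   empty one, so it leads from the complement of (a, b) to the staircase. *)
Lemma top_pair n a b : 0 < b < a -> a <= n -> exists c1 c2,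
  [/\ size c1 = a, size c2 = b, hook c1, hook c2 & ballot_pair c1 c2] /\
  legal (dual_part n [:: a; b]) (c1 ++ c2) /\
  run (dual_part n [:: a; b]) (c1 ++ c2) = rho n.
Proof.
case: b => // b /= ba an; set x := iota b.+2 (a - b.+2).
pose c2 := rev (iota 0 b.+1).
have ec2 : c2 = rev (iota 1 b) ++ [:: 0] by rewrite /c2 /= rev_cons cats1.
pose c1 := rev x ++ rev (iota 1 b) ++ [:: 0; b.+1].
have e1 : c1 ++ c2 = rev (iota 0 b.+2 ++ iota 0 b.+1 ++ x).
  have ei : rev (iota 0 b.+2) = b.+1 :: c2 by rewrite -[b.+2]addn1 iotaD rev_cat.
  by rewrite !rev_cat ei -/c2 /c1 -!catA {2}ec2 -catA.
have sx : sorted gtn (rcons (rev x ++ rev (iota 1 b)) 0).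
  apply: rcons_sorted_gtn; last first.
    by move=> y; rewrite mem_cat !mem_rev !mem_iota; lia.
  rewrite -rev_cat rev_sorted (sorted_pairwise ltn_trans) pairwise_cat.
  rewrite -!(sorted_pairwise ltn_trans) !iota_ltn_sorted andbT /= andbT.
  by apply/allrelP => u v; rewrite !mem_iota /=; lia.
have sx2 : sorted gtn (rcons (rev (iota 1 b)) 0).
  apply: rcons_sorted_gtn; last by move=> y; rewrite mem_rev mem_iota; lia.
  by rewrite rev_sorted iota_ltn_sorted.
have [h1 d1 a1] := @hook_cat _ 0 [:: b.+1] sx isT.
have [h2 d2 a2] := @hook_cat _ 0 [::] sx2 isT.
rewrite -catA in h1 d1 a1; exists c1, c2; split; last first.
  have lt1 : {in [::], forall y, b.+2 < y} by [].
  have [l1 r1] := @iota_row [::] b.+2 isT lt1.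
  have [l2 r2] : legal [:: b.+2] (iota 0 b.+1) /\ run [:: b.+2] (iota 0 b.+1) = [:: b.+2; b.+1].
    by apply: (@iota_row [:: b.+2] b.+1 isT) => y; rewrite inE => /eqP->.
  have [|l3 r3] := @extend_row b.+1 b.+2 (a - b.+2); first by rewrite ltnSn.
  have l : legal [::] (iota 0 b.+2 ++ iota 0 b.+1 ++ x).
    by rewrite !legal_cat l1 r1 l2 r2 l3.
  have r : run [::] (iota 0 b.+2 ++ iota 0 b.+1 ++ x) = [:: a; b.+1].
    by rewrite !run_cat r1 r2 r3 subnKC.
  have hb : bounded n (run [::] (iota 0 b.+2 ++ iota 0 b.+1 ++ x)).
    by rewrite r /= an (leq_trans (ltnW ba) an).
  by have := @legal_dual n [::] _ isT l hb; rewrite e1 r dual_nil.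
split; rewrite ?ec2 //.
- by rewrite /c1 !size_cat !size_rev /x !size_iota /=; lia.
- by rewrite size_cat size_rev size_iota addn1.
rewrite /ballot_pair a1 a2 d1 d2; apply/and3P; split; apply/allP => y.
- by rewrite mem_cat mem_rev mem_iota !inE /nge /=; lia.
- move=> _; rewrite /nge /nle count_cat /=; clear; clia.
- move=> _; rewrite /nge /nle count_cat /=; clear; clia.
Qed.

Fixpoint words (n k : nat) : seq (seq nat) :=
  if k is k'.+1 then [seq x :: w | x <- iota 0 n, w <- words n k'] else [:: [::]].

Lemma mem_words n k w : (w \in words n k) = (size w == k) && all (fun x => x < n) w.
Proof.
elim: k w => [|k IH] [|x w] //=.
  by apply/negP => /allpairsP[[y v]] [_ _].
apply/allpairsP/idP => [[[y v] /= [hy hv [-> ->]]]|/andP[hs /andP[hx hw]]].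
  by move: hv hy; rewrite IH mem_iota eqSS => /andP[-> ->] /= ->.
by exists (x, w); rewrite IH mem_iota hw hx -eqSS hs.
Qed.

Lemma words_uniq n k : uniq (words n k).
Proof.
elim: k => //= k IH; apply: allpairs_uniq => //; first exact: iota_uniq.
by move=> [x v] [y w] _ _ /= [-> ->].
Qed.

Lemma mem_words_run n s w : strict_partition s -> legal s w -> bounded n (run s w) ->
  w \in words n (size w).
Proof. by move=> hs lw hb; rewrite mem_words eqxx; have [] := bounded_run hs lw hb. Qed.

Lemma sumn_add_box s x : strict_partition s -> addable s x ->
  sumn (add_box s x) = (sumn s).+1.
Proof.
elim: s => [|a s IH] hs; first by rewrite /addable in_nil orbF andbT => /eqP->.
rewrite /addable !inE negb_or => /andP[h /andP[xa xs]].
rewrite /add_box /=; case: eqP => [<-|/eqP ne] //=.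
rewrite -/(add_box s x) IH ?addnS //; first exact: strict_cons hs.
rewrite /addable xs andbT; case/or3P: h => [->//|/eqP|->]; last by rewrite orbT.
by move=> e; rewrite e eqxx in ne.
Qed.

Lemma sumn_run s w : strict_partition s -> legal s w -> sumn (run s w) = sumn s + size w.
Proof.
elim: w s => [|x w IH] s hs /=; first by rewrite addn0.
by case/andP=> ax lw; rewrite IH ?strict_add_box // sumn_add_box // addSnnS.
Qed.

(** * Slides reflect the ballot conditions *)

Fixpoint pass_blocks (h : nat) (bs : seq (seq nat)) : seq (seq nat) :=
  if bs is b :: bs' then (pass h b).1 :: pass_blocks (pass h b).2 bs' else [::].

Lemma pass_flatten h bs : (pass h (flatten bs)).1 = flatten (pass_blocks h bs).
Proof. by elim: bs h => //= b bs IH h; rewrite pass_cat /= IH. Qed.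

Lemma shape_pass_blocks h bs : shape (pass_blocks h bs) = shape bs.
Proof. by elim: bs h => //= b bs IH h; rewrite size_pass IH. Qed.

Lemma pass_lrs s h bs : strict_partition s -> legal s (h :: flatten bs) -> lrs bs ->
  lrs (pass_blocks h bs).
Proof.
elim: bs s h => // b bs IH s h hs hl /andP[/= /andP[hb hbs] pb].
have l1 : legal s (h :: b) by move: hl; rewrite [flatten _]/= -cat_cons legal_cat => /andP[].
have [hk _] := pass_hook hs l1 hb.
have [s' hs' l'] := pass_legal_cat hs hl.
have {}IH : lrs (pass_blocks (pass h b).2 bs).
  by apply: IH hs' l' _; rewrite /lrs hbs (path_sorted pb).
rewrite /lrs /= hk /=; case/andP: IH => -> /=.
case: bs hbs pb hl {l'} => [//|b' bs] /andP[hb' _] /andP[bb' _] hl /= ->.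
rewrite andbT; apply: pass_ballot hs _ hb hb' bb'.
by move: hl; rewrite [flatten _]/= catA -cat_cons legal_cat => /andP[].
Qed.

Definition lrs_word (kap c : seq nat) : bool :=
  (size c == sumn kap) && lrs (reshape kap c).

Lemma lrs_wordP kap c : lrs_word kap c -> exists bs,
  [/\ c = flatten bs, shape bs = kap & lrs bs].
Proof.
case/andP => /eqP e h; exists (reshape kap c).
by rewrite reshapeKr ?e // reshapeKl ?e.
Qed.

Lemma lrs_word_flatten bs : lrs_word (shape bs) (flatten bs) = lrs bs.
Proof. by rewrite /lrs_word size_flatten eqxx flattenK. Qed.

Lemma pass_lrs_word s h c kap : strict_partition s -> legal s (h :: c) -> lrs_word kap c ->
  lrs_word kap (pass h c).1.
Proof.
move=> hs hl /lrs_wordP[bs [ec <- hb]]; rewrite ec in hl *.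
by rewrite pass_flatten -(shape_pass_blocks h) lrs_word_flatten (pass_lrs hs hl).
Qed.

Lemma infuse_lrs_word s u c kap : strict_partition s -> legal s (u ++ c) ->
  lrs_word kap c -> lrs_word kap (infuse u c).1.
Proof.
elim: u s => //= h u IH s hs /andP[ah l] hc.
have hs' := strict_add_box hs ah; have [l' _] := infuse_legal hs' l.
by apply: (pass_lrs_word hs _ (IH _ hs' l hc)); move: l'; rewrite /= ah legal_cat => /andP[].
Qed.

Lemma pass_hook_conv s h c : strict_partition s -> legal s (h :: c) ->
  hook (pass h c).1 -> hook c.
Proof.
move=> hs hl hk; have [l r] := pass_legal hs hl.
have [s' hs'] := legal_rev hs l; rewrite rev_rcons => l'.
have [] := pass_hook hs' l' (hook_rev hk); rewrite pass_rev /= => h' _.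
by rewrite -[c]revK hook_rev.
Qed.

Lemma ballot_pair_nil c : ballot_pair c [::].
Proof.
rewrite /ballot_pair /=; apply/allP => y yA; apply: ltn_addr.
by rewrite -has_count; apply/hasP; exists y.
Qed.

(** By [top_pair] there are at least as many pairs (u, c) as words u from the empty
   partition to the complement of (a, b).  As c is unique on a straight shape, there are
   at most as many pairs (c, v) as words v from (a, b) to the staircase.  Complements
   match these two sets of words, so the injection [infuse] is onto. *)
Lemma infuse_onto n a b p : 0 < b < a -> a <= n ->
  let good (u c : seq nat) :=
    [&& legal [::] (u ++ c) & run [::] (u ++ c) == rho n] in
  forall c v, good c v -> lrs_word [:: a; b] c -> size v = p ->
  lrs_word [:: a; b] (uninfuse c v).2.
Proof.
move=> ba an good.
pose T0 := [seq t <- [seq (x, y) | x <- words n (a + b), y <- words n p]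
           | good t.1 t.2 && lrs_word [:: a; b] t.1].
pose T1 := [seq t <- [seq (x, y) | x <- words n p, y <- words n (a + b)]
           | good t.1 t.2 && lrs_word [:: a; b] t.2].
pose Q0 := [seq v <- words n p | legal [:: a; b] v & run [:: a; b] v == rho n].
pose Q1 := [seq u <- words n p | legal [::] u & run [::] u == dual_part n [:: a; b]].
have hab : strict_partition [:: a; b].
  by rewrite /strict_partition /= !inE; lia.
have brho : bounded n (rho n) by apply/allP => x; rewrite mem_rho => /andP[].
have uT0 : uniq T0.
  by apply: filter_uniq; apply: allpairs_uniq; rewrite ?words_uniq // => -[? ?] [? ?].
have uT1 : uniq T1.
  by apply: filter_uniq; apply: allpairs_uniq; rewrite ?words_uniq // => -[? ?] [? ?].
have mem_good k l u c : good u c -> size u = k -> size c = l ->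
    u \in words n k /\ c \in words n l.
  case/andP => lg /eqP rg su sc; have := @bounded_run n [::] _ isT lg.
  by rewrite rg all_cat => /(_ brho)[_ /andP[hu hc]]; rewrite !mem_words su sc !eqxx.
have lrs_size c : lrs_word [:: a; b] c -> size c = a + b.
  by case/andP => /eqP -> _; rewrite /= addn0.
have straight c v : good c v -> lrs_word [:: a; b] c ->
    c = iota 0 a ++ iota 0 b /\ run [::] c = [:: a; b].
  case/andP=> lg _ /lrs_wordP[bs [ec sb hb]]; rewrite legal_cat ec in lg.
  case/andP: lg => lg _; have [|e1 e2] := straight_blocks lg hb.
    by apply/negP => /(map_f size); rewrite -/(shape bs) sb !inE /=; lia.
  by rewrite ec; split; [rewrite e1 -/(shape bs) sb /= cats0 | rewrite e2 -/(shape bs) sb].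
have le0 : size T0 <= size Q0.
  rewrite -(size_map snd); apply: uniq_leq_size.
    rewrite map_inj_in_uniq // => -[c v] [c' v'].
    rewrite !mem_filter /= => /andP[/andP[g l] _] /andP[/andP[g' l'] _] ->.
    by have [-> _] := straight _ _ g l; have [-> _] := straight _ _ g' l'.
  move=> v /mapP[[c v'] ht ->]; move: ht; rewrite !mem_filter /= => /andP[/andP[g l] ht].
  have [_ r] := straight _ _ g l; case/andP: (g) => lg rg.
  rewrite legal_cat r in lg; rewrite run_cat r in rg; case/andP: lg => _ ->; rewrite rg /=.
  by case/allpairsP: ht => -[x y] /= [_ hy [_ ->]].
have le1 : size Q0 <= size Q1.
  rewrite -(size_map rev); apply: uniq_leq_size.
    by rewrite map_inj_uniq ?filter_uniq ?words_uniq //; exact: inv_inj revK.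
  move=> w /mapP[v]; rewrite mem_filter => /andP[/andP[lv /eqP rv] hv] ->.
  have [] := @legal_dual n [:: a; b] v hab lv; first by rewrite rv.
  rewrite rv dual_rho mem_filter => -> ->; rewrite eqxx /=.
  by move: hv; rewrite !mem_words size_rev all_rev.
have le2 : size Q1 <= size T1.
  have [c1 [c2 [[s1 s2 h1 h2 hb] [l r]]]] := top_pair ba an.
  rewrite -(size_map (fun u => (u, c1 ++ c2))); apply: uniq_leq_size.
    by rewrite map_inj_uniq ?filter_uniq ?words_uniq // => x y [].
  move=> t /mapP[u]; rewrite mem_filter => /andP[/andP[lu /eqP ru] hu] ->.
  have g : good u (c1 ++ c2) by rewrite /good legal_cat run_cat lu ru l r eqxx.
  have ss : size (c1 ++ c2) = a + b by rewrite size_cat s1 s2.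
  have [_ hc] := mem_good _ _ _ _ g erefl ss.
  rewrite mem_filter g /=; apply/andP; split; last by apply/allpairsP; exists (u, c1 ++ c2).
  have := lrs_word_flatten [:: c1; c2]; rewrite /= cats0 s1 s2 => ->.
  by rewrite /lrs /= h1 h2 hb.
pose f (t : seq nat * seq nat) := infuse t.1 t.2.
have sub : {subset map f T1 <= T0}.
  move=> t /mapP[[u c]]; rewrite mem_filter /= => /andP[/andP[g l] ht] ->.
  case/andP: (g) => lg rg; have [l' r'] := @infuse_legal [::] u c isT lg.
  have hl := @infuse_lrs_word [::] u c _ isT lg l.
  have g' : good (f (u, c)).1 (f (u, c)).2 by rewrite /good /f l' r'.
  case/allpairsP: ht => -[x y] /= [hx _ [eu _]].
  have [_ su] := size_infuse u c; move: hx; rewrite -eu mem_words => /andP[/eqP sz _].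
  have [h1 h2] := mem_good _ _ _ _ g' (lrs_size _ hl) (etrans su sz).
  rewrite mem_filter g' hl /=; apply/allpairsP; exists (f (u, c)); split => //.
  by case: (f _).
have uf : uniq (map f T1).
  rewrite map_inj_in_uniq // => -[u c] [u' c'] _ _ e.
  by rewrite -(infuseK u c) -(infuseK u' c'); move: e; rewrite /f /= => ->.
have [|_ onto] := uniq_min_size uf sub.
  by rewrite size_map; apply: leq_trans le0 (leq_trans le1 le2).
move=> c v g l sv; have [hc hv] := mem_good _ _ _ _ g (lrs_size _ l) sv.
have : (c, v) \in T0.
  by rewrite mem_filter /= g l; apply/allpairsP; exists (c, v).
rewrite -onto => /mapP[[u c']]; rewrite mem_filter => /andP[/andP[_ l'] _] e.
have eU := infuseK u c'; rewrite -[infuse u c']/(f (u, c')) -e in eU.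
by have -> : uninfuse c v = (u, c') := eU.
Qed.

(** The converse of [pass_ballot]: move the hole and the pair of words into a
   staircase, where [infuse_onto] applies. *)
Lemma pass_ballot_conv s h c1 c2 : strict_partition s -> legal s (h :: c1 ++ c2) ->
  hook c1 -> hook c2 -> ballot_pair (pass h c1).1 (pass (pass h c1).2 c2).1 ->
  ballot_pair c1 c2.
Proof.
move=> hs hl h1 h2 hb; case: (eqVneq c2 [::]) => [->|c20]; first exact: ballot_pair_nil.
have hs1 : strict_partition (run s [:: h]) by apply: strict_run => //; case/andP: hl => /= ->.
have [u lu ru] := path_to hs.
have [n hn] := cnt_eventually (run s (h :: c1 ++ c2)).
have hbd : bounded n (run s (h :: c1 ++ c2)) by rewrite bounded_cnt hn.
have [v lv rv] := path_from (strict_run hs hl) hbd.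
set a := size c1; set b := size c2.
have l' := pass_legal hs hl; set c' := (pass h (c1 ++ c2)).1 in l'.
set h' := (pass h (c1 ++ c2)).2 in l'.
have lc' : lrs_word [:: a; b] c'.
  have := lrs_word_flatten (pass_blocks h [:: c1; c2]).
  rewrite -pass_flatten shape_pass_blocks /= cats0 => ->.
  have l1 : legal s (h :: c1) by move: hl; rewrite -cat_cons legal_cat => /andP[].
  have [s' hs' l2] := pass_legal_cat hs hl.
  have [hk1 _] := pass_hook hs l1 h1; have [hk2 _] := pass_hook hs' l2 h2.
  by rewrite /lrs /= hk1 hk2 hb.
have g0 : legal [::] (u ++ c') by case: l'; rewrite legal_cat lu ru -cats1 legal_cat => /andP[].
have [g1 r1] := @infuse_legal [::] u c' isT g0.
have lc'' := @infuse_lrs_word [::] u c' _ isT g0 lc'.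
set c'' := (infuse u c').1 in g1 r1 lc''; set u'' := (infuse u c').2 in g1 r1.
have [bs [ebs sbs hbs]] := lrs_wordP lc''.
have b0 : 0 < b by rewrite lt0n size_eq0.
have a0 : 0 < a.
  rewrite lt0n size_eq0; apply/negP => /eqP c1n; move: hb; rewrite c1n /=.
  case e: (pass h c2).1 => [|y w]; first by move: c20; rewrite -size_eq0 -(size_pass h c2) e.
  by move/ballot_letters => /(_ y (mem_head _ _)).
have lg : legal [::] (flatten bs) by rewrite -ebs; move: g1; rewrite legal_cat => /andP[].
have [|_ rr] := straight_blocks lg hbs.
  by apply/negP => /(map_f size); rewrite -/(shape bs) sbs !inE /=; move: a0 b0; clear; lia.
rewrite -/(shape bs) sbs -ebs in rr.
have hg : legal [::] (c'' ++ u'' ++ h' :: v) /\ run [::] (c'' ++ u'' ++ h' :: v) = rho n.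
  rewrite catA legal_cat (run_cat _ (c'' ++ u'')) g1 r1 run_cat ru.
  case: l' => l2 r2; rewrite -cats1 legal_cat in l2; case/andP: l2 => l2 l3.
  move: r2; rewrite -cats1 run_cat => r2.
  by rewrite -cat1s legal_cat run_cat l3 r2 lv rv.
have ba : b < a.
  have lc : legal [::] c'' by case: hg; rewrite legal_cat => /andP[].
  have := @strict_run [::] c'' isT lc; rewrite rr /strict_partition /= !inE; clear; lia.
have an : a <= n.
  have brho : bounded n (rho n) by apply/allP => x; rewrite mem_rho => /andP[].
  case: hg => hg1 hg2; rewrite legal_cat in hg1; case/andP: hg1 => h3 h4.
  have := @bounded_run n _ _ (@strict_run [::] c'' isT h3) h4; rewrite -run_cat hg2 => /(_ brho)[].
  by rewrite rr /= => /andP[].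
have lvc : legal (run s [:: h]) ((c1 ++ c2) ++ v).
  move: hl; rewrite /= => /andP[ah l]; rewrite legal_cat l /=; exact: lv.
have [lU rU] := uninfuse_legal hs1 lvc.
have eU := uninfuseK (c1 ++ c2) v.
set V := (uninfuse (c1 ++ c2) v).1 in lU rU eU; set C := (uninfuse (c1 ++ c2) v).2 in lU rU eU.
have eI : infuse (u ++ h :: V) C = (c'', u'' ++ h' :: v).
  by rewrite infuse_cat /= eU.
have lC : lrs_word [:: a; b] C.
  have := @infuse_onto n a b _ _ an c'' (u'' ++ h' :: v); rewrite b0 ba => /(_ _ isT).
  have eU' := infuseK (u ++ h :: V) C; rewrite eI in eU'.
  have -> : uninfuse c'' (u'' ++ h' :: v) = (u ++ h :: V, C) := eU'.
  apply => //.
  by rewrite (proj1 hg) (proj2 hg) eqxx.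
have := infuse_lrs_word hs1 lU lC; rewrite eU => /andP[_].
have -> : reshape [:: a; b] (c1 ++ c2) = [:: c1; c2].
  by rewrite /= take_size_cat // drop_size_cat // take_size.
by rewrite /lrs /= !andbT => /andP[].
Qed.

Lemma pass_lrs_conv s h bs : strict_partition s -> legal s (h :: flatten bs) ->
  lrs (pass_blocks h bs) -> lrs bs.
Proof.
elim: bs s h => // b bs IH s h hs hl /andP[/= /andP[hb hbs] pb].
have l1 : legal s (h :: b) by move: hl; rewrite [flatten _]/= -cat_cons legal_cat => /andP[].
have hk := pass_hook_conv hs l1 hb.
have [s' hs' l'] := pass_legal_cat hs hl.
have {}IH : lrs bs.
  by apply: IH hs' l' _; rewrite /lrs hbs (path_sorted pb).
rewrite /lrs /= hk /=; case/andP: (IH) => -> /=.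
case: bs hbs pb hl l' IH => [//|b' bs] /andP[hb' _] /andP[bb' _] hl l' IH /= ->.
rewrite andbT; apply: pass_ballot_conv hs _ hk _ bb'; last by case/andP: IH => /andP[].
by move: hl; rewrite [flatten _]/= catA -cat_cons legal_cat => /andP[].
Qed.

Lemma uninfuse_lrs_word s c v kap : strict_partition s -> legal s (c ++ v) ->
  lrs_word kap c -> lrs_word kap (uninfuse c v).2.
Proof.
move=> hs hl; have := uninfuseK c v; have [lu _] := uninfuse_legal hs hl.
move: (uninfuse c v) lu => -[u c'] /=; elim: u s hs c v {hl} => [|h u IH] s hs c v /=.
  by move=> _ [-> _].
case/andP => ah l [ec ev] hc; have hs' := strict_add_box hs ah.
have [l1 _] := infuse_legal hs' l.
apply: (IH _ hs' (infuse u c').1 (infuse u c').2 l); first by case: (infuse u c').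
have {}l1 : legal s (h :: (infuse u c').1) by move: l1; rewrite /= ah legal_cat => /andP[].
case/andP: hc; rewrite -ec size_pass => sc hc; rewrite /lrs_word sc /=.
have rc : flatten (reshape kap (infuse u c').1) = (infuse u c').1.
  by rewrite reshapeKr // (eqP sc).
have sh : shape (reshape kap (infuse u c').1) = kap by rewrite reshapeKl // (eqP sc).
set R := reshape kap _ in rc sh *; apply: (@pass_lrs_conv s h) => //; first by rewrite rc.
have := flattenK (pass_blocks h R); rewrite shape_pass_blocks sh => <-.
by rewrite -pass_flatten rc.
Qed.

(** * Counting words *)

Lemma included_cnt s t : strict_partition s -> strict_partition t ->
  included s t <-> forall z, cnt s z <= cnt t z.
Proof.
move=> hs ht; split => [/allP h z|h].
  rewrite leqNgt; apply/negP => lt; have := lt; rewrite cnt_nth // => hz.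
  have : cnt t z \in iota 0 (size s).
    by rewrite mem_iota add0n /= ltnNge; apply/negP => /(nth_default 0) e; rewrite e in hz.
  by move/h => le; have := leq_trans hz le; rewrite -cnt_nth // ltnn.
apply/allP => i _; case e: (nth 0 s i) => [//|z].
by rewrite -cnt_nth //; apply: leq_trans (h z); rewrite cnt_nth // e.
Qed.

Lemma cnt_rho n z : cnt (rho n) z = n - z.
Proof.
rewrite /cnt /rho count_rev; elim: n => [|n IH]; first by rewrite sub0n.
by rewrite -[n.+1]addn1 iotaD count_cat IH /= add1n; lia.
Qed.

Lemma strict_rho n : strict_partition (rho n).
Proof. by rewrite /strict_partition rho_sorted mem_rho. Qed.

Lemma spart_strict n (s : spart n) : strict_partition s.
Proof. by have /andP[] := partsP s. Qed.

Lemma spart_bounded n (s : spart n) : bounded n s.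
Proof. by apply/allP => x /spart_mem_rho; rewrite mem_rho => /andP[]. Qed.

Lemma to_spart n s : strict_partition s -> bounded n s -> exists m : spart n, parts m = s.
Proof.
move=> hs hb; have h : strict_partition s && included s (rho n).
  rewrite hs /=; apply/(included_cnt hs (strict_rho n)) => z; rewrite cnt_rho.
  move: hb; rewrite bounded_cnt => /eqP h; case: (leqP z n) => zn.
    by have := cnt_drop hs zn; rewrite h.
  by rewrite (eqP (_ : n - z == 0)) ?subn_eq0 ?(ltnW zn) // -h; apply: cnt_mono; apply: ltnW.
by exists (SPart h).
Qed.

Lemma parts_inj n : injective (@parts n).
Proof. exact: val_inj. Qed.

Definition num_words (n : nat) (P : pred (seq nat)) (k : nat) (s t : seq nat) : nat :=
  count (fun w => [&& P w, legal s w & run s w == t]) (words n k).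

Lemma count_sum (T : Type) (P : pred T) s : count P s = \sum_(x <- s) P x.
Proof. by rewrite -sum1_count big_mkcond; apply: eq_bigr => x _; case: (P x). Qed.

(** Composing two families of paths through an intermediate partition. *)
Lemma num_words_comp n P Q k l (s t : spart n) :
  \sum_(m : spart n) num_words n P k s m * num_words n Q l m t =
  count (fun uc => [&& P uc.1, Q uc.2, legal s (uc.1 ++ uc.2) & run s (uc.1 ++ uc.2) == t])
    [seq (u, c) | u <- words n k, c <- words n l].
Proof.
rewrite (eq_bigr (fun m : spart n => \sum_(u <- words n k) \sum_(c <- words n l)
    [&& P u, legal s u & run s u == m] * [&& Q c, legal m c & run m c == t]));
  last by move=> m _; rewrite /num_words !count_sum big_distrlr.
rewrite count_sum big_allpairs exchange_big; apply: eq_bigr => u _; rewrite exchange_big; apply: eq_bigr => c _.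
rewrite /= legal_cat run_cat; case Pu: (P u) => /=; last by rewrite big1.
case lu: (legal s u) => /=; last by rewrite andbF big1.
case: (boolP [&& Q c, legal (run s u) c & run (run s u) c == t]) => [h|nh].
  have [hQ lc /eqP rc] := and3P h; have hu := strict_run (spart_strict s) lu.
  have [|hb _] := @bounded_run n _ _ hu lc; first by rewrite rc spart_bounded.
  have [m0 em0] := to_spart hu hb.
  rewrite (bigD1 m0) //= em0 eqxx hQ lc rc eqxx /= big1 ?addn0 // => m nm.
  by rewrite -em0 (inj_eq (@parts_inj n)) eq_sym (negbTE nm).
rewrite big1 // => m _; case: eqP => [<-|_]; last by rewrite mul0n.
by rewrite (negbTE nh).
Qed.

Lemma mem_pairs n s t u c : strict_partition s -> bounded n t -> legal s (u ++ c) ->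
  run s (u ++ c) = t -> (u, c) \in [seq (u, c) | u <- words n (size u), c <- words n (size c)].
Proof.
move=> hs hb l r; rewrite -r in hb; have [_] := bounded_run hs l hb.
rewrite all_cat => /andP[hu hc]; apply/allpairsP; exists (u, c).
by rewrite !mem_words !eqxx hu hc.
Qed.

Lemma lrs_word_size kap c : lrs_word kap c -> size c = sumn kap.
Proof. by case/andP => /eqP. Qed.

(** [infuse] and [uninfuse] exchange a strip added before an LRS filling with a strip
   added after it. *)
Theorem num_words_comm n p kap (s t : spart n) :
  \sum_(m : spart n) num_words n hook p s m * num_words n (lrs_word kap) (sumn kap) m t =
  \sum_(m : spart n) num_words n (lrs_word kap) (sumn kap) s m * num_words n hook p m t.
Proof.
have hs := spart_strict s; have hb := spart_bounded t.
rewrite !num_words_comp -!size_filter; set T1 := filter _ _; set T2 := filter _ _.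
have uT1 : uniq T1.
  by apply: filter_uniq; apply: allpairs_uniq; rewrite ?words_uniq // => -[? ?] [? ?].
have uT2 : uniq T2.
  by apply: filter_uniq; apply: allpairs_uniq; rewrite ?words_uniq // => -[? ?] [? ?].
apply/eqP; rewrite eqn_leq; apply/andP; split.
  rewrite -(size_map (fun t => infuse t.1 t.2)); apply: uniq_leq_size.
    rewrite map_inj_in_uniq // => -[u c] [u' c'] _ _ /= e.
    by rewrite -(infuseK u c) -(infuseK u' c') e.
  move=> x /mapP[[u c]]; rewrite !mem_filter => /andP[/= /and4P[hu hc l /eqP r] hin] ->.
  have [l' r'] := infuse_legal hs l; have [s1 s2] := size_infuse u c.
  have := mem_pairs hs hb l' (etrans r' r); rewrite s1 s2 (lrs_word_size hc).
  case/allpairsP: hin => -[u0 c0] /= [hu0 _ [e _]].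
  move: hu0; rewrite -e mem_words => /andP[/eqP-> _].
  rewrite -surjective_pairing => ->; rewrite andbT l' r' r eqxx.
  by rewrite (infuse_lrs_word hs l hc) (infuse_hook hs l hu).
rewrite -(size_map (fun t => uninfuse t.1 t.2)); apply: uniq_leq_size.
  rewrite map_inj_in_uniq // => -[u c] [u' c'] _ _ e.
  have {}e : uninfuse u c = uninfuse u' c' := e.
  by have := uninfuseK u c; rewrite e uninfuseK.
move=> x /mapP[[c v]]; rewrite !mem_filter => /andP[/and4P[hc hv l /eqP r] hin] ->.
have [l' r'] := uninfuse_legal hs l; have [s1 s2] := size_uninfuse c v.
have := mem_pairs hs hb l' (etrans r' r); rewrite s1 s2 (lrs_word_size hc).
case/allpairsP: hin => -[c0 v0] [_ hv0 [_ e]].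
move: hv0; rewrite -[_.2]e mem_words => /andP[/eqP-> _].
rewrite -surjective_pairing => ->; rewrite andbT l' r' r eqxx.
by rewrite (uninfuse_lrs_word hs l hc) (uninfuse_hook hs l hv).
Qed.

(** The superstandard word is the only one by [straight_blocks]. *)
Lemma num_words_straight n kap (t : seq nat) : strict_partition kap -> bounded n kap ->
  num_words n (lrs_word kap) (sumn kap) [::] t = (t == kap).
Proof.
move=> hk hb; have [l r hl] := straight_word hk; set c0 := flatten _ in l r.
have s0 : shape (map (iota 0) kap) = kap.
  by rewrite /shape -map_comp -[RHS]map_id; apply: eq_map => m; rewrite /= size_iota.
have h0 : lrs_word kap c0 by rewrite /c0 -{1}s0 lrs_word_flatten.
have c0w : c0 \in words n (sumn kap).
  by rewrite -(lrs_word_size h0); apply: (@mem_words_run n [::]); rewrite ?r.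
rewrite /num_words -[RHS](_ : count (fun c => (c == c0) && (t == kap)) (words n (sumn kap)) = _).
  apply: eq_count => c; apply/and3P/andP => [[hc lc /eqP rc]|[/eqP-> /eqP->]]; last first.
    by rewrite h0 l r.
  have [bs [ec sb hbs]] := lrs_wordP hc; rewrite ec in lc rc *.
  have [|e1 e2] := straight_blocks lc hbs.
    apply/negP => /(map_f size); rewrite -/(shape bs) sb; case/andP: hk => _ /negbTE-> //.
  rewrite -rc e2 -/(shape bs) sb; split => //.
  by rewrite /c0 e1 -/(shape bs) sb.
case: (t == kap); last by rewrite (eq_count (a2 := pred0)) ?count_pred0 // => c; rewrite andbF.
rewrite (eq_count (a2 := pred1 c0)); last by move=> c; rewrite andbT.
by rewrite count_uniq_mem ?words_uniq // c0w.
Qed.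

(** * Horizontal strips *)

Lemma mem_young s i j : strict_partition s -> ((i, j) \in young s) = (i < cnt s j).
Proof.
move=> hs; rewrite cnt_nth //; apply/allpairsPdep/idP => [[i' [j' [_ h [-> ->]]]]|h].
  by move: h; rewrite mem_rev mem_iota.
exists i, j; rewrite mem_rev !mem_iota /= h; split => //.
by rewrite ltnNge; apply/negP => /(nth_default 0) e; rewrite e in h.
Qed.

Lemma uniq_young s : uniq (young s).
Proof.
apply: allpairs_uniq_dep; first exact: iota_uniq.
  by move=> i _; rewrite rev_uniq iota_uniq.
by move=> [i j] [i' j'] _ _ [-> ->].
Qed.

Lemma mem_skew_young s t i j : strict_partition s -> strict_partition t ->
  ((i, j) \in skew_young t s) = (cnt s j <= i < cnt t j).
Proof. by move=> hs ht; rewrite mem_filter !mem_young // -leqNgt. Qed.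

(** Both the columns of the Young diagram and the diagonals of the shifted diagram
   are counted by [cnt]. *)
Lemma horizontal_stripP s t p : strict_partition s -> strict_partition t ->
  reflect ([/\ forall z, cnt s z <= cnt t z <= (cnt s z).+1 & sumn t = sumn s + p])
    (horizontal_strip t s p).
Proof.
move=> hs ht; apply: (iffP and3P) => [[hi /eqP hp hu]|[h hp]].
  split=> // z; rewrite (proj1 (included_cnt hs ht) hi) /= leqNgt; apply/negP => lt.
  have h1 : (cnt s z, z) \in skew_young t s by rewrite mem_skew_young // leqnn; lia.
  have h2 : ((cnt s z).+1, z) \in skew_young t s by rewrite mem_skew_young // leqnSn.
  case/splitPr: h1 hu h2 => d1 d2; rewrite map_cat cat_uniq /= negb_or.
  case/and3P => _ /andP[n1 _] /andP[n2 _]; rewrite mem_cat inE xpair_eqE.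
  case/or3P => [h2|/andP[/eqP e _]|h2]; [|by lia|].
    by case/negP: n1; apply/mapP; exists ((cnt s z).+1, z).
  by case/negP: n2; apply/mapP; exists ((cnt s z).+1, z).
split; [|by apply/eqP|].
  by apply/(included_cnt hs ht) => z; case/andP: (h z).
rewrite map_inj_in_uniq; first by apply: filter_uniq; exact: uniq_young.
move=> [i j] [i' j']; rewrite !mem_skew_young //= => h1 h2 e; rewrite e in h1 *.
by congr (_, _); have := h j'; lia.
Qed.

Lemma uniq_split (T : eqType) (x : T) u1 u2 v1 v2 : uniq (u1 ++ x :: u2) ->
  u1 ++ x :: u2 = v1 ++ x :: v2 -> u1 = v1.
Proof.
move=> u e; have : x \notin u1.
  by move: u; rewrite cat_uniq /= negb_or => /and3P[_ /andP[]].
have : x \notin v1.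
  by move: u; rewrite e cat_uniq /= negb_or => /and3P[_ /andP[]].
elim: u1 v1 {u} e => [|a u1 IH] [|b v1] //=.
- by move=> [-> _]; rewrite mem_head.
- by move=> [-> _]; rewrite mem_head.
by case=> -> e; rewrite !inE !negb_or => /andP[_ h1] /andP[_ h2]; rewrite (IH v1).
Qed.

(** In a strip, legality only concerns the order of neighbouring contents: left before
   right in a row, upper before lower in a column. *)
Lemma strip_legal s t u : strict_partition s -> strict_partition t ->
  (forall z, cnt t z = cnt s z + (z \in u)) -> uniq u ->
  (forall u1 x u2, u = u1 ++ x :: u2 ->
     (0 < x -> x \notin s -> x.-1 \in u -> x.-1 \in u1) /\
     (x.+1 \in u -> x.+1 \in s -> x.+1 \in u1)) ->
  legal s u /\ run s u = t.
Proof.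
elim: u s => [|x u IH] s hs ht ct /=.
  by move=> _ _; split => //; apply: strict_cnt_eq => // z; rewrite ct addn0.
case/andP => xu uu hord; have [o1 o2] := hord [::] x u erefl.
have ctx : cnt t x = cnt s x + 1 by rewrite ct mem_head.
have ax : addable s x.
  apply/andP; split.
    case: (posnP x) => //= x0; apply/negPn/negP => xs.
    have := cnt_mono t (leq_pred x); have := cnt_mono s (leq_pred x).
    have := xs; rewrite strict_mem // -leqNgt => h1 h2 h3.
    suff : x.-1 \in x :: u by move/(o1 x0 xs).
    by have := ct x.-1; case: (_ \in _) => //; move: ctx h1 h2 h3; clear; clia.
  apply/negP => xs; suff : x.+1 \in x :: u by move/o2 => /(_ xs).
  have := cntS x hs; have := cntS x ht; rewrite xs => h1 h2.
  by have := ct x.+1; case: (_ \in x :: u) => //; case: (_ \in t) h1; move: ctx h2; clear; clia.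
rewrite ax; apply: IH => //; first exact: strict_add_box.
  move=> z; rewrite cnt_add_box // ct inE; case: eqP => [->|_]; last by rewrite addn0.
  by rewrite (negbTE xu) addn0.
move=> u1 y u2 e; have [h1 h2] := hord (x :: u1) y u2 (congr1 (cons x) e).
have yu : y \in u by rewrite e mem_cat mem_head orbT.
have yx : y != x by apply: contraNneq xu => <-.
split=> [y0|]; rewrite mem_add_box //.
  rewrite negb_or negb_and => /andP[n1]; rewrite (negbTE yx) orbF => ys h.
  have := h1 y0 ys; rewrite !inE h orbT => /(_ isT) /orP[/eqP e1|//].
  by move: xu; rewrite -e1 h.
move=> h /orP[|/andP[ys _]]; first by rewrite eqSS (negbTE yx).
have := h2; rewrite !inE h ys orbT => /(_ isT isT) /orP[/eqP e1|//].
by move: xu; rewrite -e1 h.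
Qed.

Lemma hook_uniq s w : strict_partition s -> legal s w -> hook w -> uniq w.
Proof.
move=> hs l hw; rewrite -(cat_dpart w) cat_uniq uniq_dpart uniq_apart // andbT /=.
by apply/hasPn => y /(hook_disjoint hs l hw).
Qed.

(** Boxes on neighbouring diagonals share a row or a column, which decides the one to be
   added first, and thereby whether the outer one belongs to the decreasing run. *)
Lemma hook_forced s w x : strict_partition s -> legal s w -> hook w ->
  x.+1 \in w -> x \in w -> (x.+1 \in dpart w) = (x.+1 \in s).
Proof.
move=> hs l hw xw xw'; have u := hook_uniq hs l hw.
case: (boolP (x.+1 \in s)) => xs.
  case/splitPr: xw' l u hw xw => w1 w2; rewrite legal_cat => /andP[l1 /= /andP[/andP[_ n] _]].
  move=> u hw xw; have h : x.+1 \in w1.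
    apply/negPn/negP => h; move: n; rewrite strict_mem ?strict_run //= !cnt_run //.
    have := xs; rewrite strict_mem //= (count_memPn h) addn0 => lt /negP; apply.
    by apply: leq_trans lt (leq_addr _ _).
  have : x.+1 \in w1 ++ x :: w2 by rewrite mem_cat h.
  rewrite -{1}(cat_dpart (w1 ++ x :: w2)) mem_cat => /orP[//|ha].
  have [a1 [a2 [ea _ ha2]]] := split_inc hw ha.
  have e0 : w1 ++ x :: w2 = (dpart (w1 ++ x :: w2) ++ a1) ++ x.+1 :: a2.
    by rewrite -catA -ea cat_dpart.
  have xa : x \in a2 \/ x \in w1.
    case/splitPr: h u e0 => w11 w12 u; rewrite -catA /= => e0.
    have := uniq_split _ e0; rewrite -catA in u => /(_ u) e1; move: e0; rewrite -e1.
    by move/eqP; rewrite eqseq_cat // eqxx /= => /eqP[<-]; left; rewrite mem_cat mem_head orbT.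
  case: xa => [/ha2|xw1]; first by lia.
  by move: u; rewrite cat_uniq /= negb_or xw1 => /and3P[].
apply/negbTE/negP => hd; have [d1 [d2 [ed hd1 _]]] := split_dec (sorted_dpart w) hd.
move: l u; rewrite -(cat_dpart w) ed -catA legal_cat => /andP[l1 /= /andP[/andP[h _] _]] u.
have xd : x.+1 \notin d1 by apply/negP => /hd1; rewrite ltnn.
move: h; rewrite strict_mem ?strict_run //= !cnt_run // (count_memPn xd).
have := xs; rewrite strict_mem // -leqNgt /= addn0 => le lt.
have : 0 < count_mem x d1 by move: le lt; clear; clia.
by rewrite -has_count has_pred1 => /hd1; clear; lia.
Qed.

(** * The hook words of a strip *)

Section Strip.

Variables (n : nat) (s t : spart n).

(** The diagonals that meet the skew diagram. *)
Definition diag (z : nat) : bool := cnt s z < cnt t z.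

(** The lowest box of a component has content [z] with no box of content [z.-1]. *)
Definition diag_start (z : nat) : bool := diag z && ((z == 0) || ~~ diag z.-1).

Hypothesis strip : forall z, cnt s z <= cnt t z <= (cnt s z).+1.

Let hs : strict_partition s := spart_strict s.
Let ht : strict_partition t := spart_strict t.

Lemma diag_lt z : diag z -> z < n.
Proof.
rewrite /diag => h; rewrite ltnNge; apply/negP => /(cnt_mono t).
by have := spart_bounded t; rewrite bounded_cnt => /eqP->; move: h; clear; clia.
Qed.

Lemma cnt_diag z : cnt t z = cnt s z + diag z.
Proof. by have := strip z; rewrite /diag; lia. Qed.

Lemma mem_strip_word u z : legal s u -> hook u -> run s u = t -> (z \in u) = diag z.
Proof.
move=> l hk r; have := cnt_run z hs l; rewrite r cnt_diag.
by rewrite count_uniq_mem ?(hook_uniq hs l hk) //; case: (_ \in u) (diag z) => -[]; lia.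
Qed.

(** The marks of a strip are forced by its shape, except at the start of each
   component. *)
Definition marked_diag (E : {set 'I_n.+1}) (z : nat) : bool :=
  diag z && (if diag_start z then inord z \in E else z \in parts s).

Definition strip_word (E : {set 'I_n.+1}) : seq nat :=
  [seq z <- rev (iota 0 n) | marked_diag E z] ++
  [seq z <- iota 0 n | diag z && ~~ marked_diag E z].

Variable m : nat.
Hypotheses (diag_m : diag m) (min_m : forall z, diag z -> m <= z).

Lemma start_m : diag_start m.
Proof.
rewrite /diag_start diag_m; case: (posnP m) => [->|m0] //=.
by apply/negP => /min_m; lia.
Qed.

Definition free_starts : {set 'I_n.+1} := [set z : 'I_n.+1 | diag_start z & (z : nat) != m].

Lemma inordE z : diag z -> (inord z : 'I_n.+1) = z :> nat.
Proof. by move/diag_lt => h; rewrite inordK // ltnW. Qed.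

Lemma mem_strip_wordD (E : {set 'I_n.+1}) z : (z \in [seq z <- rev (iota 0 n) | marked_diag E z]) = marked_diag E z.
Proof.
rewrite mem_filter mem_rev mem_iota /= add0n; case h: (marked_diag E z) => //=.
by case/andP: h => dz _; rewrite (diag_lt dz).
Qed.

Lemma mem_strip_wordA (E : {set 'I_n.+1}) z :
  (z \in [seq z <- iota 0 n | diag z && ~~ marked_diag E z]) = diag z && ~~ marked_diag E z.
Proof.
rewrite mem_filter mem_iota /= add0n; case h: (diag z && ~~ marked_diag E z) => //=.
by case/andP: h => dz _; rewrite (diag_lt dz).
Qed.

Lemma strip_wordP (E : {set 'I_n.+1}) : E \subset free_starts ->
  [/\ hook (strip_word E), legal s (strip_word E), run s (strip_word E) = t
    & dpart (strip_word E) =i marked_diag E].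
Proof.
move=> /subsetP sE; set D := [seq z <- rev (iota 0 n) | marked_diag E z].
set A := [seq z <- iota 0 n | diag z && ~~ marked_diag E z].
have ew : strip_word E = D ++ A by [].
have mD z : (z \in D) = marked_diag E z := mem_strip_wordD E z.
have mA z : (z \in A) = diag z && ~~ marked_diag E z := mem_strip_wordA E z.
have sD : sorted gtn D.
  by apply: (sorted_filter gtn_trans); rewrite rev_sorted; exact: iota_ltn_sorted.
have sA : sorted ltn A by apply: (sorted_filter ltn_trans); exact: iota_ltn_sorted.
have mE : ~~ marked_diag E m.
  rewrite /marked_diag start_m diag_m /=; apply/negP => /sE.
  by rewrite inE inordE // eqxx andbF.
have mw z : (z \in strip_word E) = diag z.
  by rewrite mem_cat mD mA /marked_diag; case: (diag z) => //=; case: (if _ then _ else _).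
have [hk ed _] : [/\ hook (D ++ A), dpart (D ++ A) = D & apart (D ++ A) = A].
  have mAm : m \in A by rewrite mA diag_m mE.
  case eA: A mAm => [//|j a] mAm; rewrite eA in sA mA; apply: hook_cat => //.
  apply: rcons_sorted_gtn => // x; rewrite mD => hx.
  have dj : diag j by have := mA j; rewrite mem_head => /esym/andP[].
  have jm : j <= m.
    by move: mAm; rewrite inE => /predU1P[->//|/(ltn_path_lt sA)]; exact: ltnW.
  have ej : j = m by apply/eqP; rewrite eqn_leq jm min_m.
  rewrite ej ltn_neqAle min_m ?andbT; last by case/andP: hx.
  by apply: contraNneq mE => ->.
have uA : uniq A by apply: filter_uniq; exact: iota_uniq.
have uD : uniq D by apply: filter_uniq; rewrite rev_uniq iota_uniq.
have uw : uniq (D ++ A).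
  rewrite cat_uniq uA uD andbT /=; apply/hasPn => z.
  by rewrite mA /= mD => /andP[].
have [l r] : legal s (D ++ A) /\ run s (D ++ A) = t.
  apply: strip_legal => //.
    by move=> z; rewrite -ew mw cnt_diag.
  move=> u1 x u2 eu; have xw : diag x by rewrite -mw ew eu mem_cat mem_head orbT.
  have hA : x \in A -> exists a1 a2, [/\ A = a1 ++ x :: a2, u1 = D ++ a1 & {in a2, forall y, x < y}].
    move=> xA; have [a1 [a2 [eA _ h2]]] := split_inc sA xA; exists a1, a2; split => //.
    by apply: (@uniq_split _ x _ u2 _ a2); rewrite -eu // -catA -eA.
  rewrite -ew !mw; split => [x0 xs dx|dx xs].
    have nst : diag_start x = false by rewrite /diag_start dx xw; case: x x0 {eu xw xs dx hA}.
    have xA : x \in A by rewrite mA xw /marked_diag nst negb_and xs orbT.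
    have [a1 [a2 [eA -> h2]]] := hA xA; rewrite mem_cat mD.
    case: (boolP (marked_diag E x.-1)) => //= nd.
    have : x.-1 \in A by rewrite mA dx nd.
    rewrite eA mem_cat inE => /or3P[//|/eqP e|/h2]; last by rewrite ltnNge leq_pred.
    by move: x0; rewrite -e; case: x {eu xw xs dx hA nst xA eA h2 nd} e => // x /= ; lia.
  have nst : diag_start x.+1 = false by rewrite /diag_start dx xw.
  have xD : x.+1 \in D by rewrite mD /marked_diag dx nst xs.
  case: (boolP (x \in A)) => [/hA[a1 [a2 [_ -> _]]]|xA]; first by rewrite mem_cat xD.
  have : x \in D by move: xA; rewrite mA mD xw /= negbK.
  move/(split_dec sD) => [d1 [d2 [eD _ h2]]].
  have -> : u1 = d1 by apply: (@uniq_split _ x _ u2 _ (d2 ++ A)); rewrite -eu // eD -catA.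
  move: xD; rewrite eD mem_cat inE => /or3P[//|/eqP/esym/n_Sn//|/h2].
  by rewrite ltnNge leqnSn.
by split=> // z; rewrite ew ed mD.
Qed.

Lemma strip_word_onto u : legal s u -> hook u -> run s u = t ->
  exists2 E : {set 'I_n.+1}, E \subset free_starts & u = strip_word E.
Proof.
move=> l hk r; have mw z := mem_strip_word z l hk r.
have dj := hook_disjoint hs l hk.
pose E := [set z : 'I_n.+1 | diag_start z & (z : nat) \in dpart u].
have sd z : z \in dpart u -> diag z by rewrite -mw -{2}(cat_dpart u) mem_cat => ->.
have mD z : (z \in dpart u) = marked_diag E z.
  rewrite /marked_diag; case: (boolP (diag z)) => [dz|nz] /=; last first.
    by apply/negP => /sd; rewrite (negbTE nz).
  case: ifP => [st|nst]; first by rewrite /E in_set inordE // st.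
  case: z dz nst => [|z] dz; first by rewrite /diag_start dz.
  rewrite /diag_start dz /= => /negbFE dz'; apply: hook_forced hs l hk _ _; by rewrite mw.
have mA z : (z \in apart u) = diag z && ~~ marked_diag E z.
  rewrite -mD -mw -{2}(cat_dpart u) mem_cat; case: (boolP (z \in apart u)) => [/dj->|_].
    by rewrite orbT.
  by rewrite orbF; case: (_ \in _).
exists E.
  apply/subsetP => z; rewrite !inE => /andP[-> zd] /=; apply: contraTneq zd => ->.
  case eu: u mw => [|x w] mw; first by [].
  have /sorted_rcons_gtn[_ h] := dpart_sorted x w; apply/negP => /h.
  have : head 0 (apart (x :: w)) \in dpart (x :: w) ++ apart (x :: w).
    rewrite mem_cat; apply/orP; right; case e: (apart (x :: w)) => [|a b].
      by have := dpart_nil e.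
    exact: mem_head.
  by rewrite cat_dpart mw => /min_m; rewrite ltnNge => ->.
rewrite -{1}(cat_dpart u); congr (_ ++ _).
  apply: (irr_sorted_eq gtn_trans); first by move=> x; apply: ltnn.
  - exact: sorted_dpart.
  - by apply: (sorted_filter gtn_trans); rewrite rev_sorted; exact: iota_ltn_sorted.
  by move=> z; rewrite mem_strip_wordD.
apply: (irr_sorted_eq ltn_trans); first by move=> x; apply: ltnn.
- exact: hk.
- by apply: (sorted_filter ltn_trans); exact: iota_ltn_sorted.
by move=> z; rewrite mem_strip_wordA.
Qed.

Lemma strip_word_inj : {in powerset free_starts &, injective strip_word}.
Proof.
move=> E E'; rewrite !inE => sE sE' e; apply/setP => z.
have [_ _ _ h] := strip_wordP sE; have [_ _ _ h'] := strip_wordP sE'.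
case: (boolP (z \in free_starts)) => [hz|nz]; last first.
  by rewrite (contraNF (subsetP sE z) nz) (contraNF (subsetP sE' z) nz).
have := h z; rewrite e h' !unfold_in /marked_diag; move: hz; rewrite inE => /andP[hz _].
by have [-> _] := andP hz; rewrite hz inord_val.
Qed.

Lemma num_hook_words p : sumn t = sumn s + p ->
  num_words n hook p s t = 2 ^ #|free_starts|.
Proof.
move=> hp; rewrite -card_powerset /num_words -size_filter cardE.
rewrite -(size_map strip_word); apply: perm_size; apply: uniq_perm.
- by apply: filter_uniq; exact: words_uniq.
- rewrite map_inj_in_uniq ?enum_uniq // => E E'; rewrite !mem_enum.
  exact: strip_word_inj.
move=> u; rewrite mem_filter; apply/andP/mapP => [[/and3P[hk l /eqP r] _]|[E]].
  have [E sE ->] := strip_word_onto l hk r; exists E => //.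
  by rewrite mem_enum inE.
rewrite mem_enum inE => /strip_wordP[hk l r _] ->; rewrite hk l r eqxx; split => //.
have := sumn_run hs l; rewrite r hp => /addnI->.
by apply: mem_words_run hs l _; rewrite r spart_bounded.
Qed.

End Strip.

(** * Components and the Pieri rule *)

Lemma n_comp_transversal (T : finType) (e : rel T) (R : pred T) : connect_sym e ->
  (forall x, exists2 y, R y & connect e x y) ->
  (forall y y', R y -> R y' -> connect e y y' -> y = y') ->
  n_comp e predT = #|R|.
Proof.
move=> se ex un; rewrite -(@card_in_image _ _ (fingraph.root e) R); last first.
  move=> y y' hy hy' /eqP; rewrite root_connect //; exact: un.
apply: eq_card => x; rewrite !inE andbT; apply/idP/imageP => [/eqP rx|[y _ ->]].
  have [y hy xy] := ex x; exists y => //; rewrite -{1}rx; apply/eqP.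
  by rewrite root_connect.
exact: roots_root.
Qed.

Lemma mem_shifted s r c : strict_partition s ->
  ((r, c) \in shifted s) = (r <= c) && (r < cnt s (c - r)).
Proof.
move=> hs; apply/mapP/andP => [[[i j]]|[rc h]].
  by rewrite mem_young //= => h [-> ->]; rewrite leq_addr addKn.
by exists (r, c - r); rewrite ?mem_young //= subnKC.
Qed.

Lemma mem_skew_shifted s t r c : strict_partition s -> strict_partition t ->
  ((r, c) \in skew_shifted t s) = (r <= c) && (cnt s (c - r) <= r < cnt t (c - r)).
Proof.
move=> hs ht; rewrite mem_filter !mem_shifted // negb_and -leqNgt.
by case: (leqP r c).
Qed.

Section Components.

Variables (n : nat) (s t : spart n).
Hypothesis strip : forall z, cnt s z <= cnt t z <= (cnt s z).+1.

Let hs : strict_partition s := spart_strict s.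
Let ht : strict_partition t := spart_strict t.
Let D := skew_shifted t s.
Let e := fun b c : seq_sub D => adjacent (val b) (val c).

Definition box_diag (b : nat * nat) : nat := b.2 - b.1.

Lemma strip_box b : b \in D ->
  [/\ diag s t (box_diag b), b.1 = cnt s (box_diag b) & b.2 = b.1 + box_diag b].
Proof.
case: b => r c; rewrite /D mem_skew_shifted // => /andP[rc h].
have := strip (c - r); rewrite /diag /box_diag /= subnKC //; split => //; lia.
Qed.

Lemma strip_box_ex z : diag s t z -> (cnt s z, cnt s z + z) \in D.
Proof. by move=> dz; rewrite /D mem_skew_shifted // leq_addr addKn leqnn. Qed.

Lemma strip_box_inj b c : b \in D -> c \in D -> box_diag b = box_diag c -> b = c.
Proof.
move=> /strip_box[_ h1 h2] /strip_box[_ h1' h2'] e0.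
have e1 : b.1 = c.1 by rewrite h1 h1' e0.
have e2 : b.2 = c.2 by rewrite h2 h2' e0 e1.
by rewrite [b]surjective_pairing e1 e2 -surjective_pairing.
Qed.

Lemma adjacent_diag b c : b \in D -> c \in D -> adjacent b c ->
  box_diag b = (box_diag c).+1 \/ box_diag c = (box_diag b).+1.
Proof.
case: b c => [r c] [r' c']; rewrite /D !mem_skew_shifted // /adjacent /box_diag /=.
by clear; lia.
Qed.

Lemma diag_adjacent z : diag s t z -> diag s t z.+1 ->
  adjacent (cnt s z, cnt s z + z) (cnt s z.+1, cnt s z.+1 + z.+1).
Proof.
move=> _ _; rewrite /adjacent /= (cntS z hs).
by case: (_ \in _); clear; clia.
Qed.

Lemma adjacent_sym b c : adjacent b c = adjacent c b.
Proof.
rewrite /adjacent ![(c.1 == _)]eq_sym ![(c.2 == _)]eq_sym.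
by congr (_ || _); rewrite orbC eq_sym ?[c.1 == _]eq_sym; congr (_ && _).
Qed.

(** The content of the lowest box of the component of a box of content [z]. *)
Fixpoint low (z : nat) : nat :=
  if z is z'.+1 then if diag s t z' then low z' else z else 0.

Lemma low_connect b c : connect e b c -> low (box_diag (val b)) = low (box_diag (val c)).
Proof.
have step x y : e x y -> low (box_diag (val x)) = low (box_diag (val y)).
  have [dx _ _] := strip_box (valP x); have [dy _ _] := strip_box (valP y).
  move=> exy; case: (adjacent_diag (valP x) (valP y) exy) => h; rewrite h /= -?h.
    by rewrite dy.
  by rewrite dx.
case/connectP => p hp ->; elim: p b hp => //= x p IH b /andP[bx px].
by rewrite -(IH x px); exact: step bx.
Qed.

(** Every component has exactly one lowest box. *)
Lemma num_strip_components :
  num_components D = #|[set z : 'I_n.+1 | diag_start s t z]|.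
Proof.
pose R := [pred b : seq_sub D | diag_start s t (box_diag (val b))].
have se : connect_sym e.
  by apply: sym_connect_sym => x y; exact: adjacent_sym.
rewrite /num_components -/e (@n_comp_transversal _ e R) //; first last.
- move=> y y' /andP[dy hy] /andP[dy' hy'] /low_connect; move: hy hy'.
  have lowE z : (z == 0) || ~~ diag s t z.-1 -> low z = z.
    by case: z => //= z /negbTE->.
  move=> /lowE -> /lowE -> ey; apply: val_inj.
  exact: strip_box_inj (valP y) (valP y') ey.
- move=> x; have [dx _ _] := strip_box (valP x).
  elim: {x}(box_diag (val x)) {-2}x (erefl (box_diag (val x))) dx => [|z IH] x ex dx; rewrite ex in dx.
    by exists x => //; rewrite /R /= /diag_start ex dx.
  case: (boolP (diag s t z)) => dz; last first.
    by exists x => //; rewrite /R /= /diag_start ex dx dz.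
  have ez : box_diag (cnt s z, cnt s z + z) = z by rewrite /box_diag addKn.
  have [|y hy xy] := IH (SeqSub (strip_box_ex dz)) ez; first by rewrite /= ez.
  exists y => //; apply: connect_trans xy; apply: connect1.
  rewrite /e adjacent_sym /=; have [_ h1 h2] := strip_box (valP x).
  have -> : val x = (cnt s z.+1, cnt s z.+1 + z.+1).
    by rewrite [val x]surjective_pairing h2 h1 ex.
  exact: diag_adjacent.
pose f (b : seq_sub D) : 'I_n.+1 := inord (box_diag (val b)).
have fE b : f b = box_diag (val b) :> nat.
  by have [db _ _] := strip_box (valP b); rewrite /f (inordE db).
rewrite -(card_in_image (f := f)); last first.
  move=> x y _ _ /(congr1 val); rewrite /= !fE => h; apply: val_inj.
  exact: strip_box_inj (valP x) (valP y) h.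
apply: eq_card => z; rewrite inE; apply/imageP/idP => [[b hb ->]|hz].
  by rewrite fE.
have [dz _] := andP hz; exists (SeqSub (strip_box_ex dz)).
  by rewrite /R inE /= /box_diag /= addKn.
by apply: val_inj; rewrite /= fE /box_diag /= addKn.
Qed.

End Components.

(** The exponent of the Pieri rule counts the choices of marks. *)
Lemma pieri_hook_words n p (s t : spart n) : 0 < p ->
  num_words n hook p s t = if horizontal_strip t s p then 2 ^ pieri_exp t s else 0.
Proof.
move=> p0; have hs := spart_strict s; have ht := spart_strict t.
case: (horizontal_stripP p hs ht) => [[st hp]|nst].
  have [m dm hm] : exists2 m, diag s t m & forall z, diag s t z -> m <= z.
    have ex : exists m, diag s t m.
      case: (boolP (has (fun z => diag s t z) (iota 0 n))) => [/hasP[m _ hm]|/hasPn no]; first by exists m.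
      exfalso; have : parts s = parts t.
        apply: strict_cnt_eq => // z; rewrite (cnt_diag st); case: (boolP (diag s t z)) => dz.
          by have := no z; rewrite mem_iota (diag_lt dz) dz => /(_ isT).
        by rewrite addn0.
      by move=> e; move: hp; rewrite e; lia.
    by case: (ex_minnP ex) => m h1 h2; exists m.
  rewrite (@num_hook_words n s t st m dm hm p hp) /pieri_exp num_strip_components //.
  congr (2 ^ _); rewrite (cardD1 (inord m)) inE (inordE dm) (start_m dm hm) add1n /=.
  apply: eq_card => z; rewrite !inE andbC; congr (_ && _).
  by rewrite -val_eqE /= (inordE dm).
rewrite /num_words; apply/eqP; rewrite -leqn0 leqNgt -has_count; apply/hasP => -[u hu].
case/and3P => hk l /eqP r; case: nst; split; last first.
  have := sumn_run hs l; rewrite r => ->; move: hu; rewrite mem_words => /andP[/eqP-> _] //.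
move=> z; have := cnt_run z hs l; rewrite r => ->; rewrite leq_addr /=.
by rewrite -addn1 leq_add2l count_uniq_mem ?leq_b1 // (hook_uniq hs l hk).
Qed.

(** * Products of Schubert classes *)

Fact dual_spartP n (s : spart n) :
  strict_partition (dual_part n s) && included (dual_part n s) (rho n).
Proof.
by have [m <-] := to_spart (strict_dual n s) (bounded_dual n s); exact: partsP m.
Qed.

Definition dual_spart n (s : spart n) : spart n := SPart (dual_spartP s).

Lemma dual_spartK n : involutive (@dual_spart n).
Proof.
by move=> s; apply: val_inj; rewrite /= dualK ?spart_bounded ?spart_strict.
Qed.

Lemma num_hook_words_dual n p (s t : spart n) :
  num_words n hook p (dual_spart t) (dual_spart s) = num_words n hook p s t.
Proof.
have le (u v : spart n) :
    num_words n hook p u v <= num_words n hook p (dual_spart v) (dual_spart u).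
  rewrite /num_words -!size_filter -(size_map rev); apply: uniq_leq_size.
    by rewrite map_inj_uniq ?filter_uniq ?words_uniq //; exact: inv_inj revK.
  move=> w /mapP[x]; rewrite mem_filter => /andP[/and3P[hk l /eqP r] hx] ->.
  have [] := @legal_dual n u x (spart_strict u) l; first by rewrite r spart_bounded.
  rewrite r mem_filter hook_rev // => -> ->; rewrite eqxx /=.
  by move: hx; rewrite !mem_words size_rev all_rev.
by apply/eqP; rewrite eqn_leq le -{2}(dual_spartK t) -{2}(dual_spartK s) le.
Qed.

(** The sum of the row numbers of the boxes. *)
Definition wt (n : nat) (s : seq nat) : nat := \sum_(z < n) 'C((cnt s z).+1, 2).

Lemma wt_run n s w : strict_partition s -> legal s w -> bounded n (run s w) -> uniq w ->
  wt n (run s w) = wt n s + \sum_(x <- w) (cnt s x).+1.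
Proof.
elim: w s => [|x w IH] s hs /=; first by rewrite big_nil addn0.
case/andP => ax lw hb /andP[xw uw]; have hs' := strict_add_box hs ax.
have [hb' _] := bounded_run hs' lw hb.
have xn : x < n by move/allP: hb'; apply; rewrite mem_add_box // eqxx.
rewrite IH // big_cons addnA; congr (_ + _).
  rewrite /wt [LHS](bigD1 (Ordinal xn)) // [X in _ = X + _](bigD1 (Ordinal xn)) //= cnt_add_box // eqxx addn1 [in LHS]binS bin1.
  rewrite addnAC; congr (_ + _ + _); apply: eq_bigr => z nz.
  by rewrite cnt_add_box //; move: nz; rewrite -val_eqE /= eq_sym => /negbTE->; rewrite addn0.
apply: eq_big_seq => y yw; rewrite cnt_add_box //; case: eqP => [e|_]; last by rewrite addn0.
by rewrite -e yw in xw.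
Qed.

Lemma cnt_size s x : cnt s x <= size s.
Proof. exact: count_size. Qed.

(** A word of the strip has at most one box on each diagonal.  If its boxes are all in
   a new row, it is [iota 0 p]; otherwise some box is higher, and no box is lower than
   the new row. *)
Lemma new_part_heaviest n s p w : strict_partition s -> 0 < p -> {in s, forall x, p < x} ->
  hook w -> legal s w -> size w = p -> bounded n (run s w) -> bounded n (rcons s p) ->
  run s w = rcons s p \/ wt n (run s w) < wt n (rcons s p).
Proof.
move=> hs p0 hp hk l sw hb hb'; have [li ri] := iota_row hs hp.
have {}ri : run s (iota 0 p) = rcons s p by rewrite ri; case: p p0 {hp sw hb' li ri}.
have uw := hook_uniq hs l hk.
have full x : x < p -> cnt s x = size s.
  by move=> xp; apply/eqP; rewrite -all_count; apply/allP => y /hp; apply: ltn_trans.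
case: (boolP (all (fun x => cnt s x == size s) w)) => [/allP hall|].
  left; have [|ew _] := new_row hs l hk; last by rewrite ew sw ri.
  by move=> x y /hall; rewrite -all_count => /allP h /h.
rewrite -has_predC => /hasP[x xw /= hx]; right.
rewrite -ri !wt_run ?ri ?iota_uniq // ltn_add2l.
rewrite [X in _ < X](_ : _ = \sum_(y <- w) (size s).+1); last first.
  rewrite big_const_seq count_predT sw iter_addn_0.
  rewrite (eq_big_seq (fun=> (size s).+1)).
    by rewrite big_const_seq count_predT size_iota iter_addn_0.
  by move=> y; rewrite mem_iota /= => /full ->.
rewrite !(bigD1_seq x) //= -addSn; apply: leq_add; last first.
  by apply: leq_sum => y _; rewrite ltnS cnt_size.
by rewrite ltnS ltn_neqAle hx cnt_size.
Qed.

Lemma new_part_word s p w : strict_partition s -> {in s, forall x, p < x} ->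
  hook w -> legal s w -> run s w = rcons s p -> w = iota 0 p.
Proof.
move=> hs hp hk l r; have wp x : x \in w -> x < p.
  move=> xw; have := cnt_run x hs l; rewrite r /cnt -cats1 count_cat /= addn0 => /addnI e.
  by have : 0 < count_mem x w; [rewrite -has_count has_pred1 | rewrite -e; case: (x < p)].
have [|e _] := new_row hs l hk; first by move=> x y /wp xp /hp; apply: ltn_trans.
have := sumn_run hs l; rewrite r -cats1 sumn_cat /= addn0 => /addnI ep.
by rewrite e -ep.
Qed.

(** The words of the tableaux counted by [f_LRS]; see [f_LRS_lr]. *)
Definition lr (n : nat) (lam mu nu : spart n) : nat :=
  num_words n (lrs_word (dual_part n nu)) (sumn (dual_part n nu)) mu (dual_part n lam).

(** A strip that ends in the complement of [lam] is the reverse of one that starts from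
   [lam], so [num_words_comm] turns a strip added to [mu] into one added to [lam]. *)
Lemma lr_comm n p (lam mu nu : spart n) :
  \sum_(m : spart n) num_words n hook p mu m * lr lam m nu =
  \sum_(l : spart n) num_words n hook p lam l * lr l mu nu.
Proof.
have := num_words_comm p (dual_part n nu) mu (dual_spart lam); rewrite /lr /= => ->.
rewrite (reindex_inj (inv_inj (@dual_spartK n))) /=; apply: eq_bigr => l _.
by rewrite num_hook_words_dual mulnC.
Qed.

Lemma lr_empty n (lam nu : spart n) : lr lam (empty_spart n) nu = (nu == lam).
Proof.
rewrite /lr num_words_straight ?strict_dual ?bounded_dual //.
rewrite -[dual_part n lam]/(parts (dual_spart lam)) -[dual_part n nu]/(parts (dual_spart nu)).
by rewrite (inj_eq (@parts_inj n)) (inj_eq (inv_inj (@dual_spartK n))) eq_sym.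
Qed.

Section SchubertRing.

Import GRing.Theory.
Local Open Scope ring_scope.

Lemma schubert_hook_words n (H : comNzRingType) (tau : spart n -> H) :
  schubert_classes tau -> forall p (p_n : (0 < p <= n)%N) lam,
  tau (row_spart p_n) * tau lam = \sum_(lam' : spart n) tau lam' *+ num_words n hook p lam lam'.
Proof.
move=> ht p p_n lam; rewrite (schubert_pieri ht) big_mkcond; apply: eq_bigr => l _.
by rewrite pieri_hook_words; [case: ifP | case/andP: p_n].
Qed.

(** The smallest part [p] of [mu] is split off; all other terms of the product of the
   remaining parts with [p] are lighter than [mu]. *)
Theorem schubert_product n (H : comNzRingType) (tau : spart n -> H) :
  schubert_classes tau -> forall lam mu,
  tau lam * tau mu = \sum_(nu : spart n) tau nu *+ lr lam mu nu.
Proof.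
move=> ht lam mu; elim: {mu}(wt n mu).+1 {-2}mu (ltnSn (wt n mu)) lam => // k IH mu hk lam.
have [e|/eqP mu0] := eqVneq (parts mu) [::].
  have -> : mu = empty_spart n by exact: val_inj.
  rewrite (schubert_unit ht) mulr1 (bigD1 lam) //= lr_empty eqxx mulr1n.
  by rewrite big1 ?addr0 // => nu /negbTE ne; rewrite lr_empty ne.
have [s [p es]] : exists s p, parts mu = rcons s p.
  by case/lastP: (parts mu) mu0 => // s p _; exists s, p.
have [hs p0 hp] : [/\ strict_partition s, 0 < p & {in s, forall x, p < x}]%N.
  by apply: strict_rcons_inv; rewrite -es spart_strict.
have hbmu := spart_bounded mu; rewrite es in hbmu.
have [hb pn] : bounded n s /\ (p <= n)%N.
  by move: hbmu; rewrite /bounded all_rcons => /andP[].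
have [mu1 emu1] := to_spart hs hb; have p_n : (0 < p <= n)%N by rewrite p0.
have [li ri] := iota_row hs hp.
have {}ri : run s (iota 0 p) = rcons s p by rewrite ri; case: p p0 {hp li ri hbmu es pn p_n}.
have hone : num_words n hook p mu1 mu = 1%N.
  rewrite /num_words emu1 es (eq_in_count (a2 := pred1 (iota 0 p))).
    rewrite count_uniq_mem ?words_uniq //.
    by have := mem_words_run hs li; rewrite ri size_iota => ->.
  move=> w; rewrite mem_words => /andP[/eqP sw _] /=; apply/and3P/eqP => [[hkw l /eqP r]|->].
    exact: new_part_word hs hp hkw l r.
  by rewrite hook_iota li ri eqxx.
have wlt m : m != mu -> num_words n hook p mu1 m != 0%N -> (wt n m < k)%N.
  move=> nm; rewrite -lt0n -has_count => /hasP[w hw /and3P[hkw l /eqP r]].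
  move: hw; rewrite mem_words => /andP[/eqP sw _]; rewrite emu1 in l r.
  have hbm : bounded n (run s w) by rewrite r spart_bounded.
  have [e|lt] := new_part_heaviest hs p0 hp hkw l sw hbm hbmu.
    by case/eqP: nm; apply: parts_inj; rewrite -r e es.
  by rewrite r -es in lt; apply: leq_trans lt _; rewrite -ltnS.
have wlt1 : (wt n mu1 < k)%N.
  have hbi : bounded n (run s (iota 0 p)) by rewrite ri.
  have := wt_run hs li hbi (iota_uniq 0 p); rewrite ri -es emu1 => e.
  apply: leq_trans (_ : _ < wt n mu)%N _; last by rewrite -ltnS.
  rewrite e -[X in (X < _)%N]addn0 ltn_add2l; case: (p) p0 => // q _.
  by rewrite /= big_cons.
have e1 : tau mu = tau (row_spart p_n) * tau mu1 -
    \sum_(m : spart n | m != mu) tau m *+ num_words n hook p mu1 m.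
  by rewrite (schubert_hook_words ht) (bigD1 mu) //= hone mulr1n addrK.
rewrite e1 mulrBr mulrCA mulr_sumr.
have e2 : tau lam * tau mu1 = \sum_nu tau nu *+ lr lam mu1 nu := IH _ wlt1 lam.
have e3 : tau (row_spart p_n) * (tau lam * tau mu1) =
    \sum_nu tau nu *+ (\sum_(m : spart n) num_words n hook p mu1 m * lr lam m nu)%N.
  rewrite mulrA (schubert_hook_words ht) mulr_suml.
  under eq_bigr => l _ do rewrite mulrnAl (IH _ wlt1) -sumrMnl.
  rewrite exchange_big; apply: eq_bigr => nu _; rewrite lr_comm -sumrMnr.
  by apply: eq_bigr => l _; rewrite -mulrnA mulnC.
have e4 : \sum_(m : spart n | m != mu) tau lam * (tau m *+ num_words n hook p mu1 m) =
    \sum_nu tau nu *+ (\sum_(m : spart n | m != mu) num_words n hook p mu1 m * lr lam m nu)%N.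
  rewrite (eq_bigr (fun m : spart n => \sum_nu tau nu *+ (num_words n hook p mu1 m * lr lam m nu))).
    by rewrite exchange_big; apply: eq_bigr => nu _; rewrite sumrMnr.
  move=> m nm; have [->|nz] := eqVneq (num_words n hook p mu1 m) 0%N.
    by rewrite mulr0n mulr0 big1 // => nu _; rewrite mul0n mulr0n.
  rewrite mulrnAr (IH _ (wlt _ nm nz)) -sumrMnl; apply: eq_bigr => nu _.
  by rewrite -mulrnA mulnC.
rewrite e3 e4 -sumrB; apply: eq_bigr => nu _.
by rewrite (bigD1 mu) //= hone mul1n mulrnDr addrK.
Qed.

Theorem Zcoef_schubert n (H : comNzRingType) (tau : spart n -> H)
    (htau : schubert_classes tau) (lam mu nu : spart n) :
  Zcoef (schubert_basis htau) (tau lam * tau mu) nu = Posz (lr lam mu nu).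
Proof.
rewrite (schubert_product htau) -[RHS](ffunE (fun nu => Posz (lr lam mu nu))).
rewrite -(Zcoef_unique (schubert_basis htau)); congr (Zcoef _ _ _).
by apply: eq_bigr => m _; rewrite ffunE pmulrn.
Qed.

End SchubertRing.

(** * Boxes of a word *)

(** [b] is weakly north-west of [c]. *)
Definition nw (b c : nat * nat) : bool := (b.1 <= c.1) && (b.2 <= c.2).

Lemma shifted_ideal s b c : strict_partition s -> nw b c -> b.1 <= b.2 ->
  c \in shifted s -> b \in shifted s.
Proof.
case: b c => [r y] [r' y'] hs /andP[/= h1 h2] h3; rewrite !mem_shifted // h3 => /andP[h4 h5].
have := @cnt_mono s (y - r) (y' - r'); have := @cnt_drop s (y' - r') (y - r) hs.
by move: h1 h2 h3 h4 h5; clear; clia.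
Qed.

Lemma skew_convex s t b x c : strict_partition s -> strict_partition t ->
  b \in skew_shifted t s -> c \in skew_shifted t s -> nw b x -> nw x c -> x.1 <= x.2 ->
  x \in skew_shifted t s.
Proof.
move=> hs ht; rewrite !mem_filter => /andP[bs bt] /andP[_ ct] bx xc hx.
rewrite (shifted_ideal ht xc) // andbT; apply: contra bs => /(shifted_ideal hs bx); apply.
by case: b bt {bx} => r y; rewrite mem_shifted // => /andP[].
Qed.

(** The boxes added by a legal word. *)
Fixpoint boxes (s w : seq nat) : seq (nat * nat) :=
  if w is x :: w' then (cnt s x, cnt s x + x) :: boxes (add_box s x) w' else [::].

Lemma map_boxes s w : map box_diag (boxes s w) = w.
Proof. by elim: w s => //= x w IH s; rewrite IH /box_diag /= addKn. Qed.

Lemma mem_add_box_shifted s x b : strict_partition s -> addable s x ->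
  (b \in shifted (add_box s x)) = (b == (cnt s x, cnt s x + x)) || (b \in shifted s).
Proof.
case: b => r c hs ax; rewrite !mem_shifted ?strict_add_box // cnt_add_box // xpair_eqE.
case: (eqVneq (c - r) x) => [<-|ne]; last by move: ne; clear; clia.
by clear; clia.
Qed.

Lemma mem_boxes s w b : strict_partition s -> legal s w ->
  (b \in shifted (run s w)) = (b \in shifted s) || (b \in boxes s w).
Proof.
elim: w s => [|x w IH] s hs /=; first by rewrite orbF.
case/andP => ax l; rewrite IH ?strict_add_box // mem_add_box_shifted // inE.
by rewrite orbA [(b == _) || _]orbC.
Qed.

Lemma boxes_notin s w b : strict_partition s -> legal s w -> b \in boxes s w ->
  b \notin shifted s.
Proof.
elim: w s => [|x w IH] s hs //= /andP[ax l]; rewrite inE => /predU1P[->|].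
  by rewrite mem_shifted // addKn ltnn andbF.
by move/(IH _ (strict_add_box hs ax) l); rewrite mem_add_box_shifted // negb_or => /andP[].
Qed.

Lemma mem_boxes_skew s w : strict_partition s -> legal s w ->
  boxes s w =i skew_shifted (run s w) s.
Proof.
move=> hs l b; rewrite mem_filter mem_boxes //.
by case: (boolP (b \in boxes s w)) => [/(boxes_notin hs l)->|_]; rewrite ?orbT // orbF andNb.
Qed.

Lemma boxes_linear s w : strict_partition s -> legal s w ->
  pairwise (fun b c => ~~ nw c b) (boxes s w).
Proof.
elim: w s => [|x w IH] s hs //= /andP[ax l]; have hs' := strict_add_box hs ax.
rewrite IH // andbT; apply/allP => c hc.
have hx : (cnt s x, cnt s x + x) \in shifted (add_box s x) by rewrite mem_add_box_shifted ?eqxx.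
apply/negP => hn; case/negP: (boxes_notin hs' l hc); apply: (shifted_ideal hs' hn) hx.
move: hc; rewrite mem_boxes_skew // mem_filter; case: c {hn} => r y /andP[_].
by rewrite mem_shifted ?strict_run // => /andP[].
Qed.

(** If the next box were not addable, then its left or its upper neighbour would be in
   the rest of the list, to its north-west. *)
Lemma linear_extension s t bs : strict_partition s -> strict_partition t -> uniq bs ->
  bs =i skew_shifted t s -> (forall b, b \in shifted s -> b \in shifted t) ->
  pairwise (fun b c => ~~ nw c b) bs ->
  [/\ legal s (map box_diag bs), run s (map box_diag bs) = t & bs = boxes s (map box_diag bs)].
Proof.
elim: bs s => [|b bs IH] s hs ht ub mb st.
  split => //; apply: strict_cnt_eq => // z; apply/eqP; rewrite eqn_leq; apply/andP; split.
    rewrite leqNgt; apply/negP => h; have := st (cnt t z, cnt t z + z).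
    by rewrite !mem_shifted // leq_addr addKn h ltnn => /(_ isT).
  rewrite leqNgt; apply/negP => h; have := mb (cnt s z, cnt s z + z).
  by rewrite mem_skew_shifted // leq_addr addKn leqnn h.
rewrite [pairwise _ _]/= => /andP[/allP hb pb]; case/andP: ub => nb ub.
have no c : c \in skew_shifted t s -> c != b -> ~~ nw c b.
  by rewrite -mb inE => /predU1P[->|/hb //]; rewrite eqxx.
have ht' z := cntS z ht; have hs' z := cntS z hs.
case: b => r y in hb nb mb no *.
have : (r, y) \in skew_shifted t s by rewrite -mb mem_head.
rewrite mem_skew_shifted // => /and3P[ry h1 h2].
have [z ey] : exists z, y = r + z by exists (y - r); rewrite subnKC.
rewrite {y}ey in hb nb mb no ry h1 h2 *; rewrite [map _ _]/= /box_diag /= addKn in h1 h2 *.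
(* Otherwise the north-west neighbour on the same diagonal would come later. *)
have er : cnt s z = r.
  apply/eqP; rewrite eqn_leq h1 leqNgt; apply/negP => h.
  have := no (r.-1, (r + z).-1); rewrite mem_skew_shifted // xpair_eqE /nw /=.
  have -> : (r + z).-1 - r.-1 = z by move: h; clear; clia.
  by move: h h1 h2; clear; clia.
have ax : addable s z.
  apply/andP; split.
    case: (posnP z) => //= z0; apply/negPn/negP; rewrite strict_mem // -leqNgt er => h.
    have := no (r, (r + z).-1); rewrite mem_skew_shifted // xpair_eqE /nw /=.
    have -> : (r + z).-1 - r = z.-1 by move: z0; clear; lia.
    by have := cnt_mono t (leq_pred z); move: h h2 z0; clear; clia.
  apply/negP => h; have := hs' z; rewrite h er => e1.
  have := no (r.-1, r + z); rewrite mem_skew_shifted // xpair_eqE /nw /=.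
  have -> : r + z - r.-1 = z.+1 by move: e1; clear; clia.
  by have := ht' z; case: (_ \in t); move: e1 h2; clear; clia.
have eb : (cnt s z, cnt s z + z) = (r, r + z) by rewrite er.
have hsz := strict_add_box hs ax.
have [|c||-> -> <-] := IH (add_box s z) hsz ht ub.
- move=> c; have := mb c; rewrite inE !mem_filter mem_add_box_shifted // eb negb_or.
  by case: eqP => [->|_] /=; rewrite ?(negbTE nb).
- rewrite mem_add_box_shifted // eb => /predU1P[->|/st //].
  by rewrite mem_shifted // ry addKn.
- by [].
by rewrite ax eb.
Qed.

Definition before (b c : nat * nat) : bool :=
  (b.1 < c.1) || (b.1 == c.1) && (c.2 < b.2).

Lemma iota_gtn m k : pairwise gtn (rev (iota m k)).
Proof. by rewrite -(sorted_pairwise gtn_trans) rev_sorted; exact: iota_ltn_sorted. Qed.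

Lemma shifted_before s : pairwise before (shifted s).
Proof.
rewrite /shifted pairwise_map /young; have [c ->] : exists c, iota 0 (size s) = iota c (size s) by exists 0.
elim: (size s) c => //= k IH m.
rewrite pairwise_cat; apply/and3P; split; last exact: IH.
  apply/allrelP => b c /mapP[j _ ->] /allpairsPdep[i [j' [hi _ ->]]].
  by move: hi; rewrite mem_iota /before /=; lia.
rewrite pairwise_map; apply: sub_pairwise (iota_gtn _ _) => i j /=.
by rewrite /before /=; lia.
Qed.

Lemma skew_shifted_before s t : pairwise before (skew_shifted t s).
Proof. exact: pairwise_filter (shifted_before t). Qed.

(** * Reading order and contents *)

Section ReadingOrder.

(* [e b] is the rank in the alphabet of the entry of [b], which is [i.*2] for [i'] and
   [i.*2.+1] for [i]. *)
Variables (D : seq (nat * nat)) (e : nat * nat -> nat).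
Hypothesis boxD : forall b : nat * nat, b \in D -> b.1 <= b.2.
Hypothesis convexD : forall b x c : nat * nat, b \in D -> c \in D -> nw b x -> nw x c ->
  x.1 <= x.2 -> x \in D.
Hypothesis mono : forall b c : nat * nat, b \in D -> c \in D -> nw b c -> e b <= e c.
Hypothesis strict : forall b c : nat * nat, b \in D -> c \in D -> nw b c -> e b = e c ->
  if odd (e b) then b.1 = c.1 else b.2 = c.2.

Lemma between (b c : nat * nat) r y : b \in D -> c \in D -> b.1 <= r -> b.2 <= y -> r <= c.1 -> y <= c.2 ->
  r <= y -> (r, y) \in D /\ e b <= e (r, y) <= e c.
Proof.
move=> hb hc h1 h2 h3 h4 h5.
have bx : nw b (r, y) by rewrite /nw h1.
have xc : nw (r, y) c by rewrite /nw h3.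
have hx := convexD hb hc bx xc h5.
by rewrite hx (mono hb hx bx) (mono hx hc xc).
Qed.

Lemma diagonal_strict (b c : nat * nat) : b \in D -> c \in D -> b.1 < c.1 -> b.2 < c.2 -> e b < e c.
Proof.
move=> hb hc h1 h2; have n : nw b c by rewrite /nw (ltnW h1) (ltnW h2).
rewrite ltn_neqAle mono // andbT; apply/eqP => h; have := strict hb hc n h.
by case: odd; move: h1 h2; clear; lia.
Qed.

Lemma before_same_letter (b c : nat * nat) : b \in D -> c \in D -> e b = e c ->
  before b c = (box_diag c < box_diag b).
Proof.
move=> hb hc h; have := boxD hb; have := boxD hc.
have := diagonal_strict hb hc; have := diagonal_strict hc hb.
rewrite h ltnn /before /box_diag; clear; lia.
Qed.

(** If the two boxes were on one diagonal, then the box to the right of the upper and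
   above the lower one would repeat [i'] in its row or [i] in its column. *)
Lemma marked_unmarked_neq i (b c : nat * nat) : b \in D -> c \in D -> e b = i.*2 -> e c = i.*2.+1 ->
  box_diag b <> box_diag c.
Proof.
move=> hb hc eb ec hd; have h1 := boxD hb; have h2 := boxD hc; rewrite /box_diag in hd.
have : b.1 != c.1.
  apply/eqP => h; have bc : b = c by rewrite [b]surjective_pairing [c]surjective_pairing; congr (_, _) => //; move: h h1 h2 hd; clear; lia.
  by move: ec; rewrite -bc eb; clear; lia.
rewrite neq_ltn => /orP[lt|gt]; last first.
  by have := diagonal_strict hc hb gt; rewrite eb ec; move: gt h1 h2 hd; clear; lia.
have [] := @between b c b.1 c.2 hb hc; try by move: lt h1 h2 hd; clear; lia.
move=> hx; have := strict hb hx; have := strict hx hc; rewrite /nw /= eb ec /=.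
rewrite odd_double /= => s1 s2 hh.
have [h|h] : i.*2 = e (b.1, c.2) \/ e (b.1, c.2) = i.*2.+1 by move: hh; clear; lia.
  have := s2 _ h; rewrite leqnn; move: lt h1 h2 hd; clear; lia.
by have := s1 _ h; rewrite h /= odd_double /= leqnn; move: lt h1 h2 hd; clear; lia.
Qed.

Lemma before_marked i (b c : nat * nat) : b \in D -> c \in D -> e b = i.*2 -> e c = i.*2.+1 ->
  before c b = (box_diag b < box_diag c) /\ before b c = (box_diag c < box_diag b).
Proof.
move=> hb hc eb ec; have := marked_unmarked_neq hb hc eb ec.
have h1 := boxD hb; have h2 := boxD hc; rewrite /before /box_diag.
have cb : nw c b -> False by move=> /(mono hc hb); rewrite eb ec ltnn.
rewrite /nw in cb; have : b.1 < c.1 -> b.2 < c.2 -> False; last by move: cb h1 h2; clear; lia.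
move=> lt1 lt2; have [] := @between b c b.1 c.2 hb hc; try by move: lt1 lt2 h1; clear; lia.
move=> hx; have := strict hb hx; have := strict hx hc; rewrite /nw /= eb ec /=.
rewrite odd_double /= => s1 s2 hh.
have [h|h] : i.*2 = e (b.1, c.2) \/ e (b.1, c.2) = i.*2.+1 by move: hh; clear; lia.
  by have := s2 _ h; rewrite leqnn; move: lt1 lt2 h1 h2; clear; lia.
by have := s1 _ h; rewrite h /= odd_double /= leqnn; move: lt1 lt2 h1 h2; clear; lia.
Qed.

(** Otherwise the smaller entry would be south-east of the larger one. *)
Lemma before_next_letter i (b c : nat * nat) : b \in D -> c \in D ->
  e b = i.+1.*2 \/ e b = i.+1.*2.+1 -> e c = i.*2.+1 ->
  box_diag b <= box_diag c -> before c b.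
Proof.
move=> hb hc eb ec; have h1 := boxD hb; have h2 := boxD hc.
have bc : nw b c -> False by move=> /(mono hb hc); rewrite ec; case: eb => ->; clear; lia.
have cb : c.1 = b.1 -> c.2 = b.2 -> False.
  move=> e1 e2; apply: bc; rewrite /nw e1 e2 !leqnn; done.
by move: bc cb h1 h2; rewrite /nw /before /box_diag; clear; lia.
Qed.

(** The box in the row of [c] on the diagonal of [b] lies between [c] and [b] and is
   strictly north-west of [b], which leaves only the entry [i]. *)
Lemma unmarked_on_diagonal i (b c : nat * nat) : b \in D -> c \in D ->
  e b = i.+1.*2 \/ e b = i.+1.*2.+1 -> e c = i.*2.+1 ->
  before c b -> box_diag c < box_diag b ->
  exists x, [/\ x \in D, e x = i.*2.+1 & box_diag x = box_diag b].
Proof.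
move=> hb hc eb ec; have h1 := boxD hb; have h2 := boxD hc; rewrite /before /box_diag => h3 h4.
have lt : c.1 < b.1 by move: h1 h2 h3 h4; clear; lia.
have [] := @between c b c.1 (c.1 + (b.2 - b.1)) hc hb; try by move: lt h1 h2 h3 h4; clear; lia.
move=> hx hh; have hlt : e (c.1, c.1 + (b.2 - b.1)) < e b.
  by apply: diagonal_strict => //=; move: lt h1 h2 h3 h4; clear; lia.
exists (c.1, c.1 + (b.2 - b.1)); split => //=; last by clear; lia.
have := @marked_unmarked_neq i.+1 (c.1, c.1 + (b.2 - b.1)) b hx hb; rewrite /box_diag addKn.
case: eb => eb; move: hh hlt; rewrite eb ec; first by clear; lia.
move: (e _) => a h5 h6 h7; case: (eqVneq a i.+1.*2) => [/h7/(_ erefl)//|].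
by move: h5 h6; clear; lia.
Qed.

(** If [c] were below [b] on a higher diagonal, then the box in the row of [c] on the
   diagonal of [b] could neither repeat [i] south-east of [b] nor the mark of [c]. *)
Lemma before_unmarked_marked i (b c : nat * nat) : b \in D -> c \in D -> e b = i.*2.+1 -> e c = i.+1.*2 ->
  before b c = (box_diag c <= box_diag b).
Proof.
move=> hb hc eb ec; have h1 := boxD hb; have h2 := boxD hc.
have cb : nw c b -> False by move=> /(mono hc hb); rewrite eb ec; clear; lia.
rewrite /nw in cb; have : b.1 < c.1 -> box_diag b < box_diag c -> False; last first.
  by move: cb h1 h2; rewrite /before /box_diag; clear; lia.
rewrite /box_diag => lt1 lt2.
have [] := @between b c c.1 (c.1 + (b.2 - b.1)) hb hc; try by move: lt1 lt2 h1 h2; clear; lia.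
set x := (c.1, _) => hx hh.
have : e b < e x by apply: diagonal_strict => //=; move: lt1 lt2 h1 h2; clear; lia.
have := strict hx hc; rewrite /nw /= leqnn ec => s1 h.
have h' : e x = i.+1.*2 by move: h hh; rewrite eb ec; clear; lia.
by move: s1; rewrite h' odd_double => /(_ _ erefl); move: lt1 lt2 h1 h2; clear; lia.
Qed.

(** If [c] were above [b] on a lower diagonal, then the box in the row of [b] on the
   diagonal of [c] would be an unmarked [i], and the box above it in the row of [c]
   neither [i'] nor [i]. *)
Lemma before_marked_marked i (b c : nat * nat) : b \in D -> c \in D -> e b = i.+1.*2 -> e c = i.*2 ->
  before b c = (box_diag c < box_diag b).
Proof.
move=> hb hc eb ec; have h1 := boxD hb; have h2 := boxD hc.
have bc : nw b c -> False by move=> /(mono hb hc); rewrite eb ec; clear; lia.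
rewrite /nw in bc; have : c.1 < b.1 -> box_diag c < box_diag b -> False; last first.
  by move: bc h1 h2; rewrite /before /box_diag; clear; lia.
rewrite /box_diag => lt1 lt2.
have [] := @between c b b.1 (b.1 + (c.2 - c.1)) hc hb; try by move: lt1 lt2 h1 h2; clear; lia.
have [] := @between c b c.1 (b.1 + (c.2 - c.1)) hc hb; try by move: lt1 lt2 h1 h2; clear; lia.
set x := (c.1, _); set y := (b.1, _) => hx _ hy hh.
have cy : e c < e y by apply: diagonal_strict => //=; move: lt1 lt2 h1 h2; clear; lia.
have ey : e y = i.*2.+1.
  have := strict hy hb; rewrite /nw /= leqnn => s1.
  case: (eqVneq (e y) (e b)) => [h|]; last by move: cy hh; rewrite eb ec; clear; lia.
  by move: s1; rewrite h eb odd_double => /(_ _ erefl); move: lt1 lt2 h1 h2; clear; lia.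
have [nxy ncx] : nw x y /\ nw c x by rewrite /nw /=; move: lt1 lt2 h1 h2; clear; lia.
have := mono hx hy nxy; have := mono hc hx ncx; rewrite ey ec => m1 m2.
have := strict hx hy nxy; have := strict hc hx ncx; rewrite ey ec => s1 s2.
have [h|h] : e x = i.*2 \/ e x = i.*2.+1 by move: m1 m2; clear; lia.
  by have := s1 (esym h); rewrite odd_double /=; move: lt1 lt2 h1 h2; clear; lia.
by have := s2 h; rewrite h /= odd_double /=; move: lt1 lt2 h1 h2; clear; lia.
Qed.

End ReadingOrder.

(** * Lattice words of a filling *)

Lemma lattice_wordP v : reflect
  (forall v1 a v2, v = v1 ++ a :: v2 -> 2 <= a.1 ->
     count_mem (unmarked a.1) v1 < count_mem (unmarked a.1.-1) v1)
  (lattice_word v).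
Proof.
apply: (iffP forallP) => [h v1 a v2 ev ha|h p].
  have pv : size v1 < size v by rewrite ev size_cat /= addnS ltnS leq_addr.
  by have := h (Ordinal pv); rewrite /= ev nth_cat ltnn subnn take_size_cat //= ha.
by apply/implyP; apply: (h _ _ (drop p.+1 v)); rewrite -drop_nth // cat_take_drop.
Qed.

Lemma hat_word_cat u v : hat_word (u ++ v) = hat_word v ++ hat_word u.
Proof. by rewrite /hat_word map_cat rev_cat. Qed.

Lemma count_hat_word j w : count_mem (unmarked j) (hat_word w) = count_mem (marked j) w.
Proof.
rewrite /hat_word count_rev count_map; apply: eq_count => -[i []] /=; rewrite !xpair_eqE ?andbF //.
Qed.

(** The letters of the second half of [w ++ hat_word w] come from the end of [w]
   backwards. *)
Lemma lattice_hatP w : reflect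
  ((forall w1 a w2, w = w1 ++ a :: w2 -> 2 <= a.1 ->
      count_mem (unmarked a.1) w1 < count_mem (unmarked a.1.-1) w1) /\
   (forall w1 a w2, w = w1 ++ a :: w2 -> 2 <= (hat a).1 ->
      count_mem (unmarked (hat a).1) w + count_mem (marked (hat a).1) w2 <
      count_mem (unmarked (hat a).1.-1) w + count_mem (marked (hat a).1.-1) w2))
  (lattice_word (w ++ hat_word w)).
Proof.
apply: (iffP (lattice_wordP _)) => [h|[h1 h2] v1 a v2].
  split=> w1 a w2 ew ha; first by apply: (h w1 a (w2 ++ hat_word w)); rewrite // {1}ew -catA.
  have := h (w ++ hat_word w2) (hat a) (hat_word w1).
  rewrite !count_cat !count_hat_word; apply => //.
  by rewrite -catA [in hat_word w]ew hat_word_cat /hat_word /= rev_cons cat_rcons.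
move=> e ha; have hw : hat_word w = map hat (rev w) by rewrite /hat_word map_rev.
have pv : size v1 < size (w ++ hat_word w) by rewrite e size_cat /= addnS ltnS leq_addr.
have ev1 : v1 = take (size v1) (w ++ hat_word w) by rewrite e take_size_cat.
have ea : a = nth a (w ++ hat_word w) (size v1) by rewrite e nth_cat ltnn subnn.
rewrite take_cat in ev1; rewrite nth_cat in ea; case: ltnP ev1 ea => lt ev1 ea.
  by apply: (h1 v1 a (drop (size v1).+1 w)) => //; rewrite {1}ev1 ea -drop_nth // cat_take_drop.
set m := size v1 - size w in ev1 ea.
have pm : m < size (rev w).
  by move: pv; rewrite size_cat hw size_map size_rev /m; move: lt; clear; lia.
rewrite hw (nth_map (unmarked 0)) // in ea.
pose r := rev w; have er : r = take m r ++ nth (unmarked 0) r m :: drop m.+1 r.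
  by rewrite -drop_nth // cat_take_drop.
have ew : w = rev (drop m.+1 r) ++ nth (unmarked 0) r m :: rev (take m r).
  by rewrite -{1}[w]revK -/r {1}er rev_cat rev_cons cat_rcons.
have := h2 _ _ _ ew; rewrite -ea => /(_ ha).
have et : map hat (take m r) = hat_word (rev (take m r)) by rewrite /hat_word map_rev revK.
by rewrite ev1 hw -map_take et !count_cat !count_hat_word.
Qed.

Section Reading.

Variables (D : seq (nat * nat)) (L : nat * nat -> letter).
Hypothesis readD : pairwise before D.

Lemma before_irr b : before b b = false.
Proof. by rewrite /before !ltnn andbF. Qed.

Lemma before_asym b c : before b c -> before c b = false.
Proof. by rewrite /before; lia. Qed.

Lemma split_before D1 b D2 : D = D1 ++ b :: D2 ->
  (forall P, count P D1 = count (fun c => P c && before c b) D) /\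
  (forall P, count P D2 = count (fun c => P c && before b c) D).
Proof.
move=> e; move: readD; rewrite e pairwise_cat /= => /and4P[/allrelP h1 _ /allP h2 _].
have h3 c : c \in D1 -> before c b by move=> hc; apply: h1; rewrite ?mem_head.
split=> P; rewrite count_cat /= before_irr andbF add0n.
  rewrite [X in _ + X](_ : _ = 0) ?addn0; last first.
    apply/eqP; rewrite -leqn0 leqNgt -has_count; apply/hasP => -[c hc /andP[_]].
    by rewrite (before_asym (h2 _ hc)).
  by apply: eq_in_count => c hc; rewrite h3 // andbT.
rewrite [X in X + _](_ : _ = 0) ?add0n; last first.
  apply/eqP; rewrite -leqn0 leqNgt -has_count; apply/hasP => -[c hc /andP[_]].
  by rewrite (before_asym (h3 _ hc)).
by apply: eq_in_count => c hc; rewrite h2 // andbT.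
Qed.

Lemma map_split w1 a w2 : map L D = w1 ++ a :: w2 -> exists D1 b D2,
  [/\ D = D1 ++ b :: D2, map L D1 = w1, L b = a & map L D2 = w2].
Proof.
elim: D w1 => [|c D' IH] [|a' w1] //= [e1 e2]; first by exists [::], c, D'.
by have [D1 [b [D2 [-> <- <- <-]]]] := IH _ e2; exists (c :: D1), b, D2; rewrite /= e1.
Qed.

Lemma mem_split b : b \in D -> exists D1 D2, D = D1 ++ b :: D2.
Proof. by case/splitPr => D1 D2; exists D1, D2. Qed.

Definition num_before a b := count (fun c => (L c == a) && before c b) D.
Definition num_after a b := count (fun c => (L c == a) && before b c) D.

Lemma LRS_wordP : reflect
  [/\ forall b, b \in D -> 2 <= (L b).1 ->
        num_before (unmarked (L b).1) b < num_before (unmarked (L b).1.-1) b,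
      forall b, b \in D -> 2 <= (hat (L b)).1 ->
        count (fun c => L c == unmarked (hat (L b)).1) D + num_after (marked (hat (L b)).1) b <
        count (fun c => L c == unmarked (hat (L b)).1.-1) D + num_after (marked (hat (L b)).1.-1) b
    & forall b, b \in D -> ~~ (L b).2 -> num_after (L b) b = 0 ->
        0 < num_after (unmarked (L b).1) b]
  (LRS_word (map L D)).
Proof.
have c1 D1 b D2 a : D = D1 ++ b :: D2 -> count_mem a (map L D1) = num_before a b.
  by move=> e; rewrite count_map; have [-> _] := split_before e.
have c2 D1 b D2 a : D = D1 ++ b :: D2 -> count_mem a (map L D2) = num_after a b.
  by move=> e; rewrite count_map; have [_ ->] := split_before e.
have c0 a : count_mem a (map L D) = count (fun c => L c == a) D by rewrite count_map.
apply: (iffP andP) => [[/lattice_hatP[h1 h2] /forallP h3]|[h1 h2 h3]].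
  split=> b hb; have [D1 [D2 e]] := mem_split hb.
  - by rewrite -!(c1 _ _ _ _ e); apply: h1; rewrite e map_cat.
  - by rewrite -!(c2 _ _ _ _ e) -!c0; apply: (h2 (map L D1) _ (map L D2)); rewrite e map_cat.
  rewrite -!(c2 _ _ _ _ e) => mb ab.
  have pw : size D1 < size (map L D) by rewrite e size_map size_cat /= addnS ltnS leq_addr.
  have := h3 (Ordinal pw); rewrite /= /last_marked e map_cat nth_cat size_map ltnn subnn /=.
  rewrite drop_cat size_map ltnNge leqnSn subSnn /= drop0.
  have eb : L b = marked (L b).1 by case: (L b) mb => i [].
  by rewrite {1}eb eqxx -{1}eb -has_pred1 has_count ab /= -has_count has_pred1.
split.
  apply/lattice_hatP; split=> w1 a w2 /map_split[D1 [b [D2 [e e1 e2 e3]]]] ha; subst w1 a w2.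
    by rewrite !(c1 _ _ _ _ e); apply: h1 => //; rewrite e mem_cat mem_head orbT.
  by rewrite !(c2 _ _ _ _ e) !c0; apply: h2 => //; rewrite e mem_cat mem_head orbT.
apply/forallP => p /=; apply/implyP => /andP[/eqP eb nb].
have pw : p < size (map L D) := ltn_ord p.
have /map_split[D1 [b [D2 [e e1 e2 e3]]]] :
    map L D = take p (map L D) ++ nth (unmarked 0) (map L D) p :: drop p.+1 (map L D).
  by rewrite -drop_nth // cat_take_drop.
have hb : b \in D by rewrite e mem_cat mem_head orbT.
rewrite -e3 -has_pred1 has_count (c2 _ _ _ _ e) -e2; apply: h3 => //; first by rewrite e2 eb.
rewrite -(c2 _ _ _ _ e) e3; apply/eqP; rewrite -leqn0 leqNgt -has_count has_pred1.
by rewrite e2 eb.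
Qed.

End Reading.

(** * Reading words and ballot pairs *)

(** The rank of a letter in the alphabet. *)
Definition code (a : letter) : nat := a.1.*2 + a.2.

Lemma code_inj : injective code.
Proof. by move=> [i [] ] [j [] ]; rewrite /code /= => h; congr (_, _); lia. Qed.

Lemma leq_letterE a b : leq_letter a b = (code a <= code b).
Proof. by case: a b => [i [] ] [j [] ]; rewrite /leq_letter /code /=; lia. Qed.

Lemma odd_code a : odd (code a) = a.2.
Proof. by rewrite /code oddD odd_double; case: a.2. Qed.

Lemma code_marked i : code (marked i) = i.*2.
Proof. by rewrite /code addn0. Qed.

Lemma code_unmarked i : code (unmarked i) = i.*2.+1.
Proof. by rewrite /code addn1. Qed.

Lemma count_leq_in (T : eqType) (s : seq T) (P Q : pred T) :
  {in s, forall x, P x -> Q x} -> count P s <= count Q s.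
Proof.
elim: s => //= x s IH h; apply: leq_add.
  by case: (P x) (h x (mem_head _ _)) => // ->.
by apply: IH => y ys; apply: h; rewrite inE ys orbT.
Qed.

Section Cells.

Variables (D : seq (nat * nat)) (L : nat * nat -> letter).
Hypothesis boxD : forall b : nat * nat, b \in D -> b.1 <= b.2.
Hypothesis convexD : forall b x c : nat * nat, b \in D -> c \in D -> nw b x -> nw x c ->
  x.1 <= x.2 -> x \in D.
Hypothesis readD : pairwise before D.
Hypothesis mono : forall b c : nat * nat, b \in D -> c \in D -> nw b c ->
  code (L b) <= code (L c).
Hypothesis strictL : forall b c : nat * nat, b \in D -> c \in D -> nw b c ->
  code (L b) = code (L c) -> if odd (code (L b)) then b.1 = c.1 else b.2 = c.2.

Definition cells (a : letter) : seq nat := [seq box_diag b | b <- D & L b == a].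

(** The boxes with entries [i] and [i'], in an order in which they can be added:
   [i'] downwards, then [i] upwards. *)
Definition block (i : nat) : seq nat := cells (marked i) ++ rev (cells (unmarked i)).

Lemma count_cells p a : count p (cells a) = count (fun c => (L c == a) && p (box_diag c)) D.
Proof. by rewrite count_map count_filter; apply: eq_count => c /=; rewrite andbC. Qed.

Lemma nge_cells a y :
  nge (rev (cells a)) y = count (fun c => (L c == a) && (y <= box_diag c)) D.
Proof. by rewrite /nge count_rev count_cells. Qed.

Lemma mem_cells a y : reflect (exists b, [/\ b \in D, L b = a & box_diag b = y]) (y \in cells a).
Proof.
apply: (iffP mapP) => [[b]|[b [hb <- <-]]].
  by rewrite mem_filter => /andP[/eqP ha hb] ->; exists b.
by exists b; rewrite ?mem_filter ?eqxx.
Qed.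

Lemma same_letter b c : b \in D -> c \in D -> L b = L c ->
  before b c = (box_diag c < box_diag b).
Proof.
by move=> hb hc h; apply: (before_same_letter boxD mono strictL) => //; rewrite h.
Qed.

Lemma cells_sorted a : sorted gtn (cells a).
Proof.
rewrite (sorted_pairwise gtn_trans) pairwise_map.
apply: (@sub_in_pairwise _ [pred b | (b \in D) && (L b == a)] before) => [b c||].
- rewrite !inE => /andP[hb /eqP h] /andP[hc /eqP h'].
  by rewrite same_letter // h h'.
- by apply/allP => b; rewrite mem_filter inE andbC.
- exact: pairwise_filter readD.
Qed.

Lemma cells_uniq a : uniq (cells a).
Proof. by apply: (sorted_uniq gtn_trans) (cells_sorted a) => x; apply: ltnn. Qed.

Definition block_ok i : Prop :=
  [/\ hook (block i), dpart (block i) = cells (marked i)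
    & apart (block i) = rev (cells (unmarked i))].

(** The lowest of the boxes [i], [i'] is unmarked if and only if the marks can be
   recovered from the block. *)
Lemma block_okP i : block_ok i <->
  {in cells (marked i), forall y, exists2 y', y' \in cells (unmarked i) & y' < y}.
Proof.
split=> [[hk hd ha] y hy|h].
  case e: (block i) hd ha => [|x w] hd ha; first by rewrite -hd in hy.
  exists (head 0 (apart (x :: w))).
    rewrite -mem_rev -ha; case ea: (apart (x :: w)) => [|z v]; last exact: mem_head.
    by have := dpart_nil ea.
  by have /sorted_rcons_gtn[_] := dpart_sorted x w; apply; rewrite hd.
have := cells_sorted (unmarked i); rewrite -rev_sorted /block_ok /block => sA.
case e: (rev (cells (unmarked i))) sA => [|j a] sA.
  suff -> : cells (marked i) = [::] by [].
  case ed: (cells (marked i)) h => [//|y d] /(_ y (mem_head _ _))[y'].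
  by rewrite -mem_rev e.
apply: hook_cat (sA); apply: rcons_sorted_gtn; first exact: cells_sorted.
move=> y /h[y']; rewrite -mem_rev e inE => /predU1P[->//|hy].
by apply: ltn_trans; have /allP := order_path_min ltn_trans sA; apply.
Qed.

Lemma marked_letter i b c : b \in D -> c \in D -> L b = marked i -> L c = unmarked i ->
  [/\ before c b = (box_diag b < box_diag c), before b c = (box_diag c < box_diag b)
    & box_diag b <> box_diag c].
Proof.
move=> hb hc eb ec; have eb' : code (L b) = i.*2 by rewrite eb code_marked.
have ec' : code (L c) = i.*2.+1 by rewrite ec code_unmarked.
have [h1 h2] := before_marked boxD convexD mono strictL hb hc eb' ec'.
by split => //; apply: (marked_unmarked_neq boxD convexD mono strictL hb hc eb' ec').
Qed.

(** The condition on the last [i'] of the word says that an [i] is read later, which by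
   [marked_letter] means that it has a smaller content. *)
Lemma reading_block_ok : (forall b, b \in D -> 0 < (L b).1) ->
  (forall b, b \in D -> ~~ (L b).2 -> num_after D L (L b) b = 0 ->
     0 < num_after D L (unmarked (L b).1) b) <->
  (forall i, 0 < i -> block_ok i).
Proof.
move=> pos; have mE b : ~~ (L b).2 -> L b = marked (L b).1 by case: (L b) => i [].
split=> h; last first.
  move=> b hb mb _; have lb := mE b mb; have /block_okP := h _ (pos b hb).
  case/(_ (box_diag b)) => [|y /mem_cells[c [hc lc <-]] lt]; first by apply/mem_cells; exists b.
  rewrite -has_count; apply/hasP; exists c => //; rewrite lc eqxx /=.
  by have [_ -> _] := marked_letter hb hc lb lc.
move=> i i0; apply/block_okP => y /mem_cells[b [hb lb <-]].
elim: {b}(box_diag b).+1 {-2}b (ltnSn (box_diag b)) hb lb => // n IH b lt hb lb.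
have mb : ~~ (L b).2 by rewrite lb.
case: (posnP (num_after D L (L b) b)) => h0.
  have := h b hb mb h0; rewrite lb -has_count => /hasP[c hc /andP[/eqP lc bc]].
  have [_ e _] := marked_letter hb hc lb lc.
  by exists (box_diag c); rewrite -?e //; apply/mem_cells; exists c.
move: h0; rewrite -has_count => /hasP[c hc /andP[/eqP lc]].
rewrite same_letter // => cb; have [||z hz lt'] := IH c _ hc.
- by apply: leq_trans cb _; rewrite -ltnS.
- by rewrite lc.
by exists z => //; apply: ltn_trans lt' cb.
Qed.

Section Pair.

Variable i : nat.
Let A1 := unmarked i.
Let M1 := marked i.
Let A2 := unmarked i.+1.
Let M2 := marked i.+1.

Lemma before_second b : b \in D -> L b = M2 \/ L b = A2 ->
  num_before D L A2 b = nge (rev (cells A2)) (box_diag b).+1.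
Proof.
move=> hb lb; rewrite nge_cells; apply: eq_in_count => c hc /=.
case: eqP => //= lc; case: lb => lb; last by rewrite same_letter // lc lb.
by have [-> _ _] := marked_letter hb hc lb lc.
Qed.

Lemma second_code b : L b = M2 \/ L b = A2 -> code (L b) = i.+1.*2 \/ code (L b) = i.+1.*2.+1.
Proof. by case=> ->; [left; exact: code_marked | right; exact: code_unmarked]. Qed.

Lemma before_first_ge b : b \in D -> L b = M2 \/ L b = A2 ->
  nge (rev (cells A1)) (box_diag b) <= num_before D L A1 b.
Proof.
move=> hb lb; rewrite nge_cells; apply: count_leq_in => c hc /andP[/eqP lc le].
rewrite lc eqxx; apply: (before_next_letter boxD mono hb hc (second_code lb)) le.
by rewrite lc code_unmarked.
Qed.

Lemma before_first_le b : b \in D -> L b = M2 \/ L b = A2 -> box_diag b \notin cells A1 ->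
  num_before D L A1 b <= nge (rev (cells A1)) (box_diag b).
Proof.
move=> hb lb nb; rewrite nge_cells; apply: count_leq_in => c hc /andP[/eqP lc cb].
rewrite lc eqxx /= leqNgt; apply: contra nb => lt; apply/mem_cells.
have lc' : code (L c) = i.*2.+1 by rewrite lc code_unmarked.
have [x [hx lx <-]] := unmarked_on_diagonal boxD convexD mono strictL hb hc (second_code lb) lc' cb lt.
by exists x; split => //; apply: code_inj; rewrite lx code_unmarked.
Qed.

Lemma after_first_second b : b \in D -> L b = A1 -> num_after D L M2 b = nle (cells M2) (box_diag b).
Proof.
move=> hb lb; rewrite /nle count_cells; apply: eq_in_count => c hc /=.
case: eqP => //= lc.
apply: (before_unmarked_marked boxD convexD mono strictL hb hc (i := i)).
  by rewrite lb code_unmarked.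
by rewrite lc code_marked.
Qed.

Lemma after_first_first b : b \in D -> L b = A1 -> num_after D L M1 b = nle (cells M1) (box_diag b).
Proof.
move=> hb lb; rewrite /nle count_cells; apply: eq_in_count => c hc /=.
case: eqP => //= lc; have [e _ ne] := marked_letter hc hb lc lb.
by rewrite e ltn_neqAle; case: eqP ne.
Qed.

Lemma nle_lt s y : uniq s -> nle s y = count (fun x => x < y) s + (y \in s).
Proof.
move=> us; rewrite -(count_uniq_mem _ us) /nle; elim: s {us} => //= x s ->.
by clear; clia.
Qed.

Lemma after_second_second b : b \in D -> L b = M2 ->
  nle (cells M2) (box_diag b) = (num_after D L M2 b).+1.
Proof.
move=> hb lb; rewrite nle_lt ?cells_uniq // (_ : _ \in _) ?addn1; last by apply/mem_cells; exists b.
congr _.+1; rewrite count_cells; apply: eq_in_count => c hc /=.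
by case: eqP => //= lc; rewrite same_letter // lc lb.
Qed.

Lemma after_second_first b : b \in D -> L b = M2 ->
  nle (cells M1) (box_diag b) = num_after D L M1 b + (box_diag b \in cells M1).
Proof.
move=> hb lb; rewrite nle_lt ?cells_uniq //; congr (_ + _).
rewrite count_cells; apply: eq_in_count => c hc /=.
case: eqP => //= lc; apply/esym.
apply: (before_marked_marked boxD convexD mono strictL hb hc (i := i)).
  by rewrite lb code_marked.
by rewrite lc code_marked.
Qed.

Lemma nge0_cells a : nge (rev (cells a)) 0 = count (fun c => L c == a) D.
Proof. by rewrite nge_cells; apply: eq_count => c; rewrite andbT. Qed.

Hypotheses (ok1 : block_ok i) (ok2 : block_ok i.+1).

(** The conditions on the entries [i+1], [i+1'] in the first half of
   [w ++ hat_word w], and on the entries [i], [i+1'] in the second half. *)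
Definition reading_pair : Prop :=
  (forall b, b \in D -> L b = M2 \/ L b = A2 -> num_before D L A2 b < num_before D L A1 b) /\
  (forall b, b \in D -> L b = A1 \/ L b = M2 ->
     count (fun c => L c == A2) D + num_after D L M2 b <
     count (fun c => L c == A1) D + num_after D L M1 b).

(** The boxes [i] read before a box [b] with entry [i+1] or [i+1'] contain those on the
   diagonal of [b] and above.  There are others only if the diagonal of [b] carries an [i],
   and then the inequality follows from the one on the next diagonal. *)
Lemma reading_pair_ballot : reading_pair -> ballot_pair (block i) (block i.+1).
Proof.
case: ok1 => hk1 ed1 ea1; case: ok2 => hk2 ed2 ea2 [hF hB].
rewrite /ballot_pair ed1 ea1 ed2 ea2 !nge0_cells.
have uA a : uniq (rev (cells a)) by rewrite rev_uniq cells_uniq.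
have fwd b : b \in D -> L b = M2 \/ L b = A2 ->
    nge (rev (cells A2)) (box_diag b).+1 <= nge (rev (cells A1)) (box_diag b).+1 ->
    nge (rev (cells A2)) (box_diag b).+1 < nge (rev (cells A1)) (box_diag b).
  move=> hb lb le; case: (boolP (box_diag b \in cells A1)) => h1.
    by rewrite (nge_mem (uA A1)) ?mem_rev.
  by apply: leq_trans (before_first_le hb lb h1); rewrite -before_second //; apply: hF.
have le y : nge (rev (cells A2)) y <= nge (rev (cells A1)) y.
  have [n hn] := nge_eventually (rev (cells A2)).
  elim: {y}(n - y) {-2}y (erefl (n - y)) => [|k IH] y e; first by rewrite hn //; move: e; clear; lia.
  have {}IH : nge (rev (cells A2)) y.+1 <= nge (rev (cells A1)) y.+1.
    by apply: IH; move: e; clear; lia.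
  case: (boolP (y \in cells A2)) => hy.
    rewrite (nge_mem (uA A2)) ?mem_rev //; case/mem_cells: hy IH => b [hb lb <-].
    by apply: fwd => //; right.
  rewrite (nge_notin (uA A2)) ?mem_rev //; apply: leq_trans IH _.
  by rewrite [X in _ <= X](ngeS _ (uA A1)) leq_addr.
apply/and3P; split; apply/allP => y.
- rewrite mem_cat mem_rev => /orP[] /mem_cells[b [hb lb <-]]; apply: fwd => //.
    by left.
  by right.
- case/mem_cells => b [hb lb <-]; rewrite after_second_second // after_second_first //.
  rewrite addnS; apply: leq_trans (hB b hb (or_intror lb)) _.
  by rewrite leq_add2l leq_addr.
- rewrite mem_rev => /mem_cells[b [hb lb <-]].
  by rewrite -after_first_second // -after_first_first //; apply: hB b hb (or_introl lb).
Qed.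

(** Reading order and contents count the same boxes, except that a diagonal with marked
   boxes of both letters costs one; [ballot_marked_strict] makes up for it. *)
Lemma ballot_reading_pair s : strict_partition s -> legal s (block i ++ block i.+1) ->
  ballot_pair (block i) (block i.+1) -> reading_pair.
Proof.
case: ok1 => hk1 ed1 ea1; case: ok2 => hk2 ed2 ea2 hs l bp.
have st y := @ballot_marked_strict s _ _ y hs l hk1 hk2 bp.
move: bp st; rewrite /ballot_pair ed1 ea1 ed2 ea2 !nge0_cells.
case/and3P => /allP hF /allP hB1 /allP hB2 st; split=> b hb lb.
  rewrite before_second //; apply: leq_trans (before_first_ge hb lb); apply: hF.
  rewrite mem_cat mem_rev; apply/orP; case: lb => lb; [left | right]; apply/mem_cells; exists b => //.
case: lb => lb.
  rewrite after_first_second // after_first_first //; apply: hB2.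
  by rewrite mem_rev; apply/mem_cells; exists b.
have hy : box_diag b \in cells M2 by apply/mem_cells; exists b.
case: (boolP (box_diag b \in cells M1)) => h1.
  have := st _ h1 hy; rewrite after_second_second // after_second_first // h1 addn1 !addnS ltnS.
  by [].
have := hB1 _ hy; rewrite after_second_second // after_second_first // (negbTE h1).
by rewrite addnS addn0.
Qed.

End Pair.

(** Every inequality of the lattice condition compares two consecutive letters, so the
   pairs can be treated one by one. *)
Theorem LRS_reading : (forall b, b \in D -> 0 < (L b).1) ->
  (forall i, 0 < i -> exists2 s, strict_partition s & legal s (block i ++ block i.+1)) ->
  LRS_word (map L D) <->
  (forall i, 0 < i -> block_ok i /\ ballot_pair (block i) (block i.+1)).
Proof.
move=> pos hl; split=> [/(LRS_wordP _ readD)[h1 h2 h3] i i0|h].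
  have ok := (reading_block_ok pos).1 h3; split; first exact: ok.
  apply: reading_pair_ballot; [exact: ok|exact: ok|split=> b hb lb].
    have lb1 : (L b).1 = i.+1 by case: lb => ->.
    by have := h1 b hb; rewrite lb1; apply; rewrite ltnS.
  have lb1 : (hat (L b)).1 = i.+1 by case: lb => ->.
  by have := h2 b hb; rewrite lb1; apply; rewrite ltnS.
have ok i (i0 : 0 < i) : block_ok i by case: (h i i0).
have rp i (i0 : 0 < i) : reading_pair i.
  have [s hs l] := hl i i0.
  have [_ b] := h i i0; exact (ballot_reading_pair (ok i i0) (ok i.+1 isT) hs l b).
apply/(LRS_wordP _ readD); split.
- move=> b hb; case lb: (L b) => [[|i] m] //= i0.
  by apply: (rp i i0).1 => //; case: m lb; [right | left].
- move=> b hb; case lb: (L b) => [[|i] [|]] //= i0.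
  + by apply: (rp i.+1 isT).2 => //; left.
  + by apply: (rp i i0).2 => //; right.
- exact: (reading_block_ok pos).2.
Qed.

End Cells.

(** * Fillings of a skew diagram *)

Lemma uniq_skew_shifted s t : uniq (skew_shifted t s).
Proof. by apply: pairwise_uniq (skew_shifted_before s t) => b; apply: before_irr. Qed.

Lemma count_seq_sub (D : seq (nat * nat)) (P : pred (nat * nat)) : uniq D ->
  #|[set b : seq_sub D | P (val b)]| = count P D.
Proof.
move=> uD; rewrite cardE -(size_map val) -size_filter; apply/eqP.
rewrite eqn_leq; apply/andP; split; apply: uniq_leq_size; rewrite ?filter_uniq //.
- by rewrite map_inj_uniq ?enum_uniq //; exact: val_inj.
- move=> c /mapP[b]; rewrite mem_enum inE => hb ->.
  by rewrite mem_filter hb; exact: (valP b).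
- move=> c; rewrite mem_filter => /andP[hc cD]; apply/mapP; exists (SeqSub cD) => //.
  by rewrite mem_enum inE.
Qed.

(** The blocks of a word, with the letters that they stand for. *)
Fixpoint lettered (i : nat) (bs : seq (seq nat)) : seq (letter * nat) :=
  if bs is c :: bs' then
    [seq (marked i, x) | x <- dpart c] ++ [seq (unmarked i, x) | x <- apart c] ++ lettered i.+1 bs'
  else [::].

Lemma unzip2_lettered i bs : unzip2 (lettered i bs) = flatten bs.
Proof.
elim: bs i => //= c bs IH i.
by rewrite /unzip2 !map_cat -!map_comp !map_id -/(unzip2 _) IH catA cat_dpart.
Qed.

Lemma mem_lettered i bs a y : ((a, y) \in lettered i bs) =
  (i <= a.1) && (y \in (if a.2 then apart else dpart) (nth [::] bs (a.1 - i))).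
Proof.
elim: bs i => [|c bs IH] i /=; first by rewrite nth_nil; case: a => j [] /=; rewrite andbF.
rewrite !mem_cat IH; have em j m (s : seq nat) : ((a, y) \in [seq ((j, m), x) | x <- s]) = (a == (j, m)) && (y \in s).
  apply/mapP/andP => [[x xs [-> ->]]|[/eqP-> ys]]; first by rewrite eqxx.
  by exists y.
rewrite !em; case: a {em IH} => j m; rewrite !xpair_eqE /=.
case: (ltngtP i j) => [lt|gt|<-] //=; last by rewrite subnn ?eqxx; case: m; rewrite /= ?orbF.
by rewrite -(subnSK lt).
Qed.

Section Fillings.

Variables (mu al : seq nat).
Hypotheses (hmu : strict_partition mu) (hal : strict_partition al).
Hypothesis sub : forall b, b \in shifted mu -> b \in shifted al.
Let D := skew_shifted al mu.

Lemma boxD (b : nat * nat) : b \in D -> b.1 <= b.2.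
Proof. by case: b => r c; rewrite mem_skew_shifted // => /andP[]. Qed.

Lemma convexD (b x c : nat * nat) : b \in D -> c \in D -> nw b x -> nw x c ->
  x.1 <= x.2 -> x \in D.
Proof. exact: skew_convex. Qed.

Lemma readD : pairwise before D.
Proof. exact: skew_shifted_before. Qed.

Section Filling.

Variable L : nat * nat -> letter.
Let T := fun b : seq_sub D => L (val b).

(** The corner (b.1, c.2) of the rectangle spanned by two boxes reduces both properties
   to one row and one column. *)
Lemma tableauP : shifted_tableau T ->
  [/\ forall b, b \in D -> 0 < (L b).1,
      forall b c : nat * nat, b \in D -> c \in D -> nw b c -> code (L b) <= code (L c)
    & forall b c : nat * nat, b \in D -> c \in D -> nw b c -> code (L b) = code (L c) ->
        if odd (code (L b)) then b.1 = c.1 else b.2 = c.2].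
Proof.
case/and5P => /forallP h1 /forallP h2 /forallP h3 /forallP h4 /forallP h5.
have row (b c : nat * nat) : b \in D -> c \in D -> b.1 = c.1 -> b.2 <= c.2 -> code (L b) <= code (L c).
  move=> hb hc e le; have := h2 (SeqSub hb) => /forallP/(_ (SeqSub hc)).
  by rewrite /= e eqxx le leq_letterE.
have col (b c : nat * nat) : b \in D -> c \in D -> b.2 = c.2 -> b.1 <= c.1 -> code (L b) <= code (L c).
  move=> hb hc e le; have := h3 (SeqSub hb) => /forallP/(_ (SeqSub hc)).
  by rewrite /= e eqxx le leq_letterE.
have corner (b c : nat * nat) : b \in D -> c \in D -> nw b c -> (b.1, c.2) \in D.
  move=> hb hc /andP[le1 le2]; apply: (convexD hb hc); rewrite /nw /= ?leqnn ?le1 ?le2 //.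
  exact: leq_trans (boxD hb) le2.
split=> [b hb|b c hb hc n|b c hb hc n e].
- exact: (h1 (SeqSub hb)).
- have hx := corner b c hb hc n; have /andP[le1 le2] := n.
  by apply: leq_trans (row _ _ hb hx _ _) (col _ _ hx hc _ _).
have hx := corner b c hb hc n; have /andP[le1 le2] := n.
have e1 : L (b.1, c.2) = L b.
  apply: code_inj; apply/eqP; rewrite eqn_leq {1}e; apply/andP; split.
    exact: col.
  exact: row.
rewrite odd_code; case: ifPn => mb.
  have := h5 (SeqSub hx) => /forallP/(_ (SeqSub hc)); rewrite /T /= eqxx e1 mb andbT.
  by rewrite (code_inj e) eqxx => /eqP/(congr1 val)/(congr1 fst).
have := h4 (SeqSub hb) => /forallP/(_ (SeqSub hx)); rewrite /T /= eqxx e1 eqxx mb /=.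
by move=> /eqP/(congr1 val)/(congr1 snd).
Qed.

Lemma word_filling : word T = map L D.
Proof.
rewrite /word /T (map_comp L val); congr map; rewrite (pmap_filter (@insubK _ _ _)).
by apply/all_filterP/allP => b hb; rewrite insubT.
Qed.

Lemma size_block i : size (block D L i) = count (fun b => (L b).1 == i) D.
Proof.
rewrite size_cat size_rev !size_map !size_filter -count_predUI.
rewrite [X in _ + X](_ : _ = 0) ?addn0; last first.
  by apply/eqP; rewrite -leqn0 leqNgt -has_count; apply/hasP => -[b _ /andP[/eqP-> /=]]; rewrite xpair_eqE andbF.
by apply: eq_count => b /=; case: (L b) => j []; rewrite !xpair_eqE ?andbT ?andbF ?orbF.
Qed.

Lemma content_filling :
  content T = [seq size (block D L i) | i <- iota 1 (\max_(b : seq_sub D) (L (val b)).1)].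
Proof.
rewrite /content /mkseq -[1]/(1 + 0) iotaDl -map_comp; apply: eq_map => i /=.
rewrite size_block -(count_seq_sub _ (uniq_skew_shifted mu al)) add1n.
by apply: eq_card => b; rewrite !inE.
Qed.

End Filling.

End Fillings.

(** * From tableaux to words *)

Lemma rev_pairwise (T : eqType) (r : rel T) s :
  pairwise r (rev s) = pairwise (fun x y => r y x) s.
Proof. by elim: s => //= x s IH; rewrite rev_cons pairwise_rcons all_rev IH. Qed.

Lemma legal_blocks s bs i : strict_partition s -> legal s (flatten bs) ->
  exists2 s', strict_partition s' & legal s' (nth [::] bs i ++ nth [::] bs i.+1).
Proof.
elim: bs s i => [|c bs IH] s [|i] hs /=; rewrite ?nth_nil; try by exists s.
  rewrite legal_cat => /andP[l1 l2]; exists s => //; rewrite legal_cat l1.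
  by case: bs l2 {IH} => //= c' bs; rewrite legal_cat => /andP[].
by rewrite legal_cat => /andP[l1 l2]; apply: IH l2; apply: strict_run.
Qed.

Section Tableau.

Variables (mu al : seq nat).
Hypotheses (hmu : strict_partition mu) (hal : strict_partition al).
Hypothesis sub : forall b, b \in shifted mu -> b \in shifted al.
Let D := skew_shifted al mu.

Variable L : nat * nat -> letter.
Hypothesis tabL : shifted_tableau (fun b : seq_sub D => L (val b)).

Let pos := let: And3 h _ _ := tableauP hmu hal tabL in h.
Let mono := let: And3 _ h _ := tableauP hmu hal tabL in h.
Let strictL := let: And3 _ _ h := tableauP hmu hal tabL in h.
Let convD := convexD hmu hal.
Let boxesD := boxD hmu hal.
Let rdD := readD mu al.

Lemma tableau_cells_sorted a : sorted gtn (cells D L a).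
Proof. exact: cells_sorted. Qed.

Definition block_boxes (i : nat) : seq (nat * nat) :=
  [seq b <- D | L b == marked i] ++ rev [seq b <- D | L b == unmarked i].

Lemma map_block_boxes i : map box_diag (block_boxes i) = block D L i.
Proof. by rewrite map_cat map_rev. Qed.

Lemma mem_block_boxes i b : (b \in block_boxes i) = (b \in D) && ((L b).1 == i).
Proof.
rewrite mem_cat mem_rev !mem_filter -andb_orl andbC; congr (_ && _).
by case: (L b) => j []; rewrite !xpair_eqE ?andbT ?andbF ?orbF.
Qed.

(** The order in which [block_boxes] lists the boxes. *)
Definition precedes (b c : nat * nat) : bool :=
  (code (L b) < code (L c)) ||
  (L b == L c) && (if (L b).2 then before c b else before b c).

Lemma precedes_nw b c : b \in D -> c \in D -> precedes b c -> ~~ nw c b.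
Proof.
move=> hb hc; apply: contraL => n; rewrite negb_or -leqNgt mono //= negb_and.
case: eqP => //= e; have e' : code (L c) = code (L b) by rewrite e.
have := strictL hc hb n e'; rewrite odd_code -e; case/andP: n.
by rewrite /before; case: (L b).2; clear; lia.
Qed.

Lemma block_boxes_linear m k :
  pairwise precedes (flatten [seq block_boxes i | i <- iota m k]).
Proof.
elim: k m => //= k IH m; rewrite pairwise_cat IH andbT; apply/andP; split.
  apply/allrelP => b c; rewrite mem_block_boxes => /andP[_ /eqP hb].
  case/flatten_mapP => i; rewrite mem_iota mem_block_boxes => /andP[lt _] /andP[_ /eqP hc].
  by rewrite /precedes /code hb hc; move: lt; case: (L b).2; case: (L c).2; clear; lia.
rewrite pairwise_cat rev_pairwise; apply/and3P; split.
- apply/allrelP => b c; rewrite mem_rev !mem_filter => /andP[/eqP e1 _] /andP[/eqP e2 _].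
  by rewrite /precedes e1 e2 code_marked code_unmarked ltnSn.
- apply: (@sub_in_pairwise _ [pred b | L b == marked m] before) => [b c||].
  + by rewrite !inE /precedes => /eqP-> /eqP->; rewrite eqxx /= ltnn.
  + exact: filter_all.
  + exact: pairwise_filter rdD.
- apply: (@sub_in_pairwise _ [pred b | L b == unmarked m] before) => [b c||].
  + by rewrite !inE /precedes => /eqP-> /eqP->; rewrite eqxx /= ltnn.
  + exact: filter_all.
  + exact: pairwise_filter rdD.
Qed.

Variable k : nat.
Hypothesis Lk : forall b, b \in D -> (L b).1 <= k.

Let bxs := flatten [seq block_boxes i | i <- iota 1 k].
Let bs := [seq block D L i | i <- iota 1 k].

Lemma map_all_boxes : map box_diag bxs = flatten bs.
Proof.
rewrite map_flatten -map_comp; congr flatten; apply: eq_map => i.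
exact: map_block_boxes.
Qed.

Lemma mem_all_boxes : bxs =i D.
Proof.
move=> b; apply/flatten_mapP/idP => [[i _]|hb]; first by rewrite mem_block_boxes => /andP[].
exists (L b).1; last by rewrite mem_block_boxes hb eqxx.
by rewrite mem_iota add1n ltnS pos // Lk.
Qed.

Lemma tableau_word :
  [/\ legal mu (flatten bs), run mu (flatten bs) = al & bxs = boxes mu (flatten bs)].
Proof.
have p : pairwise (fun b c => ~~ nw c b) bxs.
  apply: (@sub_in_pairwise _ [pred b | b \in D] precedes) => [b c hb hc||].
  - exact: precedes_nw.
  - by apply/allP => b; rewrite mem_all_boxes.
  - exact: block_boxes_linear.
rewrite -map_all_boxes; apply: linear_extension => //; last exact: mem_all_boxes.
by apply: pairwise_uniq p => b; rewrite /nw !leqnn.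
Qed.

Lemma nth_blocks i : nth [::] bs i = block D L i.+1.
Proof.
case: (ltnP i k) => ik; first by rewrite (nth_map 0) ?size_iota // nth_iota // add1n.
rewrite nth_default ?size_map ?size_iota //; apply/esym/size0nil.
rewrite size_block; apply/eqP; rewrite -leqn0 leqNgt -has_count; apply/hasP => -[b hb /eqP e].
by have := Lk hb; rewrite e ltnNge ik.
Qed.

Lemma tableau_LRS : LRS_word (map L D) <->
  (forall i, 0 < i -> block_ok D L i /\ ballot_pair (block D L i) (block D L i.+1)).
Proof.
apply: LRS_reading => // -[|i] // _.
have [l _ _] := tableau_word; have := legal_blocks i hmu l.
by rewrite !nth_blocks.
Qed.

Lemma sorted_blocks : (forall i, 0 < i -> block_ok D L i /\ ballot_pair (block D L i) (block D L i.+1)) ->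
  lrs bs.
Proof.
move=> h; apply/andP; split.
  by apply/allP => c /mapP[i]; rewrite mem_iota => /andP[i0 _] ->; case: (h i i0) => -[].
apply/(sortedP [::]) => i _; rewrite !nth_blocks; by have [_ b] := h i.+1 isT; exact: b.
Qed.

Lemma lettered_blocks m j : 0 < m -> (forall i, 0 < i -> block_ok D L i) ->
  lettered m [seq block D L i | i <- iota m j] =
  [seq (L b, box_diag b) | b <- flatten [seq block_boxes i | i <- iota m j]].
Proof.
move=> m0 ok; elim: j m m0 => //= j IH m m0; have [_ -> ->] := ok m m0.
rewrite IH // !map_cat -catA; congr (_ ++ _).
  rewrite /cells -map_comp; apply/eq_in_map => b.
  by rewrite mem_filter => /andP[/eqP-> _].
rewrite !map_rev /cells -map_comp; congr (rev _ ++ _); apply/eq_in_map => b.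
by rewrite mem_filter => /andP[/eqP-> _].
Qed.

End Tableau.

(** * From words to tableaux *)

Lemma map_nth_index (S T : eqType) (x0 : T) (s : seq S) (t : seq T) : uniq s ->
  size t = size s -> [seq nth x0 t (index x s) | x <- s] = t.
Proof.
move=> us e; apply: (@eq_from_nth _ x0); rewrite size_map // => i hi.
by case: s us e hi => // x s us e hi; rewrite (nth_map x) // index_uniq.
Qed.

Lemma pairwise_or (T : eqType) (r : rel T) s x y : pairwise r s -> x \in s -> y \in s ->
  x != y -> r x y \/ r y x.
Proof.
elim: s => //= z s IH /andP[/allP hz ps]; rewrite !inE.
move=> /predU1P[->|xs] /predU1P[->|ys]; rewrite ?eqxx // => ne.
- by left; apply: hz.
- by right; apply: hz.
- exact: IH.
Qed.

Definition lettered_lt (p q : letter * nat) : bool :=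
  (code p.1 < code q.1) || (p.1 == q.1) && (if p.1.2 then p.2 < q.2 else q.2 < p.2).

Lemma lettered_sorted i bs : all hook bs -> pairwise lettered_lt (lettered i bs).
Proof.
elim: bs i => //= c bs IH i /andP[hc hbs]; have later p : p \in lettered i.+1 bs -> i < p.1.1.
  by case: p => a y; rewrite mem_lettered => /andP[].
rewrite !pairwise_cat !allrel_catr IH // andbT; apply/and3P; split.
- apply/andP; split; apply/allrelP => p q /mapP[x _ ->].
    by case/mapP => y _ ->; rewrite /lettered_lt code_marked code_unmarked ltnSn.
  by case: q => [[j []] y] /later; rewrite /lettered_lt /code /=; clear; lia.
- rewrite pairwise_map; apply: sub_pairwise (_ : pairwise gtn _) => [x y|].
    by rewrite /lettered_lt /= eqxx ltnn.
  by rewrite -(sorted_pairwise gtn_trans) sorted_dpart.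
- apply/andP; split.
    apply/allrelP => p q /mapP[x _ ->].
    by case: q => [[j []] y] /later; rewrite /lettered_lt /code /=; clear; lia.
  rewrite pairwise_map; apply: sub_pairwise (_ : pairwise ltn _) => [x y|].
    by rewrite /lettered_lt /= eqxx ltnn.
  by rewrite -(sorted_pairwise ltn_trans).
Qed.

Lemma boxes_uniq s w : strict_partition s -> legal s w -> uniq (boxes s w).
Proof.
by move=> hs /(boxes_linear hs); apply: pairwise_uniq => b; rewrite /nw !leqnn.
Qed.

(** The filling that gives every box the letter by which it is added. *)
Definition fill (kap mu w : seq nat) (b : nat * nat) : letter :=
  nth (unmarked 0) (unzip1 (lettered 1 (reshape kap w))) (index b (boxes mu w)).

Section Fill.

Variables (mu al kap w : seq nat).
Hypotheses (hmu : strict_partition mu) (hal : strict_partition al) (kap0 : 0 \notin kap).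
Hypothesis sub : forall b, b \in shifted mu -> b \in shifted al.
Hypotheses (lw : legal mu w) (rw : run mu w = al) (ww : lrs_word kap w).
Let D := skew_shifted al mu.
Let L := fill kap mu w.
Let bs := reshape kap w.
Let bx := boxes mu w.

Let ew : flatten bs = w.
Proof. by case/andP: ww => /eqP e _; rewrite reshapeKr // e. Qed.

Let es : shape bs = kap.
Proof. by case/andP: ww => /eqP e _; rewrite reshapeKl // e. Qed.

Let sk : size bs = size kap.
Proof. by rewrite -es size_map. Qed.

Let mem_bx : bx =i D.
Proof. by move=> b; rewrite mem_boxes_skew // rw. Qed.

Let hooks : all hook bs.
Proof. by case/andP: ww => _ /andP[]. Qed.

Lemma fill_boxes : [seq (L b, box_diag b) | b <- bx] = lettered 1 bs.
Proof.
rewrite -zip_map map_boxes map_nth_index ?boxes_uniq //.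
  by rewrite -[X in zip _ X]ew -(unzip2_lettered 1) zip_unzip.
by rewrite -(size_map box_diag (boxes mu w)) map_boxes -[in RHS]ew -(unzip2_lettered 1 bs) !size_map.
Qed.

Lemma mem_fill a y : (exists b, [/\ b \in D, L b = a & box_diag b = y]) <->
  (a, y) \in lettered 1 bs.
Proof.
rewrite -fill_boxes; split=> [[b [hb <- <-]]|/mapP[b hb [-> ->]]].
  by apply/mapP; exists b; rewrite ?mem_bx.
by exists b; rewrite -mem_bx.
Qed.

Lemma fill_letter b : b \in D -> 0 < (L b).1 <= size kap.
Proof.
move=> hb; have : (L b, box_diag b) \in lettered 1 bs by apply/mem_fill; exists b.
rewrite mem_lettered => /andP[-> h]; rewrite leqNgt; apply/negP => lt; move: h.
rewrite nth_default; last by rewrite sk -ltnS subn1 (ltn_predK lt).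
by case: (L b).2.
Qed.

(** The letters of a word do not decrease, the contents follow the runs of a hook word,
   and no box comes after a box to its south-east. *)
Lemma fill_order (b c : nat * nat) : b \in D -> c \in D -> nw b c -> b != c ->
  lettered_lt (L b, box_diag b) (L c, box_diag c).
Proof.
move=> hb hc n ne; rewrite -mem_bx in hb; rewrite -mem_bx in hc.
have h1 := lettered_sorted 1 hooks; rewrite -fill_boxes pairwise_map in h1.
have h2 := boxes_linear hmu lw.
have := @pairwise_or _ [rel b c | lettered_lt (L b, box_diag b) (L c, box_diag c) && ~~ nw c b]
  bx b c.
rewrite (pairwise_relI _ (fun b c => ~~ nw c b)) h1 h2 => /(_ isT hb hc ne)[] /andP[] //=.
by rewrite n.
Qed.

Lemma fill_tableau : shifted_tableau (fun b : seq_sub D => L (val b)).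
Proof.
have le (b c : nat * nat) : b \in D -> c \in D -> nw b c -> leq_letter (L b) (L c).
  move=> hb hc n; rewrite leq_letterE; case: (eqVneq b c) => [->//|ne].
  by case/orP: (fill_order hb hc n ne) => [/ltnW|/andP[/eqP/= ->]].
apply/and5P; split; apply/forallP => b.
- by case/andP: (fill_letter (valP b)).
- apply/forallP => c; apply/implyP => /andP[/eqP e h].
  by apply: le (valP b) (valP c) _; rewrite /nw e leqnn.
- apply/forallP => c; apply/implyP => /andP[/eqP e h].
  by apply: le (valP b) (valP c) _; rewrite /nw e leqnn andbT.
- apply/forallP => c; apply/implyP => /and3P[/eqP e1 /eqP e2 m].
  apply/negPn/negP => ne; have {}ne : val b != val c by [].
  have m' : (L (val c)).2 = false by rewrite -e2; apply: negbTE.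
  case/orP: (leq_total (val b).2 (val c).2) => h.
    have n : nw (val b) (val c) by rewrite /nw e1 leqnn.
    have := fill_order (valP b) (valP c) n ne.
    by rewrite /lettered_lt /= e2 ltnn eqxx m' /box_diag e1; move: h; move: (val b).1 (val b).2 (val c).1 (val c).2 => ? ? ? ?; clear; lia.
  have n : nw (val c) (val b) by rewrite /nw e1 leqnn.
  rewrite eq_sym in ne; have := fill_order (valP c) (valP b) n ne.
  by rewrite /lettered_lt /= e2 ltnn eqxx m' /box_diag e1; move: h; move: (val b).1 (val b).2 (val c).1 (val c).2 => ? ? ? ?; clear; lia.
- apply/forallP => c; apply/implyP => /and3P[/eqP e1 /eqP e2 m].
  apply/negPn/negP => ne; have {}ne : val b != val c by [].
  have m' : (L (val c)).2 by rewrite -e2.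
  case/orP: (leq_total (val b).1 (val c).1) => h.
    have n : nw (val b) (val c) by rewrite /nw e1 leqnn andbT.
    have := fill_order (valP b) (valP c) n ne.
    by rewrite /lettered_lt /= e2 ltnn eqxx m' /box_diag e1; move: h; move: (val b).1 (val b).2 (val c).1 (val c).2 => ? ? ? ?; clear; lia.
  have n : nw (val c) (val b) by rewrite /nw e1 leqnn andbT.
  rewrite eq_sym in ne; have := fill_order (valP c) (valP b) n ne.
  by rewrite /lettered_lt /= e2 ltnn eqxx m' /box_diag e1; move: h; move: (val b).1 (val b).2 (val c).1 (val c).2 => ? ? ? ?; clear; lia.
Qed.

Let Lk b : b \in D -> (L b).1 <= size kap.
Proof. by case/fill_letter/andP. Qed.

Lemma cells_fill i : cells D L (marked i.+1) = dpart (nth [::] bs i) /\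
  cells D L (unmarked i.+1) = rev (apart (nth [::] bs i)).
Proof.
have hk : hook (nth [::] bs i).
  by case: (ltnP i (size bs)) => h; [exact: (allP hooks _ (mem_nth _ h)) | rewrite nth_default].
have mE a y : y \in cells D L a <-> (a, y) \in lettered 1 bs.
  by split=> [/mem_cells/mem_fill|/mem_fill/mem_cells].
have irr : irreflexive gtn by move=> x; apply: ltnn.
split; apply: (irr_sorted_eq gtn_trans irr); rewrite ?(tableau_cells_sorted hmu hal fill_tableau) //.
- exact: sorted_dpart.
- move=> y; apply/idP/idP => [/mE|h]; first by rewrite mem_lettered /= subSS subn0.
  by apply/mE; rewrite mem_lettered /= subSS subn0.
- by rewrite rev_sorted.
- move=> y; rewrite mem_rev; apply/idP/idP => [/mE|h]; first by rewrite mem_lettered /= subSS subn0.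
  by apply/mE; rewrite mem_lettered /= subSS subn0.
Qed.

Lemma block_fill i : block D L i.+1 = nth [::] bs i.
Proof. by have [e1 e2] := cells_fill i; rewrite /block e1 e2 revK cat_dpart. Qed.

Lemma blocks_fill : [seq block D L i | i <- iota 1 (size kap)] = bs.
Proof.
apply: (@eq_from_nth _ [::]); rewrite size_map size_iota // => i hi.
by rewrite (nth_map 0) ?size_iota // nth_iota // add1n block_fill.
Qed.

Lemma fill_LRS : LRS_tableau kap (fun b : seq_sub D => L (val b)).
Proof.
apply/and3P; split; first exact: fill_tableau.
  rewrite content_filling; set m := \max_(b : seq_sub D) _.
  suff -> : m = size kap by rewrite map_comp blocks_fill -/(shape bs) es.
  apply/eqP; rewrite eqn_leq; apply/andP; split.
    by apply/bigmax_leqP => b _; apply: Lk (valP b).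
  case ek: (size kap) => [//|k]; have kk : k < size kap by rewrite ek.
  have : 0 < size (block D L k.+1).
    rewrite block_fill -(nth_map _ 0) ?sk // -/(shape bs) es.
    by rewrite lt0n; apply: contraNneq kap0 => <-; apply: mem_nth.
  rewrite size_block -has_count => /hasP[b hb /eqP <-].
  exact: (leq_bigmax_cond (F := fun b : seq_sub D => (L (val b)).1) (SeqSub hb)).
rewrite word_filling; apply/(tableau_LRS hmu hal sub fill_tableau Lk) => -[//|i] _.
have [e1 e2] := cells_fill i; rewrite /block_ok !block_fill e1 e2 revK; split.
  split=> //; case: (ltnP i (size bs)) => h; first exact: (allP hooks _ (mem_nth _ h)).
  by rewrite nth_default.
case: (ltnP i.+1 (size bs)) => h; last by rewrite (nth_default _ h) ballot_pair_nil.
by case/andP: ww => _ /andP[_ /(sortedP [::])]; apply.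
Qed.

End Fill.

Lemma filling_word mu al kap (L : nat * nat -> letter) : strict_partition mu ->
  strict_partition al -> (forall b, b \in shifted mu -> b \in shifted al) ->
  LRS_tableau kap (fun b : seq_sub (skew_shifted al mu) => L (val b)) ->
  exists w, [/\ legal mu w, run mu w = al, lrs_word kap w
    & {in skew_shifted al mu, forall b, L b = fill kap mu w b}].
Proof.
move=> hmu hal sub /and3P[tab /eqP ec]; rewrite word_filling => lrsL.
set D := skew_shifted al mu in tab ec lrsL *.
have Lk b : b \in D -> (L b).1 <= size kap.
  move=> hb; rewrite -ec size_mkseq.
  exact: (leq_bigmax_cond (F := fun b : seq_sub D => (L (val b)).1) (SeqSub hb)).
have [l r eb] := tableau_word hmu hal sub tab Lk.
set bs := [seq _ | i <- iota 1 (size kap)] in l r eb.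
have hb := (tableau_LRS hmu hal sub tab Lk).1 lrsL.
have es : shape bs = kap.
  have ek : size kap = \max_(b : seq_sub D) (L (val b)).1 by rewrite -ec size_mkseq.
  by rewrite /shape /bs -map_comp ek -[RHS]ec content_filling.
exists (flatten bs); split => //.
  by rewrite -{1}es lrs_word_flatten; apply: sorted_blocks hb.
move=> b bD; rewrite /fill -{1}es flattenK -eb /bs lettered_blocks // => [|i i0]; last by case: (hb i i0).
rewrite /unzip1 -map_comp (nth_map b).
  by rewrite /= nth_index // (mem_all_boxes hmu hal tab Lk).
by rewrite index_mem (mem_all_boxes hmu hal tab Lk).
Qed.

(** * The structure constants *)

Lemma included_shifted s t : strict_partition s -> strict_partition t -> included s t ->
  forall b, b \in shifted s -> b \in shifted t.
Proof.
move=> hs ht /(included_cnt hs ht) h [r c]; rewrite !mem_shifted // => /andP[-> lt] /=.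
exact: leq_trans lt (h _).
Qed.

(** A word is recovered from its filling by [blocks_fill], and by [filling_word] every
   tableau is the filling of a word. *)
Lemma num_LRS_words n mu al kap : strict_partition mu -> strict_partition al ->
  included mu al -> bounded n al -> 0 \notin kap ->
  num_LRS (skew_shifted al mu) kap = num_words n (lrs_word kap) (sumn kap) mu al.
Proof.
move=> hmu hal inc hb k0; have sub := included_shifted hmu hal inc.
have [s [us ms <-]] := num_LRSP (skew_shifted al mu) kap.
set D := skew_shifted al mu in s us ms *.
pose W := [seq w <- words n (sumn kap) | [&& lrs_word kap w, legal mu w & run mu w == al]].
have memW w : w \in W = [&& lrs_word kap w, legal mu w & run mu w == al].
  rewrite mem_filter andb_idr // => /and3P[ww l /eqP r].
  by rewrite -(lrs_word_size ww); apply: mem_words_run l _; rewrite // r.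
have ffunE' L : LRS_tableau kap [ffun b : seq_sub D => L (val b)] =
    LRS_tableau kap (fun b : seq_sub D => L (val b)).
  by apply: eq_LRS_tableau => b; rewrite ffunE.
pose F w : {ffun seq_sub D -> letter} := [ffun b => fill kap mu w (val b)].
rewrite /num_words -size_filter -/W -(size_map F W).
apply/perm_size/uniq_perm => //.
  rewrite map_inj_in_uniq; first by rewrite filter_uniq // words_uniq.
  move=> w w'; rewrite !memW => /and3P[ww l /eqP r] /and3P[ww' l' /eqP r'] /ffunP e.
  have {}e b : b \in D -> fill kap mu w b = fill kap mu w' b.
    by move=> hD; have := e (SeqSub hD); rewrite !ffunE.
  have wE v : lrs_word kap v -> flatten (reshape kap v) = v.
    by case/andP => /eqP ev _; rewrite reshapeKr // ev.
  rewrite -(wE w ww) -(wE w' ww').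
  rewrite -(blocks_fill hmu hal l r ww) -(blocks_fill hmu hal l' r' ww').
  congr flatten; apply: eq_map => i; rewrite /block /cells.
  by congr (_ ++ rev _); congr map; apply: eq_in_filter => b /e ->.
move=> T; rewrite ms; apply/idP/mapP => [hT|[w]].
  pose L b := oapp T (unmarked 0) (insub b).
  have eT : T =1 (fun b => L (val b)) by move=> b; rewrite /L valK.
  rewrite (eq_LRS_tableau _ eT) in hT.
  have [w [l r ww e]] := filling_word hmu hal sub hT.
  exists w; first by rewrite memW ww l r eqxx.
  by apply/ffunP => b; rewrite ffunE eT e //; exact: (valP b).
rewrite memW => /and3P[ww l /eqP r] ->; rewrite ffunE'.
exact: fill_LRS.
Qed.

Lemma f_LRS_lr n (lam mu nu : spart n) : f_LRS n lam mu nu = lr lam mu nu.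
Proof.
have hmu := spart_strict mu; have hal := strict_dual n lam.
rewrite /f_LRS /lr; case: ifP => inc.
  apply: num_LRS_words => //; first exact: bounded_dual.
  by have /andP[] := strict_dual n nu.
apply/esym/eqP; rewrite -leqn0 leqNgt -has_count; apply/hasP => -[w _ /and3P[_ l /eqP r]].
case/negP: (negbT inc); apply/(included_cnt hmu hal) => z.
by rewrite -r cnt_run // leq_addr.
Qed.

Theorem theorem2 (n : nat) (n_ge1 : 1 <= n) (H : comNzRingType)
    (tau : spart n -> H) (htau : schubert_classes tau) (lam mu nu : spart n) :
  Zcoef (schubert_basis htau) (tau lam * tau mu)%R nu = Posz (f_LRS n lam mu nu).
Proof. by rewrite Zcoef_schubert f_LRS_lr. Qed.
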